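(* Let $\mathfrak{A}$ be a unital $C^*$-algebra. For a stationary quantum stochastic process with sample algebra $\mathfrak{A}$ and distribution $\varphi\in\mathcal{S}(\ast_{\mathbb{N}}\mathfrak{A})$, the following are equivalent: (i) the process is weakly spreadable; (ii) the tail algebra $\mathcal{T}_\varphi$ is expected with a unique shift-invariant, normal, $\varphi$-invariant conditional expectation, which is also forward-decoupling; that is, there exists a unique normal conditional expectation $E:\mathcal{R}_{\varphi_{\mathbb{Z}}}\to\mathcal{T}_{\varphi_{\mathbb{Z}}}$ which is shift-invariant and $\varphi$-invariant, and this $E$ satisfies the forward-decoupling condition.
   Context: $\mathbb{N}=\{0,1,2,\dots\}$. $\ast_{\mathbb{N}}\mathfrak{A}$ and $\ast_{\mathbb{Z}}\mathfrak{A}$ are the unital free product $C^*$-algebras (units amalgamated) of copies of $\mathfrak{A}$ indexed by $\mathbb{N}$, resp. $\mathbb{Z}$, with canonical unital embeddings $i_j$; $\ast_{\mathbb{N}}\mathfrak{A}\subset\ast_{\mathbb{Z}}\mathfrak{A}$; $\tau$ is the shift, $\tau(i_j(a))=i_{j+1}(a)$. A (unital) quantum stochastic process with sample algebra $\mathfrak{A}$ is a quadruple $(\mathfrak{B},\omega,\mathfrak{A},\{\iota_j\}_{j\in\mathbb{N}})$ with $\mathfrak{B}$ a unital $C^*$-algebra, $\omega$ a state on $\mathfrak{B}$, and $\iota_j:\mathfrak{A}\to\mathfrak{B}$ unital $*$-homomorphisms; its distribution is the state $\varphi$ on $\ast_{\mathbb{N}}\mathfrak{A}$ with $\varphi(i_{j_1}(a_1)\cdots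 i_{j_n}(a_n))=\omega(\iota_{j_1}(a_1)\cdots\iota_{j_n}(a_n))$ (every state on $\ast_{\mathbb{N}}\mathfrak{A}$ arises this way). The process is stationary if $\varphi\circ\tau=\varphi$. For finite $F\subset\mathbb{N}$, $\ast_F\mathfrak{A}$ is the $C^*$-subalgebra generated by the unit and $i_j(\mathfrak{A})$, $j\in F$; $x\in\ast_{\mathbb{N}}\mathfrak{A}$ is localized with support contained in $F$ if $x\in\ast_F\mathfrak{A}$. $F>G$ means $\min F>\max G$. The process is weakly spreadable if $\varphi(xyz)=\varphi(x\tau(y)z)$ for all localized $x,y,z\in\ast_{\mathbb{N}}\mathfrak{A}$ with supports contained in finite sets $F_x,F_y,F_z$ with $F_y>F_x\cup F_z$. $\varphi_{\mathbb{Z}}$ is the unique shift-invariant state on $\ast_{\mathbb{Z}}\mathfrak{A}$ extending $\varphi$, with GNS triple $(\pi_{\varphi_{\mathbb{Z}}},\mathcal{H}_{\varphi_{\mathbb{Z}}},\xi_{\varphi_{\mathbb{Z}}})$. $\mathcal{R}_{\varphi_{\mathbb{Z}}}:=\pi_{\varphi_{\mathbb{Z}}}(\ast_{\mathbb{N}}\mathfrak{A})''$, $\mathcal{T}_{\varphi_{\mathbb{Z}}}:=\bigcap_{n\in\mathbb{N}}\{\pi_{\varphi_{\mathbb{Z}}}(i_k(\mathfrak{A})):k\ge n\}''$, and $\mathcal{T}_\varphi:=\bigcap_{n\in\mathbb{N}}\{\pi_\varphi(i_k(\mathfrak{A})):k\ge n\}''$ in the GNS representation $\pi_\varphi$ of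 $\varphi$. The tail algebra is said to be expected if there exists a normal conditional expectation from $\mathcal{R}_{\varphi_{\mathbb{Z}}}$ onto $\mathcal{T}_{\varphi_{\mathbb{Z}}}$. A normal conditional expectation onto a von Neumann subalgebra $\mathcal{N}\subset\mathcal{M}$ is a normal, contractive, completely positive projection $E:\mathcal{M}\to\mathcal{N}$ onto $\mathcal{N}$ with $E(nmn')=nE(m)n'$. $E:\mathcal{R}_{\varphi_{\mathbb{Z}}}\to\mathcal{T}_{\varphi_{\mathbb{Z}}}$ is shift-invariant if $E(\pi_{\varphi_{\mathbb{Z}}}(\tau(x)))=E(\pi_{\varphi_{\mathbb{Z}}}(x))$ for all $x\in\ast_{\mathbb{N}}\mathfrak{A}$; $\varphi$-invariant if $\langle E(T)\xi_{\varphi_{\mathbb{Z}}},\xi_{\varphi_{\mathbb{Z}}}\rangle=\langle T\xi_{\varphi_{\mathbb{Z}}},\xi_{\varphi_{\mathbb{Z}}}\rangle$ for all $T\in\mathcal{R}_{\varphi_{\mathbb{Z}}}$; forward-decoupling if $E(XYZ)=E(XE(Y)Z)$ for all $X\in\pi_{\varphi_{\mathbb{Z}}}(\ast_{F_X}\mathfrak{A})''$, $Y\in\pi_{\varphi_{\mathbb{Z}}}(\ast_{F_Y}\mathfrak{A})''$, $Z\in\pi_{\varphi_{\mathbb{Z}}}(\ast_{F_Z}\mathfrak{A})''$ with $F_X,F_Y,F_Z\subset\mathbb{N}$ finite and $F_Y>F_X\cup F_Z$. *)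

(* Defs.v *)
From HB Require Import structures.
From mathcomp Require Import all_boot all_order all_algebra.
From mathcomp Require Import sesquilinear complex.
From mathcomp Require Import all_classical all_reals.
From mathcomp Require Import topology normedtype sequences.

Set Implicit Arguments.
Unset Strict Implicit.
Unset Printing Implicit Defensive.

Import Order.TTheory GRing.Theory Num.Theory.
Import numFieldNormedType.Exports.

Local Open Scope classical_set_scope.
Local Open Scope ring_scope.

(* Everything is parametrised by C : numClosedFieldType so that C carries the
   topology of a numFieldType; it is meant to be used with C := R[i] for
   R : realType, the field of complex numbers. Norms take values in C, and
   0 <= z in C means that z is a nonnegative real. *)

(* A unital C*-algebra. The norm is a field of its own because the ring and
   normed-module hierarchies of the libraries are only joined for numeric
   domains. algType requires 1 != 0, so the zero algebra (which has no states)
   is excluded. *)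
HB.mixin Record isCStarAlgebra (C : numClosedFieldType) A
    & GRing.Algebra C A := {
  star : A -> A;
  starK : involutive star;
  starD : {morph star : x y / x + y};
  starZ : forall (a : C) x, star (a *: x) = a^* *: star x;
  starM : forall x y, star (x * y) = star y * star x;
  cnorm : A -> C;
  cnorm_ge0 : forall x, 0 <= cnorm x;
  cnorm_eq0 : forall x, cnorm x = 0 -> x = 0;
  ler_cnormD : forall x y, cnorm (x + y) <= cnorm x + cnorm y;
  cnormZ : forall (a : C) x, cnorm (a *: x) = `|a| * cnorm x;
  ler_cnormM : forall x y, cnorm (x * y) <= cnorm x * cnorm y;
  cnorm_star : forall x, cnorm (star x * x) = cnorm x ^+ 2;
  cnorm_complete : forall u : nat -> A,
    (forall e : C, 0 < e -> exists N, forall m n,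
       (N <= m)%N -> (N <= n)%N -> cnorm (u m - u n) < e) ->
    exists l, forall e : C, 0 < e -> exists N, forall n,
       (N <= n)%N -> cnorm (u n - l) < e
}.

#[short(type="cstarType")]
HB.structure Definition CStarAlgebra (C : numClosedFieldType) :=
  {A of GRing.Algebra C A & isCStarAlgebra C A}.

(* hdot is linear in its first argument and conjugate-linear in the second. *)
HB.mixin Record isHilbert (C : numClosedFieldType) H
    & CompleteNormedModule C H := {
  hdot : {dot H for (@Num.conj C)};
  normr_hdot : forall u : H, `|u| ^+ 2 = hdot u u
}.

#[short(type="hilbertType")]
HB.structure Definition Hilbert (C : numClosedFieldType) :=
  {H of CompleteNormedModule C H & isHilbert C H}.

Section CStarAlgebras.
Context {C : numClosedFieldType}.

Record starHom (A B : cstarType C) := StarHom {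
  starHom_fun :> {lrmorphism A -> B};
  starHomP : {morph starHom_fun : x / star x}
}.

Record state (A : cstarType C) := State {
  state_fun :> {scalar A};
  state_ge0 : forall x, 0 <= state_fun (star x * x);
  state1 : state_fun 1 = 1
}.

Definition cstar_subalgebra (A : cstarType C) (B : set A) :=
  [/\ forall x, (forall e : C, 0 < e -> exists2 y, B y & cnorm (x - y) < e) ->
        B x,
      B 1,
      forall (a : C) x y, B x -> B y -> B (a *: x + y),
      forall x y, B x -> B y -> B (x * y)
    & forall x, B x -> B (star x)].

(* The unital free product of copies of A indexed by J (units amalgamated),
   i.e. the coproduct in the category of unital C*-algebras. *)
Record freeProduct (J : Type) (A : cstarType C) := FreeProduct {
  fp_alg :> cstarType C;
  fp_in : J -> starHom A fp_alg;
  fp_univ : forall (D : cstarType C) (f : J -> starHom A D),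
    exists2 g : starHom fp_alg D,
      forall j a, g (fp_in j a) = f j a
    & forall g' : starHom fp_alg D,
        (forall j a, g' (fp_in j a) = f j a) -> g' =1 g
}.

Definition fp_lift (J : Type) (A : cstarType C) (P : freeProduct J A)
    (D : cstarType C) (f : J -> starHom A D) : starHom P D :=
  projT1 (cid2 (fp_univ P f)).

Definition fp_local (J : Type) (A : cstarType C) (P : freeProduct J A)
    (F : set J) : set P :=
  smallest (@cstar_subalgebra P) (\bigcup_(j in F) range (fp_in P j)).

Definition shiftN (A : cstarType C) (PN : freeProduct nat A) : starHom PN PN :=
  fp_lift PN (fun j => fp_in PN j.+1).

Definition shiftZ (A : cstarType C) (PZ : freeProduct int A) : starHom PZ PZ :=
  fp_lift PZ (fun j => fp_in PZ (j + 1)).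

Definition embNZ (A : cstarType C) (PN : freeProduct nat A)
    (PZ : freeProduct int A) : starHom PN PZ :=
  fp_lift PN (fun j => fp_in PZ j%:Z).

End CStarAlgebras.

Record qprocess (C : numClosedFieldType) (A : cstarType C) := QProcess {
  qp_alg : cstarType C;
  qp_state : state qp_alg;
  qp_hom : nat -> starHom A qp_alg
}.

Section Processes.
Context {C : numClosedFieldType} {A : cstarType C}.
Context {PN : freeProduct nat A} {PZ : freeProduct int A}.

Definition is_distribution (X : qprocess A) (phi : state PN) :=
  forall w : seq (nat * A),
    phi (\prod_(p <- w) fp_in PN p.1 p.2)
    = qp_state X (\prod_(p <- w) qp_hom X p.1 p.2).

Definition stationary (phi : state PN) := forall x, phi (shiftN PN x) = phi x.

Definition set_gt (F G : set nat) := forall i j, F i -> G j -> (j < i)%N.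

Definition weakly_spreadable (phi : state PN) :=
  forall Fx Fy Fz : set nat,
    finite_set Fx -> finite_set Fy -> finite_set Fz ->
    set_gt Fy (Fx `|` Fz) ->
  forall x y z, fp_local Fx x -> fp_local Fy y -> fp_local Fz z ->
    phi (x * y * z) = phi (x * shiftN PN y * z).

Definition stationary_extension (phi : state PN) (phiZ : state PZ) :=
  (forall x, phiZ (shiftZ PZ x) = phiZ x) /\
  (forall x, phiZ (embNZ PN PZ x) = phi x).

End Processes.

Section Operators.
Context {C : numClosedFieldType} {H : hilbertType C}.
Implicit Types (S T : H -> H) (M N : set (H -> H)) (u v : nat -> H).

(* B(H) is represented as a subset of the vector space H -> H. *)
Definition bounded_op : set (H -> H) :=
  [set T | linear T /\ exists c : C, forall x, `|T x| <= c * `|x|].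

Definition commutant M : set (H -> H) :=
  [set T | bounded_op T /\ forall S, M S -> S \o T = T \o S].

Definition bicommutant M := commutant (commutant M).

Definition square_summable u :=
  cvgn (series (fun n => `|u n| ^+ 2 : C)).

Definition normal_functional u v T : C :=
  limn (series (fun n => hdot (T (u n)) (v n))).

Definition sigma_weak_cvg (F : set_system (H -> H)) T :=
  forall u v, square_summable u -> square_summable v ->
    normal_functional u v S @[S --> F] --> normal_functional u v T.

(* Positivity in M_n(B(H)), identified with B(H^n). *)
Definition positive_opmx n (T : 'I_n -> 'I_n -> H -> H) :=
  forall x : 'I_n -> H, 0 <= \sum_i \sum_j hdot (T i j (x j)) (x i).

(* Only the restriction of E to M is constrained. *)
Record normal_condexp M N (E : (H -> H) -> (H -> H)) : Prop := {
  condexp_sub : forall T, M T -> N (E T);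
  condexp_id : forall T, N T -> E T = T;
  condexp_linear : forall (a : C) S T, M S -> M T ->
    E (a *: S + T) = a *: E S + E T;
  condexp_bimodule : forall S T S', N S -> M T -> N S' ->
    E (S \o T \o S') = S \o E T \o S';
  condexp_contractive : forall T (c : C), M T -> 0 <= c ->
    (forall x, `|T x| <= c * `|x|) -> forall x, `|E T x| <= c * `|x|;
  condexp_cp : forall n (T : 'I_n -> 'I_n -> H -> H),
    (forall i j, M (T i j)) -> positive_opmx T ->
    positive_opmx (fun i j => E (T i j));
  (* continuity on M for the sigma-weak topology *)
  condexp_normal : forall (F : set_system (H -> H)) T,
    ProperFilter F -> F M -> M T ->
    sigma_weak_cvg F T -> sigma_weak_cvg (E @ F) (E T)
}.

End Operators.

Record starRep (C : numClosedFieldType) (P : cstarType C)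
    (H : hilbertType C) := StarRep {
  rep_fun :> P -> H -> H;
  rep_bounded : forall x, bounded_op (rep_fun x);
  rep_linear : forall (a : C) x y,
    rep_fun (a *: x + y) = a *: rep_fun x + rep_fun y;
  rep1 : rep_fun 1 = id;
  repM : forall x y, rep_fun (x * y) = rep_fun x \o rep_fun y;
  rep_star : forall x h k,
    hdot (rep_fun (star x) h) k = hdot h (rep_fun x k)
}.

Definition is_GNS (C : numClosedFieldType) (P : cstarType C)
    (H : hilbertType C) (phi : state P) (pi : starRep P H) (xi : H) :=
  (forall x, phi x = hdot (pi x xi) xi) /\
  closure (range (fun x => pi x xi)) = setT.

Section TailAlgebra.
Context {C : numClosedFieldType} {A : cstarType C}.
Variables (PN : freeProduct nat A) (PZ : freeProduct int A).
Variables (H : hilbertType C) (pi : starRep PZ H) (xi : H).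

Definition local_vna (F : set nat) : set (H -> H) :=
  bicommutant ((fun x => pi (embNZ PN PZ x)) @` fp_local F).

Definition future_vna : set (H -> H) :=
  bicommutant (range (fun x : PN => pi (embNZ PN PZ x))).

Definition tail_vna : set (H -> H) :=
  \bigcap_n bicommutant
    [set T | exists2 k : nat, (n <= k)%N & exists a, T = pi (fp_in PZ k%:Z a)].

Implicit Type E : (H -> H) -> (H -> H).

Definition shift_invariant E :=
  forall x : PN, E (pi (embNZ PN PZ (shiftN PN x))) = E (pi (embNZ PN PZ x)).

Definition state_invariant E :=
  forall T, future_vna T -> hdot (E T xi) xi = hdot (T xi) xi.

Definition forward_decoupling E :=
  forall FX FY FZ : set nat,
    finite_set FX -> finite_set FY -> finite_set FZ ->
    set_gt FY (FX `|` FZ) ->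
  forall X Y Z, local_vna FX X -> local_vna FY Y -> local_vna FZ Z ->
    E (X \o Y \o Z) = E (X \o E Y \o Z).

Definition invariant_condexp E :=
  [/\ normal_condexp future_vna tail_vna E, shift_invariant E
    & state_invariant E].

End TailAlgebra.

(* Main.v *)
Require Import Defs.
From HB Require Import structures.
From mathcomp Require Import all_boot all_order all_algebra.
From mathcomp Require Import sesquilinear complex.
From mathcomp Require Import all_classical all_reals.
From mathcomp Require Import topology normedtype sequences.
From mathcomp Require Import zify ring lra.

Set Implicit Arguments.
Unset Strict Implicit.
Unset Printing Implicit Defensive.

Import Order.TTheory GRing.Theory Num.Theory.
Import numFieldNormedType.Exports.

Local Open Scope classical_set_scope.
Local Open Scope ring_scope.

(** Why the theorem is true.

    Let U be the unitary of H that implements the shift, alpha the conjugation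
    by U, and R the von Neumann algebra of the nonnegative indices.  Call a
    vector past if it is U^-n pi(x) xi for some x supported in {0, ..., n-1}.

    For T = pi(y) and past vectors h, k the number <T h, k> is a value of phi on
    a product z^* tau^n(y) x whose middle factor lies beyond the outer ones, and
    weak spreadability says exactly that this value does not change when T is
    replaced by alpha(T).  The identity only involves two pairs of vectors, so
    it passes from pi(y) to every T in R by von Neumann's density theorem
    (bicommutant_density, future_constant).  A dense set of vectors becomes past
    after finitely many backward shifts.  Hence the matrix coefficients of
    alpha^n(T) are eventually constant on a dense set, the operators alpha^n(T)
    converge weakly, and their limit E(T) (tail_limit) is the expectation: it
    lies in every tail because alpha^n(T) does from some n on; the same
    constancy shows that alpha fixes the tail algebra, so E is the identity
    there and is a bimodule map; contractivity, complete positivity, shift and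
    state invariance pass to the limit.

    Three points need more.

    Normality.  On vectors of the dense set, a coefficient of E(T) is a
    coefficient of T itself.  Expanding two square-summable sequences in rapidly
    convergent series of such vectors turns a normal functional of E(T) into an
    absolutely convergent triple series of coefficients of T, which is again a
    normal functional of T (normal_functional_pullback).

    Uniqueness.  Let E' be another invariant normal expectation.  Since
    alpha^n(pi(x)) is bounded and tends weakly to E(pi(x)), it does so
    sigma-weakly; E' does not see the shift and fixes the tail algebra, so
    E'(pi(x)) = E(pi(x)).  The operators pi(x) are sigma-weakly dense in R
    (bicommutant_sigma_weak), and both maps are normal.

    Decoupling.  If Y lies beyond X and Z, then the coefficients of alpha^n(Y)
    between Z h and X^* k, for past h and k, do not depend on n: these vectors
    are limits of vectors that are past relative to the support of Y
    (decoupling_constant).  So Y can be replaced by its limit E(Y).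

    Conversely, forward decoupling and the two invariances give
    phi(x y z) = <E(X Y Z) xi, xi> = <E(X E(Y) Z) xi, xi>, and E(Y) is unchanged
    when Y is shifted (decoupling_spreadable).

    The operator theory behind this is the projection theorem, the Riesz
    representation, the Hilbert space of square-summable sequences (the
    amplification in which the density theorem is proved), and the continuity
    of *-homomorphisms and representations.  The universal property of the free
    product enters through fp_generated: a C*-subalgebra that contains all the
    copies of A is everything. *)

(** * Complex numbers with real-valued moduli *)

(** A name for the structure of complex numbers that does not reduce, so that its
    topology is found in the same way as for an abstract field. *)
Definition Cx (R : realType) : numClosedFieldType := R[i].

Section ComplexNumbers.
Variable R : realType.
Local Notation C := (Cx R).
Implicit Types (x y : R) (z w : C).

Definition toC (x : R) : C := x%:C%C.
Definition reC (z : C) : R := complex.Re z.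
Definition imC (z : C) : R := complex.Im z.
Definition abs (z : C) : R := reC `|z|.

Fact toC_additive : zmod_morphism toC.
Proof. exact: raddfB. Qed.
HB.instance Definition _ := GRing.isZmodMorphism.Build R C toC toC_additive.

Fact toC_multiplicative : monoid_morphism toC.
Proof. split; [exact: rmorph1|exact: rmorphM]. Qed.
HB.instance Definition _ :=
  GRing.isMonoidMorphism.Build R C toC toC_multiplicative.

Fact reC_additive : zmod_morphism reC.
Proof. by case=> a b [c d]. Qed.
HB.instance Definition _ := GRing.isZmodMorphism.Build C R reC reC_additive.

Fact imC_additive : zmod_morphism imC.
Proof. by case=> a b [c d]. Qed.
HB.instance Definition _ := GRing.isZmodMorphism.Build C R imC imC_additive.

Lemma toCK x : reC (toC x) = x. Proof. by []. Qed.
Lemma ler_toC x y : (toC x <= toC y) = (x <= y). Proof. exact: lecR. Qed.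
Lemma ltr_toC x y : (toC x < toC y) = (x < y). Proof. exact: ltcR. Qed.

Lemma toC_ge0 x : (0 <= toC x) = (0 <= x). Proof. exact: lecR. Qed.
Lemma toC_gt0 x : (0 < toC x) = (0 < x). Proof. exact: ltcR. Qed.

Lemma ge0_toC z : 0 <= z -> z = toC (reC z).
Proof.
case: z => a b; rewrite /= lecE /= => /andP[/eqP -> _]; rewrite /toC /reC /=.
by [].
Qed.

Lemma reC_ge0 z : 0 <= z -> 0 <= reC z.
Proof. by case: z => a b; rewrite /= lecE /= => /andP[]. Qed.

Lemma absE z : `|z| = toC (abs z).
Proof. by rewrite {1}(@ge0_toC `|z|) ?normr_ge0. Qed.

Lemma abs_ge0 z : 0 <= abs z. Proof. by rewrite reC_ge0. Qed.
Lemma abs0 : abs 0 = 0. Proof. by rewrite /abs normr0 raddf0. Qed.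
Lemma absD z w : abs (z + w) <= abs z + abs w.
Proof. by rewrite -ler_toC raddfD /= -!absE ler_normD. Qed.
Lemma absM z w : abs (z * w) = abs z * abs w.
Proof. by apply: (fmorph_inj toC); rewrite rmorphM /= -!absE normrM. Qed.
Lemma absN z : abs (- z) = abs z. Proof. by rewrite /abs normrN. Qed.
Lemma absB z w : abs (z - w) = abs (w - z). Proof. by rewrite /abs distrC. Qed.
Lemma abs_eq0 z : abs z = 0 -> z = 0.
Proof. by move=> h; apply/normr0_eq0; rewrite absE h raddf0. Qed.
Lemma abs_conj z : abs z^* = abs z. Proof. by rewrite /abs norm_conjC. Qed.
Lemma abs_toC x : abs (toC x) = `|x|.
Proof.
have [x0|x0] := leP 0 x.
  by rewrite /abs ger0_norm ?toC_ge0 // toCK ger0_norm.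
by rewrite -absN -raddfN /= /abs ger0_norm ?toC_ge0 ?oppr_ge0 ?ltW // toCK ltr0_norm.
Qed.
Lemma abs_sum (I : Type) (r : seq I) (P : pred I) (F : I -> C) :
  abs (\sum_(i <- r | P i) F i) <= \sum_(i <- r | P i) abs (F i).
Proof.
elim/big_ind2 : _ => [|z a w b za wb|//]; first by rewrite abs0.
by apply: le_trans (absD _ _) _; apply: lerD.
Qed.

Lemma abs_def z : abs z ^+ 2 = reC z ^+ 2 + imC z ^+ 2.
Proof.
apply: (fmorph_inj toC); rewrite rmorphXn /= -absE.
by case: z => a b; rewrite -(@add_Re2_Im2 R).
Qed.

Lemma reC_le_abs z : `|reC z| <= abs z.
Proof.
rewrite -[leRHS]ger0_norm ?abs_ge0 // -ler_sqr ?nnegrE // !real_normK ?num_real //.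
by rewrite abs_def lerDl sqr_ge0.
Qed.
Lemma imC_le_abs z : `|imC z| <= abs z.
Proof.
rewrite -[leRHS]ger0_norm ?abs_ge0 // -ler_sqr ?nnegrE // !real_normK ?num_real //.
by rewrite abs_def lerDr sqr_ge0.
Qed.
Lemma abs_le_reim z : abs z <= `|reC z| + `|imC z|.
Proof.
rewrite -ler_sqr ?nnegrE ?abs_ge0 ?addr_ge0 // abs_def sqrrD !real_normK ?num_real //.
by rewrite -addrA lerD2l lerDr mulrn_wge0 // mulr_ge0.
Qed.

Lemma conj_toC x : (toC x)^* = toC x.
Proof.
apply/CrealP; rewrite realE -(raddf0 toC : toC 0 = 0) !ler_toC; exact: num_real.
Qed.
Lemma reC_conj z : reC z^* = reC z.
Proof. by case: z. Qed.
Lemma mulC_conj z : z * z^* = toC (abs z ^+ 2).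
Proof. by rewrite rmorphXn /= -absE normCK. Qed.
Lemma reCi z : reC ('i * z) = - imC z.
Proof.
by rewrite -[('i : C)]complexiE; case: z => a b; rewrite /reC /imC /= mul0r mul1r sub0r.
Qed.

End ComplexNumbers.

(** * Null sequences of reals *)

Section NullSequences.
Variable R : realType.
Implicit Types (s t : nat -> R) (c : R).

(** One-sided, since it is applied to norms; a constant sequence with this property
    is nonpositive, which is how limits of inequalities are taken. *)
Definition to0 s := forall e : R, 0 < e ->
  exists N, forall n, (N <= n)%N -> s n < e.

Lemma to0_le s t : to0 t -> (forall n, s n <= t n) -> to0 s.
Proof.
move=> t0 st e /t0[N hN]; exists N => n /hN; exact: le_lt_trans.
Qed.

Lemma to0D s t : to0 s -> to0 t -> to0 (fun n => s n + t n).
Proof.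
move=> s0 t0 e e0; have e2 : 0 < e / 2 by rewrite divr_gt0.
have [N hN] := s0 _ e2; have [M hM] := t0 _ e2.
exists (maxn N M) => n; rewrite geq_max => /andP[/hN ? /hM ?]; lra.
Qed.

Lemma to0Z c s : 0 <= c -> to0 s -> to0 (fun n => c * s n).
Proof.
move=> c0 s0 e e0; have c1 : 0 < c + 1 by lra.
have [N hN] := s0 (e / (c + 1)) (divr_gt0 e0 c1).
exists N => n /hN; rewrite ltr_pdivlMr // => h.
have [sn|sn] := leP 0 (s n); first by nra.
by nra.
Qed.

Lemma to0_cst0 : to0 (fun=> 0).
Proof. by move=> e e0; exists 0%N. Qed.

Lemma to0_eventually s t : to0 t ->
  (exists N, forall n, (N <= n)%N -> s n <= t n) -> to0 s.
Proof.
move=> t0 [M hM] e /t0[N hN]; exists (maxn N M) => n.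
by rewrite geq_max => /andP[/hN ? /hM ?]; apply: le_lt_trans; eauto.
Qed.

Lemma to0_sub s (f : nat -> nat) : (forall n, (n <= f n)%N) ->
  to0 s -> to0 (fun n => s (f n)).
Proof.
by move=> nf s0 e /s0[N hN]; exists N => n nN; apply: hN; apply: leq_trans (nf n).
Qed.

Lemma to0_const c : to0 (fun=> c) -> c <= 0.
Proof.
by move=> h; rewrite leNgt; apply/negP => c0; have [N /(_ N (leqnn _))] := h _ c0; rewrite ltxx.
Qed.

Lemma to0_invS : to0 (fun n => n.+1%:R^-1).
Proof.
move=> e e0; have [N hN] : exists N, e^-1 < N.+1%:R.
  exists (Num.truncn e^-1).
  by apply: (@truncnS_gt R).
exists N => n Nn; rewrite invf_plt ?posrE // (lt_le_trans hN) // ler_nat.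
by rewrite ltnS.
Qed.

Lemma nat_le_pow2 n : (n.+1 <= 2 ^ n)%N.
Proof. by elim: n => // n IH; rewrite expnS mul2n -addnn; lia. Qed.

Lemma to0_pow2 : to0 (fun n => 2^-1 ^+ n).
Proof.
apply: to0_le to0_invS _ => n; rewrite exprVn lef_pV2 ?posrE ?exprn_gt0 //.
by rewrite -natrX ler_nat nat_le_pow2.
Qed.

Lemma monotone_tends s B : (forall n, s n <= s n.+1) -> (forall n, s n <= B) ->
  exists l, [/\ (forall n, s n <= l), l <= B & to0 (fun n => l - s n)].
Proof.
move=> inc bd; have mono : {homo s : m n / (m <= n)%N >-> m <= n}.
  by apply: homo_leq => //; exact: le_trans.
have hs : has_sup (range s).
  by split; [exists (s 0%N), 0%N|exists B => _ [n _ <-]].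
exists (sup (range s)); split.
- by move=> n; apply: ub_le_sup; [exact: hs.2|exists n].
- by apply: ge_sup => [|_ [n _ <-]//]; exact: hs.1.
move=> e e0; have [_ [N _ <-] hN] := sup_adherent e0 hs.
by exists N => n /mono; lra.
Qed.

Lemma cauchy_tends s : (forall e : R, 0 < e -> exists N, forall m n,
    (N <= m)%N -> (N <= n)%N -> `|s m - s n| < e) ->
  exists l, to0 (fun n => `|s n - l|).
Proof.
move=> cs.
have : cvgn s.
  apply/cauchy_cvgP/cauchy_ballP => e e0.
  have [N hN] := cs _ e0.
  pose A : set R := s @` [set n | (N <= n)%N].
  exists (A, A); first by split; exists N => // n /= Nn; exists n.
  by case=> _ _ /= [[m hm <-] [n hn <-]]; apply: hN.
move=> /cvg_ex[l /cvgrPdist_lt hl]; exists l => e /hl[N _ hN].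
by exists N => n /hN; rewrite distrC.
Qed.

End NullSequences.

(** * Inner product spaces, orthogonal projections and the Riesz representation *)

Section InnerProduct.
Variable R : realType.
Local Notation C := (Cx R).
Variables (V : lmodType C) (f : {dot V for (@Num.conj C)}).
Implicit Types (u v w : V) (a : C) (K : set V).

Lemma dotDl u v w : f (u + v) w = f u w + f v w. Proof. exact: linearDl. Qed.
Lemma dotBl u v w : f (u - v) w = f u w - f v w. Proof. exact: linearBl. Qed.
Lemma dotNl u w : f (- u) w = - f u w. Proof. exact: linearNl. Qed.
Lemma dotZl a u w : f (a *: u) w = a * f u w. Proof. exact: linearZl_LR. Qed.
Lemma dot0l w : f 0 w = 0. Proof. exact: linear0l. Qed.
Lemma dotDr u v w : f w (u + v) = f w u + f w v. Proof. exact: linearDr. Qed.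
Lemma dotBr u v w : f w (u - v) = f w u - f w v. Proof. exact: linearBr. Qed.
Lemma dotNr u w : f w (- u) = - f w u. Proof. exact: linearNr. Qed.
Lemma dotZr a u w : f w (a *: u) = a^* * f w u. Proof. exact: linearZr_LR. Qed.
Lemma dot0r w : f w 0 = 0. Proof. exact: linear0r. Qed.
Lemma dot_suml (I : Type) (r : seq I) (F : I -> V) w :
  f (\sum_(i <- r) F i) w = \sum_(i <- r) f (F i) w.
Proof.
by elim/big_ind2 : _ => [|_ u _ v <- <-|//]; rewrite ?dot0l ?dotDl.
Qed.
Lemma dot_sumr (I : Type) (r : seq I) (F : I -> V) w :
  f w (\sum_(i <- r) F i) = \sum_(i <- r) f w (F i).
Proof.
by elim/big_ind2 : _ => [|_ u _ v <- <-|//]; rewrite ?dot0r ?dotDr.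
Qed.

Definition hn v : R := Num.sqrt (reC (f v v)).

Lemma dotC u v : f u v = (f v u)^*.
Proof. by rewrite hermC mul1r. Qed.

Lemma dot_ge0 v : 0 <= f v v. Proof. exact: dnorm_ge0. Qed.

Lemma hn_ge0 v : 0 <= hn v. Proof. exact: sqrtr_ge0. Qed.

Lemma hn_sqr v : hn v ^+ 2 = reC (f v v).
Proof. by rewrite sqr_sqrtr // reC_ge0 // dot_ge0. Qed.

Lemma dotvv v : f v v = toC (hn v ^+ 2).
Proof. by rewrite hn_sqr -ge0_toC // dot_ge0. Qed.

Lemma hn0 : hn 0 = 0.
Proof. by rewrite /hn dot0r raddf0 sqrtr0. Qed.

Lemma hn_eq0 v : hn v = 0 -> v = 0.
Proof.
by move=> h; apply/eqP; rewrite -(dnorm_eq0 f) dotvv h expr0n raddf0.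
Qed.

Lemma hnZ a v : hn (a *: v) = abs a * hn v.
Proof.
apply/eqP; rewrite -(@eqrXn2 _ 2) ?mulr_ge0 ?hn_ge0 ?abs_ge0 //.
apply/eqP/(fmorph_inj (@toC R)).
rewrite /= -dotvv dotZl dotZr /= mulrA mulC_conj dotvv.
by rewrite -rmorphM -exprMn.
Qed.

Lemma hnN v : hn (- v) = hn v.
Proof. by rewrite -scaleN1r hnZ absN /abs normr1 mul1r. Qed.

Lemma hnBC u v : hn (u - v) = hn (v - u).
Proof. by rewrite -hnN opprB. Qed.

Lemma hnD_sqr u v : hn (u + v) ^+ 2 = hn u ^+ 2 + hn v ^+ 2 + 2 * reC (f u v).
Proof.
by rewrite hn_sqr hnormD mul1r !raddfD /= -!hn_sqr reC_conj; ring.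
Qed.

Lemma parallelogram u v :
  hn (u + v) ^+ 2 + hn (u - v) ^+ 2 = 2 * hn u ^+ 2 + 2 * hn v ^+ 2.
Proof. by rewrite !hnD_sqr hnN dotNr raddfN /=; ring. Qed.

Lemma cauchy_schwarz u v : abs (f u v) <= hn u * hn v.
Proof.
have [v0|vn0] := eqVneq (hn v) 0.
  by rewrite (hn_eq0 v0) dot0r abs0 hn0 mulr0.
have v0 : 0 < hn v by rewrite lt_def vn0 hn_ge0.
rewrite -ler_sqr ?nnegrE ?abs_ge0 ?mulr_ge0 ?hn_ge0 // exprMn.
pose a : C := f u v * toC (hn v ^- 2).
have := sqr_ge0 (hn (u - a *: v)).
rewrite hnD_sqr hnN hnZ dotNr dotZr /= raddfN /=.
have -> : reC (a^* * f u v) = hn v ^- 2 * abs (f u v) ^+ 2.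
  by rewrite rmorphM /= conj_toC mulrAC [_^* * _]mulrC mulC_conj mulrC -rmorphM toCK.
have -> : abs a = hn v ^- 2 * abs (f u v).
  by rewrite absM abs_toC ger0_norm 1?mulrC // invr_ge0 exprn_ge0 // ltW.
move=> h; have := mulr_ge0 (ltW (exprn_gt0 2 v0)) h.
suff -> : hn v ^+ 2 * (hn u ^+ 2 + (hn v ^- 2 * abs (f u v) * hn v) ^+ 2 +
   2 * - (hn v ^- 2 * abs (f u v) ^+ 2)) = hn u ^+ 2 * hn v ^+ 2 - abs (f u v) ^+ 2.
  by rewrite subr_ge0.
by field.
Qed.

Lemma hnD u v : hn (u + v) <= hn u + hn v.
Proof.
rewrite -ler_sqr ?nnegrE ?addr_ge0 ?hn_ge0 // hnD_sqr.
have := cauchy_schwarz u v; have := reC_le_abs (f u v).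
by have := ler_norm (reC (f u v)); nra.
Qed.

Lemma hn_triangle w u v : hn (u - v) <= hn (u - w) + hn (w - v).
Proof. by rewrite -[u - v](subrKA w) hnD. Qed.

Lemma dot_ext v : (forall w, f v w = 0) -> v = 0.
Proof. by move=> /(_ v) /eqP; rewrite dnorm_eq0 => /eqP. Qed.

Lemma dot_ext2 u v : (forall w, f u w = f v w) -> u = v.
Proof.
by move=> h; apply/eqP; rewrite -subr_eq0; apply/eqP/dot_ext => w; rewrite dotBl h subrr.
Qed.

Definition hcauchy (s : nat -> V) := forall e : R, 0 < e ->
  exists N, forall m n, (N <= m)%N -> (N <= n)%N -> hn (s m - s n) < e.

Definition hcomplete := forall s, hcauchy s ->
  exists l, to0 (fun n => hn (s n - l)).

Definition hclosed K := forall x,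
  (forall e : R, 0 < e -> exists2 y, K y & hn (x - y) < e) -> K x.

Lemma to0_hcauchy s l : to0 (fun n => hn (s n - l)) -> hcauchy s.
Proof.
move=> sl e e0; have e2 : 0 < e / 2 by rewrite divr_gt0.
have [N hN] := sl _ e2; exists N => m n /hN hm /hN hn_.
by have := hn_triangle l (s m) (s n); rewrite (hnBC l); lra.
Qed.

(** A sequence in K that minimises the distance to v is Cauchy by the parallelogram
    law; perturbing its limit p along k in K by the optimal multiple of k shows
    that v - p is orthogonal to k. *)
Theorem orthogonal_projection K : hcomplete -> K 0 ->
  (forall a u v, K u -> K v -> K (a *: u + v)) -> hclosed K ->
  forall v, exists2 p, K p & forall k, K k -> f (v - p) k = 0.
Proof.
move=> cpl K0 Klin Kcl v.
have KZ a u : K u -> K (a *: u) by move=> Ku; rewrite -[_ *: _]addr0; apply: Klin.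
have KD u w : K u -> K w -> K (u + w) by move=> Ku; rewrite -[u]scale1r; apply: Klin.
pose D : set R := [set hn (v - k) | k in K].
have Dinf : has_inf D.
  by split; [exists (hn (v - 0)), 0|exists 0 => _ [k _ <-]; exact: hn_ge0].
pose d := inf D.
have dle k : K k -> d <= hn (v - k) by move=> Kk; apply: (ge_inf Dinf.2); exists k.
have d0 : 0 <= d by apply: (lb_le_inf Dinf.1) => _ [k _ <-]; exact: hn_ge0.
have /choice[s hs] : forall n, exists k, K k /\ hn (v - k) < d + n.+1%:R^-1.
  move=> n; have n0 : 0 < n.+1%:R^-1 :> R by rewrite invr_gt0.
  by have [_ [k Kk <-] hk] := inf_adherent n0 Dinf; exists k.
have cs : hcauchy s.
  (* Two points within d + t' of v have a midpoint at distance at least d, so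
     their distance squared is at most 8 d t' + 4 t'^2. *)
  move=> e e0; pose t := e ^+ 2 / (8 * (d + 1)).
  have t0 : 0 < t by rewrite divr_gt0 ?exprn_gt0 // mulr_gt0 //; lra.
  pose t' := Num.min t 1.
  have t'0 : 0 < t' by rewrite lt_min t0 ltr01.
  have [N hN] := to0_invS t'0; exists N => m n Nm Nn.
  have [Km hm] := hs m; have [Kn hn'] := hs n.
  have mid : 2 * d <= hn ((v - s m) + (v - s n)).
    have -> : (v - s m) + (v - s n) = 2%:R *: (v - (2^-1 *: s m + 2^-1 *: s n)).
      rewrite scalerBr scalerDr !scalerA divff ?pnatr_eq0 // !scale1r.
      by rewrite scaler_nat mulr2n addrACA opprD.
    rewrite hnZ.
    have -> : abs (2%:R : C) = 2 by rewrite -(rmorph_nat (@toC R)) abs_toC normr_nat.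
    by rewrite ler_pM2l //; apply: dle; apply: KD; apply: KZ.
  have par := parallelogram (v - s m) (v - s n).
  have sub : hn (v - s m - (v - s n)) = hn (s m - s n).
    by rewrite opprB addrC subrKA hnBC.
  rewrite sub in par.
  have hm' : hn (v - s m) < d + t' by apply: lt_trans hm _; rewrite ltrD2l hN.
  have hn'' : hn (v - s n) < d + t' by apply: lt_trans hn' _; rewrite ltrD2l hN.
  have tt : t' <= t by rewrite ge_min lexx.
  have t1 : t' <= 1 by rewrite ge_min lexx orbT.
  rewrite -ltr_sqr ?nnegrE ?hn_ge0 //; last exact: ltW.
  have et : e ^+ 2 = t * (8 * (d + 1)) by rewrite /t; field; lra.
  have nm0 := hn_ge0 (v - s m); have nn0 := hn_ge0 (v - s n).
  have sq1 : hn (v - s m) ^+ 2 < (d + t') ^+ 2 by rewrite ltr_sqr ?nnegrE ?hn_ge0 //; lra.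
  have sq2 : hn (v - s n) ^+ 2 < (d + t') ^+ 2 by rewrite ltr_sqr ?nnegrE ?hn_ge0 //; lra.
  have sq3 : (2 * d) ^+ 2 <= hn ((v - s m) + (v - s n)) ^+ 2.
    by rewrite ler_sqr ?nnegrE ?hn_ge0 //; lra.
  have : hn (s m - s n) ^+ 2 < 4 * (d + t') ^+ 2 - (2 * d) ^+ 2 by lra.
  have p1 : t' * t' <= t' by apply: ler_piMr => //; exact: ltW.
  have p2 : t' * (8 * (d + 1)) <= t * (8 * (d + 1)) by rewrite ler_wpM2r //; lra.
  have p3 : 4 * (d + t') ^+ 2 - (2 * d) ^+ 2 = 8 * d * t' + 4 * (t' * t') by ring.
  by rewrite et p3; lra.
have [p sp] := cpl _ cs; exists p.
  apply: Kcl => e /sp[N /(_ N (leqnn _)) hN]; exists (s N); first by case: (hs N).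
  by rewrite hnBC.
have hp : hn (v - p) <= d.
  rewrite -subr_le0; apply: to0_const.
  apply: to0_le (to0D sp (@to0_invS R)) _ => n; have [_ hn'] := hs n.
  by have := hn_triangle (s n) v p; move: hn' => /=; set t := n.+1%:R^-1; lra.
move=> k Kk; have [->|k0] := eqVneq k 0; first by rewrite dot0r.
have nk : 0 < hn k.
  by rewrite lt_def hn_ge0 andbT; apply: contra_neq k0; exact: hn_eq0.
pose a : C := f (v - p) k * toC (hn k ^- 2).
have Kp : K p.
  apply: Kcl => e /sp[N /(_ N (leqnn _)) hN]; exists (s N); first by case: (hs N).
  by rewrite hnBC.
have := dle _ (Klin a k p Kk Kp).
rewrite opprD addrCA addrC -ler_sqr ?nnegrE ?hn_ge0 // hnD_sqr hnN hnZ dotNr dotZr /= raddfN /=.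
have -> : reC (a^* * f (v - p) k) = hn k ^- 2 * abs (f (v - p) k) ^+ 2.
  by rewrite rmorphM /= conj_toC mulrAC [_^* * _]mulrC mulC_conj mulrC -rmorphM toCK.
have -> : abs a = hn k ^- 2 * abs (f (v - p) k).
  by rewrite absM abs_toC ger0_norm 1?mulrC // invr_ge0 exprn_ge0 // ltW.
have : hn (v - p) ^+ 2 <= d ^+ 2 by rewrite ler_sqr ?nnegrE ?hn_ge0.
have -> : (hn k ^- 2 * abs (f (v - p) k) * hn k) ^+ 2 = hn k ^- 2 * abs (f (v - p) k) ^+ 2.
  by field; rewrite gt_eqF.
move=> h1 h2; have h3 : hn k ^- 2 * abs (f (v - p) k) ^+ 2 <= 0 by lra.
apply: abs_eq0; apply/eqP; rewrite -sqrf_eq0 eq_le sqr_ge0 andbT.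
by move: h3; rewrite pmulr_rle0 // invr_gt0 exprn_gt0.
Qed.

(** The orthogonal complement of the kernel of g is a line, spanned by the component
    q of any vector outside the kernel. *)
Theorem riesz (g : V -> C) (c : R) : hcomplete -> scalar g ->
  (forall v, abs (g v) <= c * hn v) -> exists w, forall v, g v = f v w.
Proof.
move=> cpl glin gbd.
have g0 : g 0 = 0 by have := glin (-1) 0 0; rewrite scaler0 addr0 mulN1r addNr.
have gB u v : g (u - v) = g u - g v.
  by rewrite addrC -scaleN1r glin mulN1r addrC.
have gZ a v : g (a *: v) = a * g v by rewrite -[_ *: _]addr0 glin g0 addr0.
have [[v gv]|ng] := pselect (exists v, g v != 0); last first.
  exists 0 => v; rewrite dot0r; apply: contrapT => h; apply: ng.
  by exists v; apply/eqP.
pose K := [set v | g v = 0].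
have Kcl : hclosed K.
  move=> x hx; apply: abs_eq0; apply/le_anti; rewrite abs_ge0 andbT leNgt; apply/negP => gx.
  have c0 : 0 < `|c| + 1 by rewrite ltr_wpDl.
  have [y Ky hy] := hx _ (divr_gt0 gx c0).
  have : abs (g x) <= c * hn (x - y) by rewrite -[g x]subr0 -Ky -gB gbd.
  move: hy; rewrite ltr_pdivlMr // leNgt => hy; apply/negP; rewrite negbK.
  apply: le_lt_trans hy; rewrite mulrC ler_wpM2l ?hn_ge0 //.
  by have := ler_norm c; lra.
have Klin a u w : K u -> K w -> K (a *: u + w).
  by rewrite /K /= glin => -> ->; rewrite mulr0 addr0.
have [p Kp hp] := orthogonal_projection cpl (g0 : K 0) Klin Kcl v.
pose q := v - p; have gq : g q = g v by rewrite gB Kp subr0.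
have q0 : f q q != 0.
  rewrite dnorm_eq0; apply: contra_neq gv => q0; rewrite -gq q0 //.
exists ((g v / f q q)^* *: q) => x.
have : f q (g q *: x - g x *: q) = 0 by apply: hp; rewrite /K /= gB !gZ mulrC subrr.
rewrite dotBr !dotZr /= => /eqP; rewrite subr_eq0 => /eqP /(congr1 (@Num.conj C)).
rewrite !rmorphM /= !conjCK -dotC -[(f q q)^*]dotC gq => h.
by rewrite mulrAC h mulfK.
Qed.

End InnerProduct.

(** * Convergence of complex sequences; Hilbert spaces *)

Section HilbertSpace.
Variable R : realType.
Local Notation C := (Cx R).
Variable H : hilbertType C.
Implicit Types (h k : H) (S T : H -> H) (s : nat -> C).

Definition ctends s (l : C) := to0 (fun n => abs (s n - l)).

Lemma ctendsP s l : ctends s l <-> s n @[n --> \oo] --> l.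
Proof.
split=> [sl|/cvgrPdist_lt sl].
  apply/cvgrPdist_lt => e e0.
  have := sl _ (_ : 0 < reC e); rewrite -ltr_toC raddf0 -ge0_toC ?ltW // => /(_ e0)[N hN].
  by exists N => // n /= /hN; rewrite distrC -ltr_toC -absE -ge0_toC // ltW.
move=> e e0; have [N _ hN] := sl (toC e) (etrans (toC_gt0 e) e0).
by exists N => n /hN /=; rewrite distrC absE ltr_toC.
Qed.

Lemma ctends_lim s l : ctends s l -> limn s = l.
Proof. by move=> /ctendsP; exact: cvg_lim. Qed.

Lemma ctends_unique s l l' : ctends s l -> ctends s l' -> l = l'.
Proof. by move=> /ctends_lim <- /ctends_lim. Qed.

Lemma ctendsD s t l m : ctends s l -> ctends t m ->
  ctends (fun n => s n + t n) (l + m).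
Proof.
move=> sl tm; apply: to0_le (to0D sl tm) _ => n.
by rewrite opprD addrACA absD.
Qed.

Lemma ctendsZ a s l : ctends s l -> ctends (fun n => a * s n) (a * l).
Proof.
move=> sl; apply: to0_le (to0Z (abs_ge0 a) sl) _ => n.
by rewrite -mulrBr absM.
Qed.

Lemma ctends_conj s l : ctends s l -> ctends (fun n => (s n)^*) l^*.
Proof. by move=> sl; apply: to0_le sl _ => n; rewrite -rmorphB abs_conj. Qed.

Lemma ctends_cst l : ctends (fun=> l) l.
Proof. by apply: to0_le (@to0_cst0 R) _ => n; rewrite subrr abs0. Qed.

Lemma ctends_ext s t l : s =1 t -> ctends s l -> ctends t l.
Proof. by move=> st sl; apply: to0_le sl _ => n; rewrite st. Qed.

Lemma ctends_sum (I : Type) (r : seq I) (F : I -> nat -> C) (l : I -> C) :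
  (forall i, ctends (F i) (l i)) ->
  ctends (fun n => \sum_(i <- r) F i n) (\sum_(i <- r) l i).
Proof.
move=> Fl; elim: r => [|i r IH].
  by apply: ctends_ext (ctends_cst _) => n; rewrite !big_nil.
by rewrite big_cons; apply: ctends_ext (ctendsD (Fl i) IH) => n; rewrite big_cons.
Qed.

Lemma ctends_abs s l c : ctends s l -> (forall n, abs (s n) <= c) -> abs l <= c.
Proof.
move=> sl sc; rewrite -subr_le0; apply: to0_const; apply: to0_le sl _ => n.
by have := absD (s n) (l - s n); rewrite subrKC (absB l); have := sc n; lra.
Qed.

Lemma ctends_ge0 s l : ctends s l -> (forall n, 0 <= s n) -> 0 <= l.
Proof.
move=> sl s0.
have im : imC l = 0.
  apply/normr0_eq0/le_anti; rewrite normr_ge0 andbT; apply: to0_const.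
  apply: to0_le sl _ => n; apply: le_trans (imC_le_abs _).
  by rewrite raddfB /= (ge0_toC (s0 n)) /imC /= sub0r normrN.
have re : 0 <= reC l.
  rewrite -oppr_le0; apply: to0_const; apply: to0_le sl _ => n.
  apply: le_trans (reC_le_abs _); rewrite raddfB /=.
  by have := reC_ge0 (s0 n); have := ler_norm (reC (s n) - reC l); lra.
by move: im re; case: l sl => a b _; rewrite /imC /reC /= lecE /= => -> ->; rewrite eqxx.
Qed.

Lemma ccauchy_tends s : (forall e : R, 0 < e -> exists N, forall m n,
    (N <= m)%N -> (N <= n)%N -> abs (s m - s n) < e) -> exists l, ctends s l.
Proof.
move=> cs.
have [a ha] : exists l, to0 (fun n => `|reC (s n) - l|).
  apply: cauchy_tends => e /cs[N hN]; exists N => m n Nm Nn.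
  by rewrite -raddfB; apply: le_lt_trans (reC_le_abs _) (hN _ _ Nm Nn).
have [b hb] : exists l, to0 (fun n => `|imC (s n) - l|).
  apply: cauchy_tends => e /cs[N hN]; exists N => m n Nm Nn.
  by rewrite -raddfB; apply: le_lt_trans (imC_le_abs _) (hN _ _ Nm Nn).
exists (Complex a b : C); apply: to0_le (to0D ha hb) _ => n.
by apply: le_trans (abs_le_reim _) _; rewrite !raddfB.
Qed.

(** Absolutely bounded partial sums make a complex series converge. *)
Lemma cseries_tends s B : (forall N, \sum_(n < N) abs (s n) <= B) ->
  exists l, ctends (fun N => \sum_(n < N) s n) l.
Proof.
move=> sB; apply: ccauchy_tends => e e0.
have inc N : \sum_(n < N) abs (s n) <= \sum_(n < N.+1) abs (s n).
  by rewrite big_ord_recr /= lerDl abs_ge0.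
have [l [hl _ /(_ _ (divr_gt0 e0 (ltr0n R 2)))[N hN]]] := monotone_tends inc sB.
have key m j : abs (\sum_(n < m + j) s n - \sum_(n < m) s n) <=
    \sum_(n < m + j) abs (s n) - \sum_(n < m) abs (s n).
  elim: j => [|j IH]; first by rewrite addn0 !subrr abs0.
  rewrite addnS !big_ord_recr /= addrAC [leRHS]addrAC.
  by apply: le_trans (absD _ _) _; rewrite lerD2r.
have bd m : (N <= m)%N -> abs (\sum_(n < m) s n - \sum_(n < N) s n) < e / 2.
  move=> Nm; apply: le_lt_trans (hN _ (leqnn N)).
  by rewrite -(subnKC Nm); apply: le_trans (key _ _) _; rewrite lerD2r hl.
exists N => m n /bd hm /bd hn.
rewrite -(subrKA (\sum_(n < N) s n)); apply: le_lt_trans (absD _ _) _.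
by rewrite (absB _ (\sum_(n < n) s n)); lra.
Qed.

Local Notation nm := (hn (@hdot _ H)).

Lemma normHE h : `|h| = toC (nm h).
Proof.
apply/eqP; rewrite -(@eqrXn2 _ 2) // ?toC_ge0 ?hn_ge0 //.
by rewrite normr_hdot dotvv rmorphXn.
Qed.

Lemma hilbert_complete : hcomplete (@hdot _ H).
Proof.
move=> s cs.
have : cvgn s.
  apply/cauchy_cvgP/cauchy_ballP => e e0.
  have [N hN] : exists N, forall m n, (N <= m)%N -> (N <= n)%N ->
      nm (s m - s n) < reC e.
    by apply: cs; rewrite -ltr_toC raddf0 -ge0_toC // ltW.
  pose A : set H := s @` [set n | (N <= n)%N].
  exists (A, A); first by split; exists N => // n /= Nn; exists n.
  case=> _ _ /= [[m hm <-] [n hn <-]]; rewrite -ball_normE /=.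
  by rewrite normHE [e]ge0_toC ?ltr_toC ?hN // ltW.
move=> /cvg_ex[l /cvgrPdist_lt hl]; exists l => e e0.
have [N _ hN] := hl (toC e) (etrans (toC_gt0 e) e0).
by exists N => n /hN /=; rewrite distrC normHE ltr_toC.
Qed.

Definition bounded_by (c : R) T := forall h, nm (T h) <= c * nm h.

Lemma bounded_opP T : bounded_op T <->
  linear T /\ exists2 c : R, 0 <= c & bounded_by c T.
Proof.
split=> -[Tlin]; [case=> c hc|case=> c _ cT]; split=> //.
  exists (abs c); first exact: abs_ge0.
  move=> h; rewrite -ler_toC rmorphM /= -absE -!normHE.
  apply: le_trans (hc h) _; rewrite -[X in X <= _]ger0_norm ?normrM ?normr_id //.
  by apply: le_trans (normr_ge0 _) (hc h).
by exists (toC c) => h; rewrite !normHE -rmorphM ler_toC; apply: cT.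
Qed.

End HilbertSpace.

(** * Bounded operators, adjoints and commutants *)

Section Operators.
Variable R : realType.
Local Notation C := (Cx R).
Variable H : hilbertType C.
Implicit Types (h k : H) (S T : H -> H) (a : C) (M : set (H -> H)).
Local Notation nm := (hn (@hdot _ H)).

Lemma linear0f T : linear T -> T 0 = 0.
Proof. by move=> lT; have := lT (-1) 0 0; rewrite scaler0 addr0 scaleN1r addNr. Qed.

Lemma linearZf T : linear T -> forall a h, T (a *: h) = a *: T h.
Proof. by move=> lT a h; rewrite -[_ *: _]addr0 lT linear0f // addr0. Qed.

Lemma linearDf T : linear T -> forall h k, T (h + k) = T h + T k.
Proof. by move=> lT h k; rewrite -[h]scale1r lT !scale1r. Qed.

Lemma linearBf T : linear T -> forall h k, T (h - k) = T h - T k.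
Proof. by move=> lT h k; rewrite addrC -scaleN1r lT scaleN1r addrC. Qed.

Lemma linear_sumf T : linear T -> forall (I : Type) (r : seq I) (F : I -> H),
  T (\sum_(i <- r) F i) = \sum_(i <- r) T (F i).
Proof.
move=> lT I r F; elim: r => [|i r IH]; first by rewrite !big_nil linear0f.
by rewrite !big_cons linearDf // IH.
Qed.

Lemma bounded_id : bounded_op (@id H).
Proof. by apply/bounded_opP; split=> //; exists 1 => // h; rewrite mul1r. Qed.

Lemma bounded_comp S T : bounded_op S -> bounded_op T -> bounded_op (S \o T).
Proof.
move=> /bounded_opP[lS [c c0 cS]] /bounded_opP[lT [d d0 dT]].
apply/bounded_opP; split; first by move=> a h k /=; rewrite lT lS.
exists (c * d); first exact: mulr_ge0.
by move=> h /=; apply: le_trans (cS _) _; rewrite -mulrA ler_wpM2l.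
Qed.

Lemma bounded_lin a S T : bounded_op S -> bounded_op T -> bounded_op (a *: S + T).
Proof.
move=> /bounded_opP[lS [c c0 cS]] /bounded_opP[lT [d d0 dT]].
apply/bounded_opP; split.
  move=> b h k; rewrite !fctE /= lT lS !scalerDr !scalerA mulrC -!addrA.
  by congr (_ + _); rewrite addrCA.
exists (abs a * c + d); first by rewrite addr_ge0 // mulr_ge0 ?abs_ge0.
move=> h; rewrite !fctE /=; apply: le_trans (hnD _ _ _) _.
by rewrite mulrDl lerD ?dT // hnZ -mulrA ler_wpM2l ?abs_ge0.
Qed.

Lemma dot_bound T c : bounded_by c T -> forall h k,
  abs (hdot (T h) k) <= c * nm h * nm k.
Proof.
by move=> cT h k; apply: le_trans (cauchy_schwarz _ _ _) _; rewrite ler_wpM2r ?hn_ge0.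
Qed.

Lemma adjoint T : bounded_op T ->
  exists2 T', bounded_op T' & forall h k, hdot (T h) k = hdot h (T' k).
Proof.
move=> /bounded_opP[lT [c c0 cT]].
have /choice[T' hT'] : forall k, exists k', forall h, hdot (T h) k = hdot h k'.
  move=> k; apply: (@riesz _ _ (@hdot _ H) (fun h => hdot (T h) k) (c * nm k)).
  - exact: hilbert_complete.
  - by move=> a h h'; rewrite lT dotDl dotZl.
  - by move=> h; apply: le_trans (dot_bound cT _ _) _; rewrite mulrAC.
exists T' => //; apply/bounded_opP; split.
  move=> a h k; apply: (@dot_ext2 _ _ (@hdot _ H)) => w; apply: (can_inj conjCK).
  by rewrite -!dotC -hT' !dotDr !dotZr !hT'.
exists c => // k; have [->|n0] := eqVneq (nm (T' k)) 0; first by rewrite mulr_ge0 ?hn_ge0.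
have np : 0 < nm (T' k) by rewrite lt_def n0 hn_ge0.
rewrite -(ler_pM2l np) mulrA (mulrC _ c).
apply: le_trans (dot_bound cT _ _).
by rewrite hT' dotvv abs_toC ger0_norm ?expr2 // mulr_ge0 ?hn_ge0.
Qed.

Lemma op_ext S T : (forall h k, hdot (S h) k = hdot (T h) k) -> S = T.
Proof.
by move=> ST; apply/funext => h; apply: (@dot_ext2 _ _ (@hdot _ H)) => k.
Qed.

Lemma commutant_id M : commutant M id.
Proof. by split=> [|S _]; [exact: bounded_id|]. Qed.

Lemma commutant_comp M S T : commutant M S -> commutant M T -> commutant M (S \o T).
Proof.
move=> [bS cS] [bT cT]; split; first exact: bounded_comp.
by move=> U MU; rewrite compA cS // -compA cT.
Qed.

Lemma sub_bicommutant M : M `<=` bounded_op -> M `<=` bicommutant M.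
Proof. by move=> Mb T MT; split; [exact: Mb|move=> S [_ /(_ _ MT)]]. Qed.

Lemma commutantS M N : M `<=` N -> commutant N `<=` commutant M.
Proof. by move=> MN T [bT cT]; split=> // S /MN; exact: cT. Qed.

Lemma bicommutantS M N : M `<=` N -> bicommutant M `<=` bicommutant N.
Proof. by move=> MN; do 2!apply: commutantS. Qed.

(** Taking commutants reverses inclusions, so the commutant of the bicommutant is
    both smaller and larger than the commutant. *)
Lemma tricommutant M : M `<=` bounded_op -> commutant (bicommutant M) = commutant M.
Proof.
move=> Mb; apply/seteqP; split; first exact: commutantS (sub_bicommutant Mb).
by apply: sub_bicommutant => T [].
Qed.

Lemma bicommutant_sub M N : N `<=` bounded_op -> M `<=` bicommutant N ->
  bicommutant M `<=` bicommutant N.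
Proof.
move=> Nb MN; apply: commutantS; rewrite -(tricommutant Nb); exact: commutantS.
Qed.

Definition star_closed M := forall T, M T -> exists2 T', M T' &
  forall h k, hdot (T h) k = hdot h (T' k).

Lemma adjoint_sym T T' : (forall h k, hdot (T h) k = hdot h (T' k)) ->
  forall h k, hdot (T' h) k = hdot h (T k).
Proof. by move=> hT h k; rewrite dotC -hT -dotC. Qed.

(** The adjoint of an operator commuting with M commutes with the adjoints of the
    elements of M, which are again elements of M. *)
Lemma star_closed_commutant M : star_closed M -> star_closed (commutant M).
Proof.
move=> Ms T [bT cT]; have [T' bT' hT'] := adjoint bT; exists T' => //; split=> // S MS.
have [S' MS' hS'] := Ms _ MS; apply: op_ext => h k /=.
rewrite hS' (adjoint_sym hT') (adjoint_sym hT') hS' -[T (S' k)]/((T \o S') k).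
by rewrite -cT.
Qed.

End Operators.

(** * The Hilbert space of square-summable sequences *)

Section SquareSummable.
Variable R : realType.
Local Notation C := (Cx R).
Variable H : hilbertType C.
Implicit Types (h k : H) (S T : H -> H) (a : C) (M : set (H -> H)).
Local Notation nm := (hn (@hdot _ H)).
Implicit Types u v : nat -> H.

Lemma sqsumP u : square_summable u <->
  exists B : R, forall N, \sum_(n < N) nm (u n) ^+ 2 <= B.
Proof.
pose s N := \sum_(n < N) nm (u n) ^+ 2.
have sE : series (fun n => `|u n| ^+ 2 : C) = (fun N => toC (s N)).
  apply/funext => N; rewrite /series /= big_mkord rmorph_sum /=.
  by apply: eq_bigr => i _; rewrite normHE rmorphXn.
have inc N : s N <= s N.+1 by rewrite /s big_ord_recr /= lerDl sqr_ge0.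
have mono : {homo s : m n / (m <= n)%N >-> m <= n}.
  by apply: homo_leq => //; exact: le_trans.
rewrite /square_summable sE; split.
  move=> /cvg_ex[l /ctendsP sl]; exists (reC l) => N.
  rewrite -/(s N) -subr_le0; apply: to0_const; apply: to0_eventually sl _.
  exists N => n /mono sNn; have := reC_le_abs (toC (s n) - l).
  by rewrite raddfB /= ?toCK; have := ler_norm (s n - reC l); lra.
move=> [B sB]; have [l [sl _ hl]] := monotone_tends inc sB.
apply/cvg_ex; exists (toC l); apply/ctendsP; apply: to0_le hl _ => N.
by rewrite -rmorphB abs_toC ler0_norm ?subr_le0 // opprB.
Qed.

Lemma sqsum_dominated u (b : nat -> R) B : (forall n, nm (u n) ^+ 2 <= b n) ->
  (forall N, \sum_(n < N) b n <= B) -> square_summable u.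
Proof.
move=> ub bB; apply/sqsumP; exists B => N; apply: le_trans (bB N).
by apply: ler_sum => i _; exact: ub.
Qed.

Lemma sqsum_map c T u : bounded_by c T -> square_summable u ->
  square_summable (T \o u).
Proof.
move=> cT /sqsumP[B uB].
apply: (@sqsum_dominated _ (fun n => c ^+ 2 * nm (u n) ^+ 2) (c ^+ 2 * B)).
  move=> n; rewrite -exprMn ler_sqr ?nnegrE ?hn_ge0 //; first exact: cT.
  by apply: (le_trans _ (cT _)); exact: hn_ge0.
by move=> N; rewrite -mulr_sumr ler_wpM2l ?sqr_ge0.
Qed.

Definition fin_seq (s : seq H) : nat -> H := nth 0 s.

Lemma sqsum_fin s : square_summable (fin_seq s).
Proof.
apply/sqsumP; exists (\sum_(n < size s) nm (fin_seq s n) ^+ 2) => N.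
have [Ns|sN] := leqP N (size s).
  by rewrite (big_ord_widen _ (fun n => nm (fin_seq s n) ^+ 2) Ns)
     [leRHS](bigID (fun i : 'I_(size s) => (i < N)%N)) /= lerDl
     sumr_ge0 // => i _; rewrite sqr_ge0.
rewrite (big_ord_widen _ (fun n => nm (fin_seq s n) ^+ 2) (ltnW sN)).
rewrite [leLHS](bigID (fun i : 'I_N => (i < size s)%N)) /= gerDl.
rewrite big1 // => i; rewrite -leqNgt => si.
by rewrite /fin_seq nth_default // hn0 expr0n.
Qed.

Definition l2pred : {pred (nat -> H)} := fun u => `[< square_summable u >].

Fact l2_submod : submod_closed l2pred.
Proof.
split=> [|a u v /asboolP/sqsumP[A uA] /asboolP/sqsumP[B vB]]; apply/asboolP/sqsumP.
  by exists 0 => N; rewrite big1 // => i _; rewrite hn0 expr0n.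
exists (2 * (abs a ^+ 2 * A) + 2 * B) => N.
apply: le_trans (_ : \sum_(n < N) (2 * (abs a ^+ 2 * nm (u n) ^+ 2) + 2 * nm (v n) ^+ 2) <= _).
  apply: ler_sum => i _; rewrite !fctE /=.
  have := hnD (@hdot _ H) (a *: u i) (v i); rewrite hnZ => le1.
  have := hn_ge0 (@hdot _ H) (a *: u i + v i); rewrite -exprMn.
  move: le1; set x := hn _ _; set y := abs a * _; set z := nm _ => le1 x0.
  have : x ^+ 2 <= (y + z) ^+ 2 by rewrite ler_sqr ?nnegrE //; lra.
  by have := sqr_ge0 (y - z); rewrite sqrrB sqrrD; lra.
rewrite big_split /= -!mulr_sumr; apply: lerD; apply: ler_wpM2l => //; last exact: vB.
by apply: ler_wpM2l; [exact: sqr_ge0|exact: uA].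
Qed.

HB.instance Definition _ := GRing.isSubmodClosed.Build C (nat -> H) l2pred l2_submod.

Definition l2 := {u : nat -> H | l2pred u}.
HB.instance Definition _ := SubType.on l2.
HB.instance Definition _ := [Choice of l2 by <:].
HB.instance Definition _ := [SubChoice_isSubLmodule of l2 by <:].
End SquareSummable.

Lemma lincomb_lt (R : realFieldType) (a x y e : R) : 0 <= x ->
  x * (a + 1) < e / 2 -> y < e / 2 -> a * x + y < e.
Proof. by move=> x0; rewrite mulrDr mulr1 mulrC; lra. Qed.

Section L2Space.
Variable R : realType.
Local Notation C := (Cx R).
Variable H : hilbertType C.
Implicit Types (S T : H -> H) (a : C).
Local Notation nm := (hn (@hdot _ H)).
Local Notation l2 := (l2 H).

Definition sdot (u v : nat -> H) := normal_functional u v id.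

Lemma sdot_tends (u v : nat -> H) : square_summable u -> square_summable v ->
  ctends (fun N => \sum_(n < N) hdot (u n) (v n)) (sdot u v).
Proof.
move=> /sqsumP[A uA] /sqsumP[B vB].
have [|l hl] := @cseries_tends R (fun n => hdot (u n) (v n)) (A + B).
  move=> N; apply: le_trans (lerD (uA N) (vB N)); rewrite -big_split /=.
  apply: ler_sum => i _; apply: le_trans (cauchy_schwarz _ _ _) _.
  have := sqr_ge0 (nm (u i) - nm (v i)); rewrite sqrrB.
  by have := mulr_ge0 (hn_ge0 hdot (u i)) (hn_ge0 hdot (v i)); lra.
rewrite /sdot /normal_functional (_ : series _ = fun N => \sum_(n < N) hdot (u n) (v n)).
  by rewrite (ctends_lim hl).
by apply/funext => N; rewrite /series /= big_mkord.
Qed.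

Lemma normal_functional_tends (u v : nat -> H) T : square_summable u -> square_summable v ->
  bounded_op T ->
  ctends (fun N => \sum_(n < N) hdot (T (u n)) (v n)) (normal_functional u v T).
Proof.
move=> su sv /bounded_opP[_ [c _ cT]].
exact: sdot_tends (sqsum_map cT su) sv.
Qed.

Lemma l2P (u : l2) : square_summable (val u).
Proof. exact/asboolP/(valP u). Qed.

Definition mkl2 u (su : square_summable u) : l2 := exist _ u (asboolT su).

Definition l2dot (u v : l2) : C := sdot (val u) (val v).

Lemma l2dot_tends (u v : l2) :
  ctends (fun N => \sum_(n < N) hdot (val u n) (val v n)) (l2dot u v).
Proof. by apply: sdot_tends; exact: l2P. Qed.

Lemma l2dotPl a (u v w : l2) : l2dot (a *: u + v) w = a * l2dot u w + l2dot v w.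
Proof.
apply: ctends_unique (l2dot_tends _ _) _.
apply: ctends_ext (ctendsD (ctendsZ a (l2dot_tends u w)) (l2dot_tends v w)) => N.
rewrite mulr_sumr -big_split /=; apply: eq_bigr => i _.
by rewrite -dotZl -dotDl.
Qed.

Lemma l2dotC (u v : l2) : l2dot u v = (l2dot v u)^*.
Proof.
apply: ctends_unique (l2dot_tends _ _) _.
apply: ctends_ext (ctends_conj (l2dot_tends v u)) => N.
by rewrite rmorph_sum; apply: eq_bigr => i _; rewrite /= -dotC.
Qed.

Fact l2dot_bilinear : bilinear_for ( *%R) ((@Num.conj C) \; *%R) l2dot.
Proof.
split=> [w a u v|w a u v]; first exact: l2dotPl.
by rewrite l2dotC l2dotPl rmorphD rmorphM /= -!l2dotC.
Qed.
HB.instance Definition _ :=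
  bilinear_isBilinear.Build C l2 l2 C _ _ l2dot l2dot_bilinear.

Fact l2dot_hermitian (u v : l2) : l2dot u v = (-1) ^+ false * (l2dot v u)^*.
Proof. by rewrite mul1r; exact: l2dotC. Qed.
HB.instance Definition _ :=
  isHermitianSesquilinear.Build C l2 false (@Num.conj C) l2dot l2dot_hermitian.

Lemma l2dot_ge (u : l2) N :
  toC (\sum_(n < N) nm (val u n) ^+ 2) <= l2dot u u.
Proof.
rewrite -subr_ge0; pose s n := \sum_(i < N + n) hdot (val u i) (val u i).
apply: (@ctends_ge0 _ (fun n => s n - toC (\sum_(n < N) nm (val u n) ^+ 2))).
  apply: ctendsD (ctends_cst _); rewrite /s; have /= := l2dot_tends u u.
  move/(to0_sub (_ : forall n, (n <= N + n)%N)); apply => n; exact: leq_addl.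
move=> n; rewrite /s; elim: n => [|n IH].
  rewrite addn0 rmorph_sum -sumrB big1 // => i _; rewrite dotvv subrr //.
by rewrite addnS big_ord_recr /= addrAC addr_ge0 // dot_ge0.
Qed.

Fact l2dot_posdef (u : l2) : u != 0 -> 0 < l2dot u u.
Proof.
move=> u0; have [n un] : exists n, val u n != 0.
  apply: contrapT => h; move/negP: u0; apply; apply/eqP/val_inj/funext => n /=.
  by apply: contrapT => /eqP un; apply: h; exists n.
apply: lt_le_trans (l2dot_ge u n.+1); rewrite toC_gt0 big_ord_recr /=.
apply: ltr_wpDl; first by apply: sumr_ge0 => i _; rewrite sqr_ge0.
rewrite exprn_gt0 // lt_def hn_ge0 andbT; apply: contra_neq un; exact: hn_eq0.
Qed.
HB.instance Definition _ := isDotProduct.Build C l2 l2dot l2dot_posdef.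

Definition l2form : {dot l2 for (@Num.conj C)} := l2dot.
Local Notation nm2 := (hn l2form).

Lemma nm2_ge (u : l2) N : \sum_(n < N) nm (val u n) ^+ 2 <= nm2 u ^+ 2.
Proof. by rewrite -ler_toC -dotvv; exact: l2dot_ge. Qed.

Lemma nm_le_nm2 (u : l2) n : nm (val u n) <= nm2 u.
Proof.
rewrite -ler_sqr ?nnegrE ?hn_ge0 //; apply: le_trans (nm2_ge u n.+1).
by rewrite big_ord_recr /= lerDr sumr_ge0 // => i _; rewrite sqr_ge0.
Qed.

(** The squared norm is the limit of the partial sums, hence bounded by any bound for
    them. *)
Lemma nm2_le (u : l2) (b : R) : 0 <= b ->
  (forall N, \sum_(n < N) nm (val u n) ^+ 2 <= b ^+ 2) -> nm2 u <= b.
Proof.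
move=> b0 ub; rewrite -ler_sqr ?nnegrE ?hn_ge0 // hn_sqr.
rewrite -subr_le0; apply: to0_const; apply: to0_le (l2dot_tends u u) _ => N.
have sN : reC (\sum_(n < N) hdot (val u n) (val u n)) = \sum_(n < N) nm (val u n) ^+ 2.
  by rewrite raddf_sum; apply: eq_bigr => i _; rewrite /= -hn_sqr.
rewrite absB; apply: le_trans (reC_le_abs _); rewrite raddfB /= sN.
by apply: le_trans (ler_norm _); rewrite lerB.
Qed.

Lemma nm2_sqsum (u : l2) (b : R) : 0 <= b -> nm2 u <= b -> forall N,
  \sum_(n < N) nm (val u n) ^+ 2 <= b ^+ 2.
Proof.
by move=> b0 ub N; apply: le_trans (nm2_ge u N) _; rewrite ler_sqr ?nnegrE ?hn_ge0.
Qed.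

Lemma to0_sqr (s : nat -> R) : (forall n, 0 <= s n) -> to0 s ->
  to0 (fun n => s n ^+ 2).
Proof.
move=> s0 ss e e0; have m0 : 0 < Num.min e 1 by rewrite lt_min e0 ltr01.
have [N hN] := ss _ m0; exists N => n /hN; rewrite lt_min => /andP[h1 h2].
by have := s0 n; nra.
Qed.

Lemma to0_sum (F : nat -> nat -> R) m : (forall i, to0 (F i)) ->
  to0 (fun n => \sum_(i < m) F i n).
Proof.
move=> F0; elim: m => [|m IH].
  by apply: to0_le (@to0_cst0 R) _ => n; rewrite big_ord0.
by apply: to0_le (to0D IH (F0 m)) _ => n; rewrite big_ord_recr.
Qed.

(** Coordinatewise limits exist; passing to the limit in finite sums bounds the tails
    of the Cauchy sequence uniformly in the number of coordinates. *)
Lemma l2_complete : hcomplete l2form.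
Proof.
move=> s cs.
have /choice[l hl] : forall n, exists h, to0 (fun m => nm (val (s m) n - h)).
  move=> n; apply: hilbert_complete => e /cs[N hN]; exists N => m k Nm Nk.
  exact: le_lt_trans (nm_le_nm2 (s m - s k) n) (hN _ _ Nm Nk).
have key (e : R) : 0 < e -> exists N, forall k, (N <= k)%N -> forall M,
    \sum_(n < M) nm (val (s k) n - l n) ^+ 2 <= (2 * e) ^+ 2.
  move=> e0; have [N hN] := cs _ e0; exists N => k Nk M.
  have lim : to0 (fun m => \sum_(n < M) (nm (val (s m) n - l n) ^+ 2)).
    apply: (@to0_sum (fun n m => nm (val (s m) n - l n) ^+ 2)) => n.
    by apply: to0_sqr => [m|]; [exact: hn_ge0|exact: hl].
  rewrite -subr_le0; apply: to0_const.
  apply: to0_eventually (to0Z (ler0n R 2) lim) _; exists N => m Nm.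
  rewrite lerBlDr -lerBlDl.
  apply: le_trans (_ : 2 * \sum_(n < M) nm (val (s k - s m) n) ^+ 2 <= _); last first.
    have := nm2_sqsum (ltW e0) (ltW (hN _ _ Nk Nm)) M; nra.
  rewrite lerBlDl !mulr_sumr -big_split /=; apply: ler_sum => n _.
  have := hn_triangle hdot (val (s m) n) (val (s k) n) (l n).
  rewrite -[val (s k) n - val (s m) n]/(val (s k - s m) n).
  have := hn_ge0 hdot (val (s k) n - l n); set x := nm _; set y := nm _; set z := nm _.
  move=> x0 xyz; have : x ^+ 2 <= (y + z) ^+ 2 by rewrite ler_sqr ?nnegrE //; lra.
  by have := sqr_ge0 (y - z); rewrite sqrrB sqrrD; lra.
have sl : square_summable l.
  have [N /(_ N (leqnn N)) hN] := key 1 ltr01.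
  have dl : square_summable (val (s N) - l) by apply/sqsumP; eexists; exact: hN.
  have -> : l = val (s N - mkl2 dl) by apply/funext => n; rewrite /= !fctE /= subKr.
  exact: l2P.
exists (mkl2 sl) => e e0.
have e4 : 0 < e / 4 by rewrite divr_gt0.
have [N hN] := key _ e4; exists N => n /hN h.
by apply: le_lt_trans (@nm2_le (s n - mkl2 sl) (2 * (e / 4)) _ h) _; lra.
Qed.

Lemma sqsum_bop T u : bounded_op T -> square_summable u -> square_summable (T \o u).
Proof. by move=> /bounded_opP[_ [c _ cT]]; exact: sqsum_map cT. Qed.

(** The amplification of a bounded operator, acting on each coordinate; it is set to
    zero for functions that are not bounded operators in order to be total. *)
Definition ampl T (u : l2) : l2 :=
  if pselect (bounded_op T) is left bT then mkl2 (sqsum_bop bT (@l2P u)) else 0.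

Lemma val_ampl T (u : l2) : bounded_op T -> val (ampl T u) = T \o val u.
Proof. by rewrite /ampl; case: pselect. Qed.

Lemma ampl_lin T a (u v : l2) : bounded_op T ->
  ampl T (a *: u + v) = a *: ampl T u + ampl T v.
Proof.
move=> bT; apply/val_inj/funext => n; rewrite [LHS](congr1 (@^~ n) (val_ampl _ bT)).
rewrite /= !val_ampl // !fctE /=; case: bT => lT _.
by rewrite -[RHS]lT.
Qed.

Lemma ampl_bound T c (u : l2) : bounded_op T -> 0 <= c -> bounded_by c T ->
  nm2 (ampl T u) <= c * nm2 u.
Proof.
move=> bT c0 cT; apply: nm2_le => [|N]; first by rewrite mulr_ge0 ?hn_ge0.
rewrite exprMn; apply: le_trans (ler_wpM2l (sqr_ge0 c) (nm2_ge u N)).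
rewrite mulr_sumr; apply: ler_sum => i _; rewrite val_ampl //= -exprMn.
by rewrite ler_sqr ?nnegrE ?mulr_ge0 ?hn_ge0 //; exact: cT.
Qed.

Lemma ampl_adjoint T T' : bounded_op T -> bounded_op T' ->
  (forall h k : H, hdot (T h) k = hdot h (T' k)) ->
  forall u v : l2, l2form (ampl T u) v = l2form u (ampl T' v).
Proof.
move=> bT bT' TT' u v; apply: ctends_unique (l2dot_tends _ _) _.
apply: ctends_ext (l2dot_tends u (ampl T' v)) => N.
by apply: eq_bigr => i _; rewrite !val_ampl //= TT'.
Qed.

Fact sqsum_delta j (h : H) : square_summable (fun n => if n == j then h else 0).
Proof.
apply/sqsumP; exists (nm h ^+ 2) => N.
have [jN|Nj] := ltnP j N.
  rewrite (bigD1 (Ordinal jN)) //= eqxx big1 ?addr0 // => i.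
  by rewrite -val_eqE /= => /negPf ->; rewrite hn0 expr0n.
rewrite big1 ?sqr_ge0 // => i _; rewrite ltn_eqF ?hn0 ?expr0n //.
exact: leq_trans (ltn_ord i) Nj.
Qed.

Definition l2delta j (h : H) : l2 := mkl2 (@sqsum_delta j h).

Lemma l2delta_lin j a (h k : H) : l2delta j (a *: h + k) = a *: l2delta j h + l2delta j k.
Proof.
apply/val_inj/funext => n; rewrite /= !fctE /=.
by case: eqP => // _; rewrite scaler0 addr0.
Qed.

Lemma l2delta_norm j h : nm2 (l2delta j h) <= nm h.
Proof.
apply: nm2_le (hn_ge0 _ _) _ => N /=.
have [jN|Nj] := ltnP j N.
  rewrite (bigD1 (Ordinal jN)) //= eqxx big1 ?addr0 // => i.
  by rewrite -val_eqE /= => /negPf ->; rewrite hn0 expr0n.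
rewrite big1 ?sqr_ge0 // => i _; rewrite ltn_eqF ?hn0 ?expr0n //.
exact: leq_trans (ltn_ord i) Nj.
Qed.

Lemma ampl_delta T j h : bounded_op T -> ampl T (l2delta j h) = l2delta j (T h).
Proof.
move=> bT; apply/val_inj/funext => n; rewrite val_ampl //=.
by case: eqP => // _; rewrite linear0f //; case: bT.
Qed.

Lemma val_sum (I : Type) (r : seq I) (F : I -> l2) n :
  val (\sum_(i <- r) F i) n = \sum_(i <- r) val (F i) n.
Proof.
by elim: r => [|i r IH]; rewrite ?big_nil // !big_cons -IH.
Qed.

Lemma truncation_tends (u : l2) :
  to0 (fun N => nm2 (u - \sum_(j < N) l2delta j (val u j))).
Proof.
have uE N n : val (u - \sum_(j < N) l2delta j (val u j)) n =
    if (n < N)%N then 0 else val u n.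
  rewrite /= !fctE /= val_sum; case: ltnP => [nN|Nn].
    rewrite (bigD1 (Ordinal nN)) //= eqxx big1 ?addr0 ?subrr // => i.
    by rewrite -val_eqE /= eq_sym => /negPf ->.
  rewrite big1 ?subr0 // => i _ /=; rewrite gtn_eqF //.
  exact: leq_trans (ltn_ord i) Nn.
pose s N := \sum_(n < N) nm (val u n) ^+ 2.
have inc N : s N <= s N.+1 by rewrite /s big_ord_recr /= lerDl sqr_ge0.
have [l [sl _ hl]] := monotone_tends inc (nm2_ge u).
move=> e e0; have [N hN] := hl _ (exprn_gt0 2 (divr_gt0 e0 (ltr0n R 2))).
exists N => n Nn; apply: le_lt_trans (_ : e / 2 < e); last by lra.
apply: nm2_le => [|M]; first by rewrite divr_ge0 ?ltW.
apply: le_trans (ltW (hN _ Nn)); rewrite lerBrDr.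
apply: le_trans (sl (maxn n M)).
have sE k : (k <= maxn n M)%N ->
    s k = \sum_(i < maxn n M | (i < k)%N) nm (val u i) ^+ 2.
  by move=> km; rewrite /s (big_ord_widen _ (fun i => nm (val u i) ^+ 2) km).
have -> : \sum_(i < M) nm (val (u - \sum_(j < n) l2delta j (val u j)) i) ^+ 2 =
    \sum_(i < M) (if (i < n)%N then 0 else nm (val u i) ^+ 2).
  by apply: eq_bigr => i _; rewrite uE; case: ifP; rewrite ?hn0 ?expr0n.
rewrite {2}/s [leRHS](bigID (fun i : 'I__ => (i < n)%N)) -(sE n) ?leq_maxl //.
rewrite addrC lerD2l (big_ord_widen _
  (fun i => if (i < n)%N then 0 else nm (val u i) ^+ 2) (leq_maxr n M)).
rewrite big_mkcond [leRHS]big_mkcond; apply: ler_sum => i _.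
by case: (i < M)%N; case: (i < n)%N => //=; exact: sqr_ge0.
Qed.

(** * The von Neumann density theorem *)

Definition star_algebra (M : set (H -> H)) :=
  [/\ M `<=` bounded_op, M id,
      forall a S T, M S -> M T -> M (a *: S + T),
      forall S T, M S -> M T -> M (S \o T) & star_closed M].

(** The closure K of the vectors (S u_n)_n, for S in M, is invariant under the
    amplification of the *-algebra M, so the projection onto K commutes with it.
    The entries of this projection are in the commutant of M; hence T, amplified,
    commutes with the projection as well and maps u, an element of K, into K.
    Using infinite sequences u instead of single vectors is what yields density in
    the sigma-weak topology. *)
Theorem bicommutant_density (M : set (H -> H)) T u (e : R) :
  star_algebra M -> bicommutant M T -> square_summable u ->
  0 < e -> exists2 S, M S &
    forall N, \sum_(n < N) nm (T (u n) - S (u n)) ^+ 2 <= e ^+ 2.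
Proof.
move=> [Mbounded Mid Mlin Mcomp Mstar] TM su; pose U : l2 := mkl2 su.
have bT : bounded_op T by case: TM.
pose K := [set w : l2 | forall e : R, 0 < e ->
  exists2 S, M S & nm2 (w - ampl S U) < e].
have amplU S a S' : M S -> M S' -> ampl (a *: S + S') U = a *: ampl S U + ampl S' U.
  move=> MS MS'; apply/val_inj; rewrite val_ampl; last by apply: Mbounded; exact: Mlin.
  by rewrite /= !val_ampl //; exact: Mbounded.
have KU S : M S -> K (ampl S U).
  by move=> MS e' e0; exists S => //; rewrite subrr hn0.
have K0 : K 0.
  have -> : 0 = ampl ((-1) *: id + id) U :> l2.
    by rewrite amplU // scaleN1r addNr.
  exact/KU/Mlin.
have Klin a v w : K v -> K w -> K (a *: v + w).
  move=> Kv Kw e' e0; have a0 : 0 < abs a + 1 by rewrite ltr_wpDl ?abs_ge0.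
  have e2 : 0 < e' / 2 / (abs a + 1) by rewrite !divr_gt0.
  have [S MS hS] := Kv _ e2.
  have [S' MS' hS'] := Kw _ (divr_gt0 e0 (ltr0n R 2)).
  exists (a *: S + S'); first exact: Mlin.
  rewrite amplU // opprD addrACA -scalerBr; apply: le_lt_trans (hnD _ _ _) _.
  rewrite hnZ; move: hS; rewrite ltr_pdivlMr // => hS.
  exact: lincomb_lt (hn_ge0 _ _) hS hS'.
have Kcl : hclosed l2form K.
  move=> w hw e' e0; have e2 := divr_gt0 e0 (ltr0n R 2).
  have [v Kv hv] := hw _ e2; have [S MS hS] := Kv _ e2; exists S => //.
  by rewrite (splitr e'); apply: le_lt_trans (hn_triangle _ v _ _) (ltrD hv hS).
have amplB S v w : bounded_op S -> ampl S (v - w) = ampl S v - ampl S w.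
  by move=> bS; rewrite addrC -[- w]scaleN1r ampl_lin // scaleN1r addrC.
have Kinv S w : M S -> K w -> K (ampl S w).
  move=> MS Kw e' e0; have bS := Mbounded _ MS.
  have /bounded_opP[lS [c c0 cS]] := bS.
  have c1 : 0 < c + 1 by rewrite ltr_wpDl.
  have [S' MS' hS'] := Kw _ (divr_gt0 e0 c1); exists (S \o S'); first exact: Mcomp.
  have -> : ampl (S \o S') U = ampl S (ampl S' U).
    apply/val_inj; rewrite !val_ampl //; [exact: Mbounded|exact/Mbounded/Mcomp].
  rewrite -amplB //; apply: le_lt_trans (ampl_bound _ bS c0 cS) _.
  move: hS'; rewrite ltr_pdivlMr //; apply: le_lt_trans.
  by rewrite mulrC ler_wpM2l ?hn_ge0 // lerDl.
have /choice[p hp] : forall v, exists p, K p /\ forall k, K k -> l2form (v - p) k = 0.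
  move=> v; have [p Kp hp] := orthogonal_projection l2_complete K0 Klin Kcl v.
  by exists p.
have p_unique v q : K q -> (forall k, K k -> l2form (v - q) k = 0) -> q = p v.
  move=> Kq hq; have [Kp hpv] := hp v.
  have Kqp : K (q - p v) by rewrite addrC -scaleN1r; exact: Klin.
  apply/eqP; rewrite -subr_eq0 -(dnorm_eq0 l2form).
  by rewrite -{1}(subrKA v q) dotDl -[q - v]opprB dotNl hq // hpv // oppr0 addr0.
have plin a v w : p (a *: v + w) = a *: p v + p w.
  apply/esym/p_unique; first by apply: Klin; [case: (hp v)|case: (hp w)].
  move=> k Kk; rewrite opprD addrACA -scalerBr dotDl dotZl.
  by rewrite (hp v).2 // (hp w).2 // mulr0 addr0.
have pnorm v : nm2 (p v) <= nm2 v.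
  rewrite -ler_sqr ?nnegrE ?hn_ge0 // -[X in _ <= nm2 X ^+ 2](subrK (p v)).
  by rewrite hnD_sqr (hp v).2; [rewrite raddf0 mulr0 addr0 lerDr sqr_ge0|case: (hp v)].
have pampl S v : M S -> p (ampl S v) = ampl S (p v).
  move=> MS; have bS := Mbounded _ MS; have [S' MS' SS'] := Mstar _ MS.
  apply/esym/p_unique; first by apply: Kinv; case: (hp v).
  move=> k Kk; rewrite -amplB // (ampl_adjoint bS (Mbounded _ MS') SS').
  by apply: (hp v).2; exact: Kinv.
(* The projection commutes with the amplification of M, so its matrix entries
   lie in the commutant of M and T commutes with each of them. *)
have Tentry i j h : T (val (p (l2delta j h)) i) = val (p (l2delta j (T h))) i.
  pose P h := val (p (l2delta j h)) i.
  suff cP : commutant M P by have := congr1 (@^~ h) (TM.2 _ cP).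
  split.
    apply/bounded_opP; split; first by move=> a h1 h2; rewrite /P l2delta_lin plin.
    exists 1 => // h1; rewrite mul1r; apply: le_trans (nm_le_nm2 _ _) _.
    exact: le_trans (pnorm _) (l2delta_norm _ _).
  move=> S MS; apply/funext => h1; have bS := Mbounded _ MS.
  by rewrite /P /= -ampl_delta // pampl // val_ampl.
have Tp : ampl T (p U) = p (ampl T U).
  have amplD v w : ampl T (v + w) = ampl T v + ampl T w.
    by rewrite -[v]scale1r ampl_lin // !scale1r.
  have pD v w : p (v + w) = p v + p w by rewrite -[v]scale1r plin !scale1r.
  have ampl0 : ampl T 0 = 0 by have := amplD 0 0; rewrite addr0 => /eqP; rewrite -subr_eq subrr => /eqP.
  have p0 : p 0 = 0 by have := pD 0 0; rewrite addr0 => /eqP; rewrite -subr_eq subrr => /eqP.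
  have delta j h : ampl T (p (l2delta j h)) = p (ampl T (l2delta j h)).
    by apply/val_inj/funext => i; rewrite val_ampl // ampl_delta //= Tentry.
  have fin N : ampl T (p (\sum_(j < N) l2delta j (u j))) =
      p (ampl T (\sum_(j < N) l2delta j (u j))).
    elim: N => [|N IH]; first by rewrite big_ord0 p0 ampl0 p0.
    by rewrite big_ord_recr /= !(pD, amplD) IH delta.
  have /bounded_opP[_ [c c0 cT]] := bT.
  apply/eqP; rewrite -subr_eq0; apply/eqP/(hn_eq0 (f := l2form))/le_anti.
  rewrite hn_ge0 andbT; apply: to0_const.
  have c2 : 0 <= 2 * c by rewrite mulr_ge0.
  apply: to0_le (to0Z c2 (truncation_tends U)) _ => N /=.
  have [W WE] : exists W, W = U - \sum_(j < N) l2delta j (u j) by eexists.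
  rewrite -WE; have UE : U = W + \sum_(j < N) l2delta j (u j) by rewrite WE subrK.
  have -> : ampl T (p U) - p (ampl T U) = ampl T (p W) - p (ampl T W).
    by rewrite UE !(pD, amplD) fin opprD addrACA subrr addr0.
  apply: le_trans (hnD _ _ _) _; rewrite hnN.
  have h1 := ampl_bound (p W) bT c0 cT; have h2 := pnorm (ampl T W).
  have h3 := ampl_bound W bT c0 cT; have h4 := pnorm W.
  rewrite -mulrA mulr_natl mulr2n; apply: lerD.
    by apply: le_trans h1 _; rewrite ler_wpM2l.
  exact: le_trans h2 h3.
have pU : p U = U.
  have -> : U = ampl id U by apply/val_inj; rewrite val_ampl //; exact: bounded_id.
  by apply/esym/p_unique => [|k _]; [exact: KU|rewrite subrr dot0l].
move=> e0; have : K (ampl T U) by rewrite -{1}pU Tp; case: (hp (ampl T U)).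
move=> /(_ _ e0)[S MS hS]; exists S => // N.
apply: le_trans (nm2_sqsum (ltW e0) (ltW hS) N).
by apply: ler_sum => i _; rewrite /= !fctE !val_ampl //; exact: Mbounded.
Qed.

(** An equality between two matrix coefficients extends to the bicommutant, because T
    can be approximated on the two vectors h1 and h2 simultaneously. *)
Lemma bicommutant_dot2 (M : set (H -> H)) T (h1 k1 h2 k2 : H) :
  star_algebra M -> bicommutant M T ->
  (forall S, M S -> hdot (S h1) k1 = hdot (S h2) k2) ->
  hdot (T h1) k1 = hdot (T h2) k2.
Proof.
move=> aM TM eqM; apply/eqP; rewrite -subr_eq0; apply/eqP/abs_eq0/le_anti.
rewrite abs_ge0 andbT leNgt; apply/negP => d0.
set d := abs _ in d0; set K := nm k1 + nm k2.
have K0 : 0 <= K by rewrite addr_ge0 ?hn_ge0.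
have K1 : 0 < K + 1 by rewrite ltr_wpDl.
pose e := d / (K + 1); have e0 : 0 < e by rewrite divr_gt0.
have [S MS hS] := bicommutant_density aM TM (@sqsum_fin _ _ [:: h1; h2]) e0.
have := hS 2%N; rewrite !big_ord_recr big_ord0 /= add0r => h.
have n1 : nm (T h1 - S h1) <= e.
  by rewrite -ler_sqr ?nnegrE ?hn_ge0 ?(ltW e0) //; have := sqr_ge0 (nm (T h2 - S h2)); lra.
have n2 : nm (T h2 - S h2) <= e.
  by rewrite -ler_sqr ?nnegrE ?hn_ge0 ?(ltW e0) //; have := sqr_ge0 (nm (T h1 - S h1)); lra.
have dE : d = e * (K + 1) by rewrite /e divfK // gt_eqF.
suff : d <= e * K by rewrite dE; nra.
rewrite /d -(subrKA (hdot (S h1) k1)) -dotBl (eqM _ MS) -dotBl.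
apply: le_trans (absD _ _) _; rewrite mulrDr; apply: lerD.
  by apply: le_trans (cauchy_schwarz _ _ _) _; rewrite ler_wpM2r ?hn_ge0.
by apply: le_trans (cauchy_schwarz _ _ _) _; rewrite ler_wpM2r ?hn_ge0 // hnBC.
Qed.

Lemma bicommutant_orth (M : set (H -> H)) T (h k : H) :
  star_algebra M -> bicommutant M T ->
  (forall S, M S -> hdot (S h) k = 0) -> hdot (T h) k = 0.
Proof.
move=> aM TM hM; have := @bicommutant_dot2 M T h k h 0 aM TM.
by rewrite dot0r; apply => S MS; rewrite dot0r hM.
Qed.

End L2Space.

(** * Weak limits of sequences of operators *)

Section WeakClosure.
Variable R : realType.
Local Notation C := (Cx R).
Variable H : hilbertType C.
Implicit Types (S T B : H -> H) (M : set (H -> H)) (Ts : nat -> H -> H).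
Local Notation nm := (hn (@hdot _ H)).

Definition wlim Ts B := forall h k, ctends (fun n => hdot (Ts n h) k) (hdot (B h) k).

Lemma wlim_unique Ts B B' : wlim Ts B -> wlim Ts B' -> B = B'.
Proof. by move=> h h'; apply: op_ext => x y; apply: ctends_unique (h x y) (h' x y). Qed.

Lemma ctends_shift m (s : nat -> C) l : ctends (fun n => s (m + n)%N) l -> ctends s l.
Proof.
move=> sl e /sl[N hN]; exists (m + N)%N => n mn.
by rewrite -(subnKC (leq_trans (leq_addr N m) mn)); apply: hN; lia.
Qed.

Lemma ctends_eventually m (s t : nat -> C) l :
  (forall n, (m <= n)%N -> s n = t n) -> ctends s l -> ctends t l.
Proof.
move=> st sl; apply: (ctends_shift (m := m)) => e /sl[N hN]; exists N => n Nn.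
rewrite -st ?leq_addr //; apply: hN; exact: leq_trans (leq_addl _ _).
Qed.

Lemma wlim_bound Ts B c : (forall n, bounded_by c (Ts n)) -> wlim Ts B -> bounded_by c B.
Proof.
move=> bT TB h; have le k : abs (hdot (B h) k) <= c * nm h * nm k.
  by apply: ctends_abs (TB h k) _ => n; exact: dot_bound.
have := le (B h); rewrite dotvv abs_toC ger0_norm ?sqr_ge0 //.
have [->|n0] := eqVneq (nm (B h)) 0.
  by move=> _; apply: (le_trans _ (bT 0%N h)); exact: hn_ge0.
have np : 0 < nm (B h) by rewrite lt_def n0 hn_ge0.
by rewrite expr2 ler_pM2r.
Qed.

(** Multiplication by a fixed operator S is weakly continuous, on the left because S
    has an adjoint. *)
Lemma commutant_wlim M Ts B m : M `<=` bounded_op -> bounded_op B -> wlim Ts B ->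
  (forall n, (m <= n)%N -> commutant M (Ts n)) -> commutant M B.
Proof.
move=> Mb bB TB cT; split=> // S MS; have [S' bS' SS'] := adjoint (Mb _ MS).
apply: op_ext => h k /=; rewrite SS'; apply: ctends_unique (TB h (S' k)) _.
apply: (ctends_eventually (m := m)) (TB (S h) k) => n /cT[_ /(_ _ MS) cS].
by rewrite -SS' -[S (Ts n h)]/((S \o Ts n) h) cS.
Qed.

(** Boundedness makes the coefficients at arbitrary vectors uniformly close to those
    at vectors of D, hence Cauchy; the limit form is bounded and sesquilinear, and
    the Riesz representation turns it into an operator. *)
Lemma wlim_exists Ts c (D : set H) : 0 <= c ->
  (forall n, linear (Ts n)) -> (forall n, bounded_by c (Ts n)) ->
  (forall h (e : R), 0 < e -> exists2 d, D d & nm (h - d) < e) ->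
  (forall h k, D h -> D k -> exists l, ctends (fun n => hdot (Ts n h) k) l) ->
  exists2 B, bounded_op B & wlim Ts B.
Proof.
move=> c0 lT bT dD cD.
have /choice[l hl] : forall hk : H * H, exists l, ctends (fun n => hdot (Ts n hk.1) hk.2) l.
  move=> [h k] /=; apply: ccauchy_tends => e e0.
  have K0 : 0 < 8 * (c + 1) * (nm h + nm k + 1).
    by rewrite !mulr_gt0 // ltr_wpDl ?addr_ge0 ?hn_ge0.
  pose d := Num.min 1 (e / (8 * (c + 1) * (nm h + nm k + 1))).
  have d0 : 0 < d by rewrite lt_min ltr01 divr_gt0.
  have [h' Dh hh] := dD h _ d0; have [k' Dk kk] := dD k _ d0.
  have [z hz] := cD _ _ Dh Dk.
  have [N hN] := hz _ (divr_gt0 e0 (ltr0n R 4)).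
  have close n : abs (hdot (Ts n h) k - hdot (Ts n h') k') <= e / 4.
    have -> : hdot (Ts n h) k - hdot (Ts n h') k' =
        hdot (Ts n (h - h')) k + hdot (Ts n h') (k - k').
      by rewrite linearBf // dotBl dotBr addrA subrK.
    apply: le_trans (absD _ _) _.
    have b1 := dot_bound (bT n) (h - h') k; have b2 := dot_bound (bT n) h' (k - k').
    have h'h : nm h' <= nm h + d.
      by have := hnD hdot (h' - h) h; rewrite subrK (hnBC _ h'); lra.
    have d1 : d <= 1 by rewrite ge_min lexx.
    have dK : d * (8 * (c + 1) * (nm h + nm k + 1)) <= e.
      by rewrite -ler_pdivlMr // ge_min lexx orbT.
    have p0 := hn_ge0 hdot h; have q0 := hn_ge0 hdot k.
    have c1 : c * nm (h - h') * nm k <= c * d * nm k.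
      by rewrite ler_wpM2r // ler_wpM2l // ltW.
    have c2 : c * nm h' * nm (k - k') <= c * (nm h + 1) * d.
      apply: ler_pM; rewrite ?mulr_ge0 ?hn_ge0 //; last exact: ltW.
      by rewrite ler_wpM2l //; lra.
    have c3 : 8 * (c * d * nm k + c * (nm h + 1) * d) <= d * (8 * (c + 1) * (nm h + nm k + 1)).
      rewrite -subr_ge0.
      have -> : d * (8 * (c + 1) * (nm h + nm k + 1)) -
         8 * (c * d * nm k + c * (nm h + 1) * d) = 8 * d * (nm h + nm k + 1) by ring.
      by rewrite !mulr_ge0 ?(ltW d0) // !addr_ge0.
    lra.
  exists N => m n Nm Nn.
  have := close m; have := close n; have := hN _ Nm; have := hN _ Nn.
  set a := hdot _ _; set b := hdot _ _; set a' := hdot _ _; set b' := hdot _ _.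
  move=> h1 h2 h3 h4.
  have -> : b' - a' = (b' - b) + ((b - z) + ((z - a) + (a - a'))) by rewrite !subrKA.
  rewrite (absB a') in h3; rewrite (absB a) in h1.
  have := absD (b' - b) ((b - z) + ((z - a) + (a - a'))).
  have := absD (b - z) ((z - a) + (a - a')); have := absD (z - a) (a - a').
  lra.
have lbd h k : abs (l (h, k)) <= c * nm h * nm k.
  by apply: ctends_abs (hl (h, k)) _ => n; exact: dot_bound.
have /choice[B hB] : forall h, exists w, forall k, hdot w k = l (h, k).
  move=> h; have [|||w hw] := @riesz R H hdot (fun k => (l (h, k))^*) (c * nm h).
  - exact: hilbert_complete.
  - move=> a k k'; apply: (can_inj conjCK); rewrite conjCK rmorphD rmorphM /= !conjCK.
    apply: ctends_unique (hl _) _.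
    apply: ctends_ext (ctendsD (ctendsZ a^* (hl (h, k))) (hl (h, k'))) => n /=.
    by rewrite dotDr dotZr.
  - by move=> k; rewrite abs_conj.
  by exists w => k; rewrite dotC -hw conjCK.
have TB : wlim Ts B by move=> h k; rewrite hB; exact: (hl (h, k)).
exists B => //; apply/bounded_opP; split; last by exists c => //; exact: wlim_bound TB.
move=> a h k; apply: (@dot_ext2 _ _ hdot) => w; apply: ctends_unique (TB _ _) _.
rewrite dotDl dotZl; apply: ctends_ext (ctendsD (ctendsZ a (TB h w)) (TB k w)) => n /=.
by rewrite lT dotDl dotZl.
Qed.

End WeakClosure.

(** * Normal functionals as absolutely convergent triple series *)

Section CubeEnumeration.

Definition cube N : seq (nat * nat * nat) :=
  [seq (nk, l) | nk <- [seq (n, k) | n <- iota 0 N, k <- iota 0 N], l <- iota 0 N].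

Lemma mem_cube N n k l : ((n, k, l) \in cube N) = [&& n < N, k < N & l < N]%N.
Proof.
apply/allpairsP/and3P => [[[nk l'] /= [/allpairsP[[n' k'] /= [hn hk ->]] hl [-> -> ->]]]|[hn hk hl]].
  by move: hn hk hl; rewrite !mem_iota.
exists ((n, k), l) => /=; split=> //; last by rewrite mem_iota.
by apply/allpairsP; exists (n, k) => /=; rewrite !mem_iota.
Qed.

Lemma cube_uniq N : uniq (cube N).
Proof.
apply: allpairs_uniq; [|exact: iota_uniq|by move=> [? ?] [? ?]].
by apply: allpairs_uniq; [exact: iota_uniq|exact: iota_uniq|move=> [? ?] [? ?]].
Qed.

(** The triples of naturals are listed cube after cube, so that certain partial sums
    of the resulting simple series are the sums over the cubes. *)
Fixpoint shells N : seq (nat * nat * nat) :=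
  if N is M.+1 then shells M ++ [seq t <- cube M.+1 | t \notin shells M] else [::].

Lemma shellsS N :
  shells N.+1 = shells N ++ [seq t <- cube N.+1 | t \notin shells N].
Proof. by []. Qed.

Lemma cubeS N t : t \in cube N -> t \in cube N.+1.
Proof.
move: t => [[n k] l]; rewrite !mem_cube => /and3P[hn hk hl].
by apply/and3P; split; apply: ltnW; rewrite ltnS.
Qed.

Lemma shells_cube N : perm_eq (shells N) (cube N).
Proof.
suff [un sN] : uniq (shells N) /\ shells N =i cube N by apply: uniq_perm => //; exact: cube_uniq.
elim: N => [|N [un sN]] //; rewrite shellsS; split.
  rewrite cat_uniq un filter_uniq ?cube_uniq // andbT.
  by apply/hasPn => t; rewrite mem_filter => /andP[].
move=> t; rewrite mem_cat mem_filter sN; case: (boolP (t \in cube N)) => //=.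
by move=> tN; rewrite cubeS.
Qed.

Lemma shells_prefix M N : (M <= N)%N -> exists s, shells N = shells M ++ s.
Proof.
elim: N => [|N IH]; first by rewrite leqn0 => /eqP ->; exists [::].
rewrite leq_eqVlt => /orP[/eqP ->|]; first by exists [::]; rewrite cats0.
by rewrite ltnS => /IH[s hs]; rewrite shellsS {1}hs -catA; eexists.
Qed.

Lemma size_shells N : (N <= size (shells N))%N.
Proof.
rewrite (perm_size (shells_cube N)) !size_allpairs !size_iota.
by case: N => // N; rewrite -mulnA leq_pmulr.
Qed.

(** The lists shells N are prefixes of each other and shells N has at least N entries,
    so entry i may be read in shells i.+1. *)
Definition cube_enum i := nth (0, 0, 0)%N (shells i.+1) i.

Lemma cube_enum_sum (W : nmodType) (G : nat * nat * nat -> W) N :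
  \sum_(i < size (shells N)) G (cube_enum i) =
  \sum_(n < N) \sum_(k < N) \sum_(l < N) G (nat_of_ord n, nat_of_ord k, nat_of_ord l).
Proof.
have -> : \sum_(i < size (shells N)) G (cube_enum i) = \sum_(t <- shells N) G t.
  rewrite (big_nth (0, 0, 0)%N) big_mkord; apply: eq_bigr => -[i iN] _ /=; congr G.
  rewrite /cube_enum.
  have [le|/ltnW le] := leqP i.+1 N; have [s hs] := shells_prefix le.
    by rewrite [in RHS]hs nth_cat size_shells.
  by rewrite hs nth_cat iN.
rewrite (perm_big _ (shells_cube N)) /= big_allpairs_dep /= big_allpairs_dep /=.
have -> : iota 0 N = index_iota 0 N by rewrite /index_iota subn0.
rewrite big_mkord; apply: eq_bigr => n _.
by rewrite big_mkord; apply: eq_bigr => k _; rewrite big_mkord.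
Qed.

End CubeEnumeration.

Section Normality.
Variable R : realType.
Local Notation C := (Cx R).
Variable H : hilbertType C.
Local Notation nm := (hn (@hdot _ H)).
Variable D : set H.
Hypothesis Ddense : forall h (e : R), 0 < e -> exists2 d, D d & nm (h - d) < e.
Hypothesis Dsub : forall h k, D h -> D k -> D (h - k).

Lemma sum_pow2 N : \sum_(k < N) 2^-1 ^+ k <= 2 :> R.
Proof.
suff -> : \sum_(k < N) 2^-1 ^+ k = 2 - 2 * 2^-1 ^+ N :> R.
  by rewrite gerBl mulr_ge0 ?exprn_ge0 ?invr_ge0.
elim: N => [|N IH]; first by rewrite big_ord0 expr0; ring.
by rewrite big_ord_recr /= IH exprS; field.
Qed.

(** Each u_n is the sum of a series of vectors of D with geometrically decreasing
    norms, and the constants A_n are square summable. *)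
Lemma approximate_l2 (u : nat -> H) : square_summable u ->
  exists (a : nat -> nat -> H) (A : nat -> R), [/\ forall n k, D (a n k),
    forall n k, nm (a n k) <= A n * 4^-1 ^+ k,
    forall n K, nm (u n - \sum_(k < K) a n k) <= A n * 4^-1 ^+ K
  & exists B, forall N, \sum_(n < N) A n ^+ 2 <= B].
Proof.
move=> /sqsumP[B uB].
have p2 n : 0 < 2^-1 ^+ n :> R by rewrite exprn_gt0 // invr_gt0.
have p4 n : 0 < 4^-1 ^+ n :> R by rewrite exprn_gt0 // invr_gt0.
have D0 : D 0 by have [d Dd _] := Ddense 0 ltr01; rewrite -(subrr d); exact: Dsub.
(* The factor 2^-n keeps the tolerance positive when u_n = 0 and makes A_n
   square summable. *)
have /choice[c hc] : forall nk : nat * nat, exists c, D c /\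
    nm (u nk.1 - c) < 2^-1 ^+ nk.1 * 4^-1 ^+ nk.2.
  by move=> nk; have [c Dc hc] := Ddense (u nk.1) (mulr_gt0 (p2 nk.1) (p4 nk.2)); exists c.
pose s n k := if k is k'.+1 then c (n, k) else 0.
have sD n k : D (s n k) by case: k => // k; case: (hc (n, k.+1)).
have sS n k : nm (u n - s n k.+1) <= 2^-1 ^+ n * 4^-1 ^+ k.+1.
  by have [_ /ltW] := hc (n, k.+1).
pose A n := nm (u n) + 2 * 2^-1 ^+ n.
have sA n k : nm (u n - s n k) <= (if k is 0%N then nm (u n) else 2^-1 ^+ n * 4^-1 ^+ k).
  by case: k => [|k]; [rewrite subr0|exact: sS].
exists (fun n k => s n k.+1 - s n k), A; split.
- by move=> n k; exact: Dsub.
- move=> n k; rewrite /A; apply: le_trans (hn_triangle hdot (u n) _ _) _.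
  rewrite (hnBC _ _ (u n)); have h1 := sS n k; have h2 := sA n k.
  move: h1 h2 (hn_ge0 hdot (u n)) (p2 n) (p4 k); rewrite exprS; case: k => [|k].
    by rewrite expr0 mulr1; set y := 2^-1 ^+ n; lra.
  set y := 2^-1 ^+ n; set q := 4^-1 ^+ k.+1.
  move=> h1 h2 u0 y0 q0; have := mulr_gt0 y0 q0; have := mulr_ge0 u0 (ltW q0); lra.
- move=> n K; have -> : \sum_(k < K) (s n k.+1 - s n k) = s n K.
    by rewrite -(big_mkord xpredT (fun k => s n k.+1 - s n k)) telescope_sumr // subr0.
  apply: le_trans (sA n K) _; rewrite /A.
  have := hn_ge0 hdot (u n); have := p2 n; have := p4 K.
  by case: K => [|K]; rewrite ?expr0; nra.
- exists (2 * B + 8 * 2) => N.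
  apply: le_trans (_ : \sum_(n < N) (2 * nm (u n) ^+ 2 + 8 * 2^-1 ^+ n) <= _).
    apply: ler_sum => n _; rewrite /A.
    have q1 : 2^-1 ^+ n <= 1 :> R by apply: exprn_ile1; [rewrite invr_ge0|rewrite invf_le1 ?ler1n].
    have := sqr_ge0 (nm (u n) - 2 * 2^-1 ^+ n); have := p2 n.
    by rewrite sqrrB sqrrD; nra.
  rewrite big_split /= -!mulr_sumr; apply: lerD; apply: ler_wpM2l => //.
  exact: uB.
exact: sum_pow2.
Qed.

Variables (M : set (H -> H)) (E : (H -> H) -> (H -> H)) (W : nat -> H -> H).
Hypothesis Mbounded : M `<=` bounded_op.
Hypothesis Ebounded : forall S, M S -> bounded_op (E S).
Hypothesis Wnorm : forall m h, nm (W m h) = nm h.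
Hypothesis EW : forall h k, D h -> D k ->
  exists m, forall S, M S -> hdot (E S h) k = hdot (S (W m h)) (W m k).

(** With u_n = sum_k a_nk and v_n = sum_l b_nl, the value of the functional at E S is
    the sum over (n, k, l) of <E S a_nk, b_nl>, that is of a coefficient of S at
    shifted copies of a_nk and b_nl.  The series converges absolutely since
    the norms are at most A_n 4^-k and A'_n 4^-l. *)
Theorem normal_functional_pullback (u v : nat -> H) :
  square_summable u -> square_summable v ->
  exists u' v', [/\ square_summable u', square_summable v' &
    forall S, M S -> normal_functional u v (E S) = normal_functional u' v' S].
Proof.
move=> su sv.
have [a [A [aD aA uA [B hB]]]] := approximate_l2 su.
have [b [A' [bD bA vA [B' hB']]]] := approximate_l2 sv.
have A0 n : 0 <= A n by have := aA n 0%N; rewrite expr0 mulr1; apply: le_trans (hn_ge0 _ _).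
have A'0 n : 0 <= A' n by have := bA n 0%N; rewrite expr0 mulr1; apply: le_trans (hn_ge0 _ _).
have /choice[m hm] : forall t : nat * nat * nat, exists m, forall S, M S ->
    hdot (E S (a t.1.1 t.1.2)) (b t.1.1 t.2) =
    hdot (S (W m (a t.1.1 t.1.2))) (W m (b t.1.1 t.2)).
  by move=> t; apply: EW.
(* The product of the norms of a_nk and b_nl is summable over the triples, but
   each norm alone is not; the scaling by r k l and its inverse r l k shares the
   decay equally between the two vectors. *)
pose r k l : R := 2 ^+ k * 2^-1 ^+ l.
have r0 k l : 0 <= r k l by rewrite mulr_ge0 ?exprn_ge0 ?invr_ge0.
have two0 : (2 : R) != 0 by rewrite pnatr_eq0.
have rr k l : r k l * r l k = 1.
  by rewrite /r [2 ^+ l * _]mulrC mulrACA -!exprMn divff // mulVf // !expr1n mulr1.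
have scale k l (c z : R) : 0 <= z -> z <= c * 4^-1 ^+ k -> r k l * z <= c * (2^-1 ^+ k * 2^-1 ^+ l).
  move=> z0 zc; apply: le_trans (ler_wpM2l (r0 k l) zc) _.
  rewrite /r mulrCA le_eqVlt; apply/orP; left; apply/eqP; congr (_ * _).
  by rewrite mulrAC -exprMn; congr (_ ^+ _ * _); field.
pose u' t := toC (r t.1.2 t.2) *: W (m t) (a t.1.1 t.1.2).
pose v' t := toC (r t.2 t.1.2) *: W (m t) (b t.1.1 t.2).
have absr k l : abs (toC (r k l)) = r k l by rewrite abs_toC ger0_norm.
have u'n t : nm (u' t) ^+ 2 <= A t.1.1 ^+ 2 * (2^-1 ^+ t.1.2 * 2^-1 ^+ t.2).
  set q := 2^-1 ^+ t.1.2 * 2^-1 ^+ t.2.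
  have q0 : 0 <= q by rewrite mulr_ge0 ?exprn_ge0 ?invr_ge0.
  have q1 : q <= 1.
    by apply: mulr_ile1; rewrite ?exprn_ge0 ?invr_ge0 //;
      apply: exprn_ile1; rewrite ?invr_ge0 // invf_le1 ?ler1n.
  apply: le_trans (_ : (A t.1.1 * q) ^+ 2 <= _).
    rewrite ler_sqr ?nnegrE ?hn_ge0 //; last exact: mulr_ge0.
    rewrite /u' hnZ absr Wnorm.
    by apply: scale; [exact: hn_ge0|exact: aA].
  rewrite exprMn ler_wpM2l ?sqr_ge0 // expr2 ler_piMr //.
have v'n t : nm (v' t) ^+ 2 <= A' t.1.1 ^+ 2 * (2^-1 ^+ t.2 * 2^-1 ^+ t.1.2).
  set q := 2^-1 ^+ t.2 * 2^-1 ^+ t.1.2.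
  have q0 : 0 <= q by rewrite mulr_ge0 ?exprn_ge0 ?invr_ge0.
  have q1 : q <= 1.
    by apply: mulr_ile1; rewrite ?exprn_ge0 ?invr_ge0 //;
      apply: exprn_ile1; rewrite ?invr_ge0 // invf_le1 ?ler1n.
  apply: le_trans (_ : (A' t.1.1 * q) ^+ 2 <= _).
    rewrite ler_sqr ?nnegrE ?hn_ge0 //; last exact: mulr_ge0.
    rewrite /v' hnZ absr Wnorm.
    by apply: scale; [exact: hn_ge0|exact: bA].
  rewrite exprMn ler_wpM2l ?sqr_ge0 // expr2 ler_piMr //.
have sqsum_enum (g : nat * nat * nat -> H) (c : nat -> R) (Bc : R) :
    (forall N, \sum_(n < N) c n ^+ 2 <= Bc) ->
    (forall t, nm (g t) ^+ 2 <= c t.1.1 ^+ 2 * (2^-1 ^+ t.1.2 * 2^-1 ^+ t.2)) ->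
    square_summable (g \o cube_enum).
  move=> cB gc; apply/sqsumP; exists (Bc * (2 * 2)) => N.
  apply: le_trans (_ : \sum_(i < size (shells N)) nm (g (cube_enum i)) ^+ 2 <= _).
    rewrite (big_ord_widen _ (fun i => nm (g (cube_enum i)) ^+ 2) (size_shells N)).
    by rewrite [leRHS](bigID (fun i : 'I__ => (i < N)%N)) /= lerDl sumr_ge0 // => i _; exact: sqr_ge0.
  rewrite (cube_enum_sum (fun t => nm (g t) ^+ 2)).
  have S2 : \sum_(k < N) \sum_(l < N) (2^-1 ^+ k * 2^-1 ^+ l) <= 2 * 2 :> R.
    under eq_bigr do rewrite -mulr_sumr.
    rewrite -mulr_suml; apply: ler_pM; try exact: sum_pow2;
    by apply: sumr_ge0 => i _; rewrite exprn_ge0 ?invr_ge0.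
  apply: le_trans (_ : \sum_(n < N) c n ^+ 2 * (2 * 2) <= _).
    apply: ler_sum => n _; apply: le_trans (ler_wpM2l (sqr_ge0 (c n)) S2).
    rewrite mulr_sumr; apply: ler_sum => k _; rewrite mulr_sumr.
    by apply: ler_sum => l _; exact: (gc (nat_of_ord n, nat_of_ord k, nat_of_ord l)).
  by rewrite -mulr_suml ler_wpM2r // mulr_ge0.
exists (u' \o cube_enum), (v' \o cube_enum).
have su' : square_summable (u' \o cube_enum) by exact: sqsum_enum hB u'n.
have sv' : square_summable (v' \o cube_enum).
  by apply: sqsum_enum hB' _ => t; rewrite [X in _ * X]mulrC.
split=> // S MS; have bS := Mbounded MS; have bE := Ebounded MS.
have /bounded_opP[lS _] := bS; have /bounded_opP[lE [c c0 cE]] := bE.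
have lim1 := normal_functional_tends su sv bE.
have lim2 := to0_sub size_shells (normal_functional_tends su' sv' bS).
apply: ctends_unique lim1 _.
pose x N n := \sum_(k < N) a n k; pose y N n := \sum_(l < N) b n l.
have cubeE N : \sum_(i < size (shells N)) hdot (S ((u' \o cube_enum) i)) ((v' \o cube_enum) i) =
    \sum_(n < N) hdot (E S (x N n)) (y N n).
  rewrite (cube_enum_sum (fun t => hdot (S (u' t)) (v' t))); apply: eq_bigr => n _.
  rewrite /x linear_sumf // dot_suml; apply: eq_bigr => k _.
  rewrite /y dot_sumr; apply: eq_bigr => l _.
  rewrite /u' /v' linearZf // dotZl dotZr conj_toC mulrA -rmorphM rr rmorph1 mul1r.
  by rewrite -(hm (nat_of_ord n, nat_of_ord k, nat_of_ord l)).
have K0 : 0 <= c * (3 * (B + B')).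
  have := hB 0%N; have := hB' 0%N; rewrite !big_ord0 => h1 h2.
  by rewrite !mulr_ge0 // addr_ge0.
apply: to0_le (to0D lim2 (to0Z K0 (@to0_pow2 R))) _ => N /=.
rewrite -[X in abs X](subrKA (\sum_(i < size (shells N)) hdot (S (u' (cube_enum i))) (v' (cube_enum i)))).
apply: le_trans (absD _ _) _; rewrite addrC lerD2l.
rewrite (cubeE N) -sumrB; apply: le_trans (abs_sum _ _ _) _.
apply: le_trans (_ : \sum_(n < N) c * (3 * (A n ^+ 2 + A' n ^+ 2)) * 2^-1 ^+ N <= _); last first.
  rewrite -mulr_suml ler_wpM2r ?exprn_ge0 ?invr_ge0 // -mulr_sumr ler_wpM2l //.
  by rewrite -mulr_sumr ler_wpM2l // big_split lerD.
apply: ler_sum => n _.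
have -> : hdot (E S (u n)) (v n) - hdot (E S (x N n)) (y N n) =
    hdot (E S (u n - x N n)) (v n) + hdot (E S (x N n)) (v n - y N n).
  by rewrite linearBf // dotBl dotBr addrA subrK.
apply: le_trans (absD _ _) _.
have b1 := dot_bound cE (u n - x N n) (v n); have b2 := dot_bound cE (x N n) (v n - y N n).
have q42 : 4^-1 ^+ N <= 2^-1 ^+ N :> R.
  by rewrite lerXn2r ?nnegrE ?invr_ge0 // lef_pV2 ?posrE // ler_nat.
have q1 : 4^-1 ^+ N <= 1 :> R.
  by apply: exprn_ile1; rewrite ?invr_ge0 // invf_le1 ?ler1n.
have q0 : 0 <= 4^-1 ^+ N :> R by rewrite exprn_ge0 ?invr_ge0.
have vn : nm (v n) <= A' n.
  by have := vA n 0%N; rewrite big_ord0 subr0 expr0 mulr1.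
have un : nm (u n) <= A n.
  by have := uA n 0%N; rewrite big_ord0 subr0 expr0 mulr1.
have uxn : nm (u n - x N n) <= A n * 2^-1 ^+ N.
  by apply: le_trans (uA n N) _; rewrite ler_wpM2l.
have vyn : nm (v n - y N n) <= A' n * 2^-1 ^+ N.
  by apply: le_trans (vA n N) _; rewrite ler_wpM2l.
have xn : nm (x N n) <= 2 * A n.
  have := hnD hdot (x N n - u n) (u n); rewrite subrK hnBC.
  have : nm (u n - x N n) <= A n.
    by apply: le_trans (uA n N) _; rewrite ler_piMr.
  lra.
set q := 2^-1 ^+ N in uxn vyn *.
have qq : 0 <= q by rewrite exprn_ge0 ?invr_ge0.
have c1 : c * nm (u n - x N n) * nm (v n) <= c * (A n * q) * A' n.
  by apply: ler_pM; rewrite ?mulr_ge0 ?hn_ge0 // ler_wpM2l.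
have c2 : c * nm (x N n) * nm (v n - y N n) <= c * (2 * A n) * (A' n * q).
  by apply: ler_pM; rewrite ?mulr_ge0 ?hn_ge0 // ler_wpM2l.
apply: le_trans (lerD (le_trans b1 c1) (le_trans b2 c2)) _.
have -> : c * (A n * q) * A' n + c * (2 * A n) * (A' n * q) = c * (3 * (A n * A' n)) * q by ring.
rewrite ler_wpM2r // ler_wpM2l // ler_wpM2l //.
by have := sqr_ge0 (A n - A' n); rewrite sqrrB; have := mulr_ge0 (A0 n) (A'0 n); lra.
Qed.

End Normality.

(** * The sigma-weak topology *)

Section SigmaWeak.
Variable R : realType.
Local Notation C := (Cx R).
Variable H : hilbertType C.
Implicit Types (S T B : H -> H) (Ts : nat -> H -> H) (M : set (H -> H)).
Local Notation nm := (hn (@hdot _ H)).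
Local Notation nm2 := (hn (l2form H)).

Lemma normal_functionalE (u v : nat -> H) (su : square_summable u)
  (sv : square_summable v) T : bounded_op T ->
  normal_functional u v T = l2form H (ampl T (mkl2 su)) (mkl2 sv).
Proof. by move=> bT; rewrite /l2form /= /l2dot val_ampl. Qed.

Lemma l2form_delta j (h : H) (w : l2 H) : l2form H (l2delta j h) w = hdot h (val w j).
Proof.
apply: ctends_unique (l2dot_tends _ _) _.
apply: (ctends_eventually (m := j.+1)) (ctends_cst _) => n jn /=.
rewrite (bigD1 (Ordinal jn)) //= eqxx big1 ?addr0 // => i.
by rewrite -val_eqE /= => /negPf ->; rewrite dot0l.
Qed.

(** The error of truncating the series is controlled by the norm of T alone, which is
    why weak convergence of bounded sequences implies sigma-weak convergence. *)
Lemma normal_functional_trunc (u v : nat -> H) : square_summable u -> square_summable v ->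
  exists2 t : nat -> R, to0 t & forall T c N, bounded_op T -> 0 <= c -> bounded_by c T ->
    abs (normal_functional u v T - \sum_(j < N) hdot (T (u j)) (v j)) <= c * t N.
Proof.
move=> su sv; pose W := mkl2 sv; pose U := mkl2 su.
pose U_ N : l2 H := \sum_(j < N) l2delta j (u j).
exists (fun N => nm2 W * nm2 (U - U_ N)).
  by apply: to0Z; [exact: hn_ge0|exact: (truncation_tends U)].
move=> T c N bT c0 cT; rewrite (normal_functionalE su sv bT) -/U -/W.
have -> : \sum_(j < N) hdot (T (u j)) (v j) = l2form H (ampl T (U_ N)) W.
  rewrite /U_; elim: N => [|N IH].
    by rewrite !big_ord0 -[0 in RHS](subrr U) -scaleN1r addrC ampl_lin // scaleN1r addNr dot0l.
  rewrite !big_ord_recr /= IH [in RHS]addrC -[in RHS](scale1r (l2delta N (u N))).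
  by rewrite ampl_lin // scale1r dotDl ampl_delta // l2form_delta addrC.
rewrite -dotBl.
have -> : ampl T U - ampl T (U_ N) = ampl T (U - U_ N).
  by rewrite [U - _]addrC -[- U_ N]scaleN1r ampl_lin // scaleN1r addrC.
apply: le_trans (cauchy_schwarz _ _ _) _; rewrite mulrCA mulrC ler_wpM2l ?hn_ge0 //.
exact: ampl_bound.
Qed.

Lemma wlim_normal_functional Ts B c (u v : nat -> H) : 0 <= c ->
  (forall n, bounded_op (Ts n)) -> (forall n, bounded_by c (Ts n)) ->
  bounded_op B -> wlim Ts B -> square_summable u -> square_summable v ->
  ctends (fun n => normal_functional u v (Ts n)) (normal_functional u v B).
Proof.
move=> c0 bT cT bB TB su sv; have [t t0 ht] := normal_functional_trunc su sv.
have cB := wlim_bound cT TB.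
move=> e e0; have e3 : 0 < e / 3 by rewrite divr_gt0.
have [N hN] := to0Z c0 t0 e3; have {}hN := hN N (leqnn N).
have sumN : ctends (fun n => \sum_(j < N) hdot (Ts n (u j)) (v j))
    (\sum_(j < N) hdot (B (u j)) (v j)).
  by apply: ctends_sum => j; exact: TB.
have [K hK] := sumN _ e3; exists K => n /hK.
have := ht _ _ N (bT n) c0 (cT n); have := ht _ _ N bB c0 cB.
set a := normal_functional _ _ _; set b := normal_functional _ _ _.
set p := \sum_(j < N) _; set q := \sum_(j < N) _ => h1 h2 h3.
have -> : b - a = (b - q) + ((q - p) + (p - a)) by rewrite !subrKA.
rewrite (absB a) in h1.
have := absD (b - q) ((q - p) + (p - a)); have := absD (q - p) (p - a).
lra.
Qed.

(** Approximation on two square-summable sequences reduces to approximation on one: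
    this makes the sets that generate the filter below directed. *)
Definition interleave (u v : nat -> H) n := if odd n then v n./2 else u n./2.

Lemma interleave_sum (g : H -> R) (u v : nat -> H) N :
  \sum_(n < N.*2) g (interleave u v n) = \sum_(n < N) (g (u n) + g (v n)).
Proof.
elim: N => [|N IH]; first by rewrite !big_ord0.
rewrite doubleS !big_ord_recr /= IH addrA /interleave /= odd_double /=.
by rewrite doubleK uphalf_double.
Qed.

Lemma sqsum_interleave (u v : nat -> H) :
  square_summable u -> square_summable v -> square_summable (interleave u v).
Proof.
move=> /sqsumP[A uA] /sqsumP[B vB]; apply/sqsumP; exists (A + B) => N.
apply: le_trans (_ : \sum_(n < N.*2) nm (interleave u v n) ^+ 2 <= _).
  rewrite (big_ord_widen N.*2 (fun n => nm (interleave u v n) ^+ 2)).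
    by rewrite [leRHS](bigID (fun i : 'I__ => (i < N)%N)) /= lerDl sumr_ge0 // => i _; exact: sqr_ge0.
  by rewrite -addnn leq_addr.
by rewrite (interleave_sum (fun h => nm h ^+ 2)) big_split lerD.
Qed.

(** The filter is generated by the sets of all S in M that approximate T on a
    square-summable sequence u up to e; the density theorem says that they are
    nonempty, and the Cauchy-Schwarz inequality gives the convergence. *)
Theorem bicommutant_sigma_weak M T : star_algebra M -> bicommutant M T ->
  exists F : set_system (H -> H), [/\ ProperFilter F, F M & sigma_weak_cvg F T].
Proof.
move=> aM TM; have [Mb _ _ _ _] := aM.
pose I := [set ue : (nat -> H) * R | square_summable ue.1 /\ 0 < ue.2].
pose B (ue : (nat -> H) * R) := [set S | M S /\
  forall N, \sum_(n < N) nm (T (ue.1 n) - S (ue.1 n)) ^+ 2 <= ue.2 ^+ 2].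
have i0 : I ((fun=> 0), 1).
  by split=> //; apply/sqsumP; exists 0 => N; rewrite big1 // => i _; rewrite hn0 expr0n.
have FP : ProperFilter (filter_from I B).
  apply: filter_from_proper; last first.
    by move=> [u e] [/= su e0]; have [S MS hS] := bicommutant_density aM TM su e0; exists S.
  apply: filter_from_filter; first by exists ((fun=> 0), 1); exact: i0.
  move=> [u e] [v d] /= [/= su e0] [/= sv d0].
  exists (interleave u v, Num.min e d).
    by split=> /=; [exact: sqsum_interleave|rewrite lt_min e0].
  move=> S [MS /= hS].
  have m0 : 0 <= Num.min e d by rewrite le_min !ltW.
  split; split=> //= N.
    apply: le_trans (_ : Num.min e d ^+ 2 <= _); last first.
      by rewrite ler_sqr ?nnegrE ?(ltW e0) // ge_min lexx.
    apply: le_trans (hS N.*2); rewrite (interleave_sum (fun h => nm (T h - S h) ^+ 2)).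
    by apply: ler_sum => n _; rewrite lerDl sqr_ge0.
  apply: le_trans (_ : Num.min e d ^+ 2 <= _); last first.
    by rewrite ler_sqr ?nnegrE ?(ltW d0) // ge_min lexx orbT.
  apply: le_trans (hS N.*2); rewrite (interleave_sum (fun h => nm (T h - S h) ^+ 2)).
  by apply: ler_sum => n _; rewrite lerDr sqr_ge0.
exists (filter_from I B); split; first exact: FP.
  by exists ((fun=> 0), 1); [exact: i0|move=> S []].
move=> u v su sv; apply/cvgrPdist_lt => e e0.
have bT : bounded_op T by case: TM.
pose W := mkl2 sv; pose U := mkl2 su.
have re0 : 0 < reC e by rewrite -ltr_toC raddf0 -ge0_toC // ltW.
have K1 : 0 < nm2 W + 1 by rewrite ltr_wpDl ?hn_ge0.
have d0 : 0 < reC e / (nm2 W + 1) by rewrite divr_gt0.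
exists (u, reC e / (nm2 W + 1)); first exact: (conj su d0).
  move=> S [/Mb bS hS] /=.
have -> : e = toC (reC e) by apply: ge0_toC; exact: ltW.
rewrite absE ltr_toC.
rewrite (normal_functionalE su sv bT) (normal_functionalE su sv bS) -dotBl; apply: le_lt_trans (cauchy_schwarz _ _ _) _.
have le1 : nm2 (ampl T U - ampl S U) <= reC e / (nm2 W + 1).
  apply: nm2_le (ltW d0) _ => N; apply: le_trans (hS N); apply: ler_sum => n _.
  by rewrite /= !fctE !val_ampl.
apply: le_lt_trans (ler_wpM2r (hn_ge0 _ _) le1) _.
by rewrite mulrAC ltr_pdivrMr // ltr_pM2l // ltrDl.
Qed.

Lemma normal_functional_fin T (h k : H) : bounded_op T ->
  normal_functional (fin_seq [:: h]) (fin_seq [:: k]) T = hdot (T h) k.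
Proof.
move=> bT; apply: ctends_unique (normal_functional_tends _ _ bT) _; try exact: sqsum_fin.
apply: (ctends_eventually (m := 1)) (ctends_cst _) => -[//|n] _.
rewrite big_ord_recl big1 ?addr0 // => i _ /=.
by rewrite /fin_seq /= nth_nil dot0r.
Qed.

End SigmaWeak.

(** * Continuity of morphisms and representations of C*-algebras *)

Section CStarNorm.
Variable R : realType.
Local Notation C := (Cx R).
Variable A : cstarType C.
Implicit Types (x y h : A) (a : C).

Definition cn x : R := reC (cnorm x).

Lemma cnE x : cnorm x = toC (cn x).
Proof. by rewrite -ge0_toC // cnorm_ge0. Qed.
Lemma cn_ge0 x : 0 <= cn x. Proof. by rewrite reC_ge0 // cnorm_ge0. Qed.
Lemma cn_eq0 x : cn x = 0 -> x = 0.
Proof. by move=> h; apply: cnorm_eq0; rewrite cnE h raddf0. Qed.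
Lemma cnD x y : cn (x + y) <= cn x + cn y.
Proof. by rewrite -ler_toC raddfD /= -!cnE ler_cnormD. Qed.
Lemma cnZ a x : cn (a *: x) = abs a * cn x.
Proof. by apply: (fmorph_inj (@toC R)); rewrite /= rmorphM /= -!cnE -absE cnormZ. Qed.
Lemma cnM x y : cn (x * y) <= cn x * cn y.
Proof. by rewrite -ler_toC rmorphM /= -!cnE ler_cnormM. Qed.
Lemma cnN x : cn (- x) = cn x.
Proof. by rewrite -scaleN1r cnZ absN /abs normr1 mul1r. Qed.
Lemma cnB x y : cn (x - y) = cn (y - x).
Proof. by rewrite -cnN opprB. Qed.
Lemma cn0 : cn 0 = 0.
Proof. by rewrite -(scale0r (0 : A)) cnZ abs0 mul0r. Qed.
Lemma cn_triangle z x y : cn (x - y) <= cn (x - z) + cn (z - y).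
Proof. by rewrite -[x - y](subrKA z) cnD. Qed.
Lemma cn_star_sqr x : cn (star x * x) = cn x ^+ 2.
Proof. by apply: (fmorph_inj (@toC R)); rewrite /= rmorphXn /= -!cnE cnorm_star. Qed.

Lemma cn_star x : cn (star x) = cn x.
Proof.
have le y : cn y <= cn (star y).
  have [->|y0] := eqVneq (cn y) 0; first exact: cn_ge0.
  have yp : 0 < cn y by rewrite lt_def y0 cn_ge0.
  by rewrite -(ler_pM2r yp) -expr2 -cn_star_sqr cnM.
by apply/le_anti; rewrite le andbT; have := le (star x); rewrite starK.
Qed.

Lemma star0 : star (0 : A) = 0.
Proof. by rewrite -(scale0r (0 : A)) starZ rmorph0 !scale0r. Qed.
Lemma starN x : star (- x) = - star x.
Proof. by rewrite -scaleN1r starZ rmorphN1 scaleN1r. Qed.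
Lemma starB x y : star (x - y) = star x - star y.
Proof. by rewrite starD starN. Qed.
Lemma star1 : star (1 : A) = 1.
Proof. by rewrite -[LHS]mul1r -{1}[1]starK -starM mul1r starK. Qed.
Lemma cn1 : cn 1 = 1.
Proof.
have h := cn_star_sqr 1; rewrite star1 mulr1 in h.
have n0 : cn 1 != 0 by apply/eqP => /cn_eq0/eqP; rewrite oner_eq0.
by apply: (mulfI n0); rewrite mulr1 -expr2 -h.
Qed.

Lemma cn_complete (u : nat -> A) : (forall e : R, 0 < e -> exists N, forall m n,
    (N <= m)%N -> (N <= n)%N -> cn (u m - u n) < e) ->
  exists l, to0 (fun n => cn (u n - l)).
Proof.
move=> cu; have [|l hl] := @cnorm_complete _ _ u.
  move=> e e0; have [|N hN] := cu (reC e).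
    by rewrite -ltr_toC raddf0 -ge0_toC // ltW.
  by exists N => m n Nm Nn; rewrite cnE [e]ge0_toC ?ltr_toC ?hN // ltW.
exists l => e e0; have [N hN] := hl (toC e) (etrans (toC_gt0 e) e0).
by exists N => n /hN; rewrite cnE ltr_toC.
Qed.

Lemma cn_lim_unique (u : nat -> A) l l' : to0 (fun n => cn (u n - l)) ->
  to0 (fun n => cn (u n - l')) -> l = l'.
Proof.
move=> h h'; apply/eqP; rewrite -subr_eq0; apply/eqP/cn_eq0/le_anti.
rewrite cn_ge0 andbT; apply: to0_const; apply: to0_le (to0D h h') _ => n.
by rewrite (cnB (u n) l); exact: cn_triangle.
Qed.

Definition unitary u := star u * u = 1 :> A /\ u * star u = 1.

(** Let k be a square root of 1 - h^2 that commutes with h; then u = h + i k is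
    unitary with real part h.  The root is 1 - l, where l = (h^2 + l^2) / 2 is
    obtained by iterating a contraction. *)
Lemma selfadjoint_unitaries h : star h = h -> cn h <= 2^-1 ->
  exists2 u, unitary u & h = 2^-1 *: (u + star u).
Proof.
move=> sh h2; pose a := h * h; have sa : star a = a by rewrite starM sh.
have a4 : cn a <= 4^-1.
  apply: (le_trans (cnM h h)); have := cn_ge0 h.
  by move: h2; set t := cn h => h2 t0; nra.
have half : abs (2^-1 : C) = 2^-1.
  by rewrite -(rmorph_nat (@toC R)) -fmorphV abs_toC ger0_norm ?invr_ge0.
pose F (y : A) := 2^-1 *: (a + y * y).
pose y n := iter n F 0.
have yS n : y n.+1 = F (y n) by [].
have yb n : cn (y n) <= 4^-1.
  elim: n => [|n IH]; first by rewrite /y /= cn0 invr_ge0.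
  rewrite yS /F cnZ half.
  have := cnD a (y n * y n); have := cnM (y n) (y n); have := cn_ge0 (y n).
  by nra.
have Fdiff v w : cn v <= 4^-1 -> cn w <= 4^-1 -> cn (F v - F w) <= 4^-1 * cn (v - w).
  move=> v4 w4; rewrite /F -scalerBr cnZ half.
  have -> : a + v * v - (a + w * w) = v * (v - w) + (v - w) * w.
    by rewrite opprD addrACA subrr add0r mulrBr mulrBl addrA subrK.
  have := cnD (v * (v - w)) ((v - w) * w); have := cnM v (v - w); have := cnM (v - w) w.
  by have := cn_ge0 (v - w); nra.
have ystep n : cn (y n.+1 - y n) <= 2^-1 ^+ n.
  elim: n => [|n IH].
    by rewrite expr0 [y 0%N]/(0 : A) subr0; apply: le_trans (yb _) _; lra.
  have := Fdiff (y n.+1) (y n) (yb _) (yb _); rewrite -!yS => /le_trans; apply.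
  rewrite exprS.
  have := cn_ge0 (y n.+1 - y n); move: IH; set t := _ ^+ n; set s := cn _; lra.
have [l hl] : exists l, to0 (fun n => cn (y n - l)).
  have bnd n k : cn (y (n + k)%N - y n) <= 2 * 2^-1 ^+ n * (1 - 2^-1 ^+ k).
    elim: k => [|k IH]; first by rewrite addn0 !subrr cn0 mulr0.
    rewrite addnS; apply: le_trans (cn_triangle (y (n + k)%N) _ _) _.
    apply: le_trans (lerD (ystep _) IH) _; rewrite exprD exprS.
    by rewrite le_eqVlt; apply/orP; left; apply/eqP; field.
  apply: cn_complete => e e0.
  have [N hN] := to0Z (ler0n R 4) (@to0_pow2 R) e0.
  exists N => m n hm hn; rewrite -(subnKC hm) -(subnKC hn).
  have b k : cn (y (N + k)%N - y N) <= 2 * 2^-1 ^+ N.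
    apply: le_trans (bnd N k) _; apply: ler_piMr; first by rewrite !mulr_ge0 ?exprn_ge0 ?invr_ge0.
    by rewrite gerBl exprn_ge0 ?invr_ge0.
  have := b (m - N)%N; have := b (n - N)%N; have := hN N (leqnn _).
  have := cn_triangle (y N) (y (N + (m - N))%N) (y (N + (n - N))%N).
  rewrite (cnB (y N)); lra.
have l4 : cn l <= 4^-1.
  rewrite -subr_le0; apply: to0_const; apply: to0_le hl _ => n.
  by have := cnD (y n) (l - y n); rewrite subrKC (cnB l); have := yb n; lra.
have sl : star l = l.
  apply: (cn_lim_unique (u := y) _ hl); apply: to0_le hl _ => n.
  have sy : star (y n) = y n.
    elim: n => [|n IH]; first by rewrite star0.
    by rewrite yS /F starZ starD sa starM IH fmorphV rmorph_nat.
  by rewrite -{1}sy -starB cn_star.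
have hyl : h * l = l * h.
  have comm n : h * y n = y n * h.
    elim: n => [|n IH]; first by rewrite mulr0 mul0r.
    rewrite yS /F -scalerAl -scalerAr mulrDr mulrDl /a !mulrA.
    by rewrite IH -!mulrA IH.
  apply/eqP; rewrite -subr_eq0; apply/eqP/cn_eq0/le_anti; rewrite cn_ge0 andbT.
  apply: to0_const; apply: to0_le hl _ => n.
  have -> : h * l - l * h = h * (l - y n) - (l - y n) * h.
    by rewrite mulrBr mulrBl comm opprB subrKA.
  have := cnD (h * (l - y n)) (- ((l - y n) * h)); rewrite cnN.
  have := cnM h (l - y n); have := cnM (l - y n) h; rewrite (cnB l).
  have := cn_ge0 (y n - l); move: h2; set s := cn h; set t := cn (y n - l); nra.
have fixl : l = F l.
  apply: (cn_lim_unique (u := fun n => y n.+1)).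
    by move=> e /hl[N hN]; exists N => n Nn; exact/hN/leqW.
  apply: to0_le hl _ => n; rewrite yS; apply: le_trans (Fdiff _ _ (yb n) l4) _.
  by have := cn_ge0 (y n - l); lra.
pose k := 1 - l.
have sk : star k = k by rewrite starB star1 sl.
have hk : h * k = k * h by rewrite mulrBr mulrBl hyl mulr1 mul1r.
have l2E : l * l = 2%:R *: l - a.
  by rewrite {3}fixl /F scalerA divff ?pnatr_eq0 // scale1r addrC addKr.
have kk : k * k = 1 - h * h.
  rewrite -/a.
  rewrite mulrBr mulr1 mulrBl mul1r l2E scaler_nat mulr2n.
  by rewrite opprB [l + l - a - l]addrAC addrK subrKA.
clearbody k a.
pose u := h + 'i *: k.
have su : star u = h - 'i *: k.
  by rewrite starD starZ sh sk conjCi scaleNr.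
have ii : 'i *: k * ('i *: k) = - (k * k).
  by rewrite -scalerAl -scalerAr scalerA -expr2 sqrCi scaleN1r.
have cik : 'i *: k * h = h * ('i *: k) by rewrite -scalerAl -scalerAr hk.
exists u; last first.
  by rewrite su addrACA subrr addr0 -[h + h]mulr2n -[h *+ 2]scaler_nat scalerA mulVf ?pnatr_eq0 // scale1r.
split; rewrite su ?mulrDl ?mulrDr ?mulNr ?mulrN ii cik opprK kk addrA.
  by rewrite addrK subrKC.
by rewrite subrK subrKC.
Qed.

(** Morphisms and representations have norm one on unitaries, hence are bounded on the
    selfadjoint elements, which are combinations of two unitaries. *)
Lemma seminorm_bound (g : A -> R) (K : R) :
  (forall x y, g (x + y) <= g x + g y) -> (forall a x, g (a *: x) = abs a * g x) ->
  (forall u, unitary u -> g u <= K) ->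
  forall h, star h = h -> g h <= 2 * K * cn h.
Proof.
move=> gD gZ gu h sh; have [h0|h0] := eqVneq (cn h) 0.
  by rewrite h0 (cn_eq0 h0) -(scale0r (0 : A)) gZ abs0 mul0r mulr0.
have hp : 0 < cn h by rewrite lt_def h0 cn_ge0.
pose t : R := (2 * cn h)^-1; have tp : 0 < t by rewrite invr_gt0 mulr_gt0.
have abst : abs (toC t) = t by rewrite abs_toC gtr0_norm.
have [||u uu hu] := @selfadjoint_unitaries (toC t *: h).
- by rewrite starZ conj_toC sh.
- rewrite cnZ abst /t le_eqVlt; apply/orP; left; apply/eqP; field; exact: h0.
have uu' : unitary (star u) by case: uu => u1 u2; split; rewrite starK.
have half : abs (2^-1 : C) = 2^-1.
  by rewrite -(rmorph_nat (@toC R)) -fmorphV abs_toC ger0_norm ?invr_ge0.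
have gt : t * g h <= K.
  rewrite -abst -gZ hu gZ half.
  by have := gD u (star u); have := gu _ uu; have := gu _ uu'; lra.
have -> : g h = 2 * cn h * (t * g h) by rewrite /t; field; exact: h0.
have -> : 2 * K * cn h = 2 * cn h * K by ring.
by rewrite ler_pM2l // mulr_gt0.
Qed.

End CStarNorm.

Section Morphisms.
Variable R : realType.
Local Notation C := (Cx R).

(** By the C*-identity it is enough to bound f on the selfadjoint element x^* x. *)
Lemma starHom_bound (A B : cstarType C) (f : starHom A B) x : cn (f x) <= 2 * cn x.
Proof.
have sa h : star h = h -> cn (f h) <= 2 * cn h.
  move=> sh; have := @seminorm_bound _ _ (fun y => cn (f y)) 1 _ _ _ h sh; rewrite mulr1.
  apply=> [y z|a y|u [u1 _]] /=.
  - by rewrite raddfD cnD.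
  - by rewrite linearZ cnZ.
  - rewrite -ler_sqr ?nnegrE ?cn_ge0 // expr1n -cn_star_sqr -starHomP -rmorphM u1 rmorph1.
    by rewrite cn1.
rewrite -ler_sqr ?nnegrE ?mulr_ge0 ?cn_ge0 // -cn_star_sqr -starHomP -rmorphM.
apply: le_trans (sa _ _) _; first by rewrite starM starK.
by rewrite cn_star_sqr; have := sqr_ge0 (cn x); nra.
Qed.

Lemma rep_bound (P : cstarType C) (H : hilbertType C) (pi : starRep P H) x :
  bounded_by (2 * cn x) (pi x).
Proof.
move=> h; have piD y z k : pi (y + z) k = pi y k + pi z k.
  by rewrite -[y]scale1r rep_linear !fctE !scale1r.
have pi0 k : pi 0 k = 0 by apply: (addrI (pi 0 k)); rewrite -piD !addr0.
have piZ a y k : pi (a *: y) k = a *: pi y k.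
  by rewrite -[a *: y]addr0 rep_linear !fctE pi0 addr0.
have sa y : star y = y -> hn hdot (pi y h) <= 2 * hn hdot h * cn y.
  move=> sy; apply: (@seminorm_bound _ _ (fun z => hn hdot (pi z h)) _ _ _ _ y sy).
  - move=> z w.
    by rewrite piD hnD.
  - by move=> a z; rewrite piZ hnZ.
  - move=> u [u1 _]; rewrite -ler_sqr ?nnegrE ?hn_ge0 // !hn_sqr -rep_star.
    by rewrite -[pi (star u) _]/((pi (star u) \o pi u) h) -repM u1 rep1.
rewrite -ler_sqr ?nnegrE ?mulr_ge0 ?cn_ge0 ?hn_ge0 // hn_sqr -rep_star.
rewrite -[pi (star x) _]/((pi (star x) \o pi x) h) -repM.
apply: le_trans (ler_norm _) _; apply: le_trans (reC_le_abs _) _.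
apply: le_trans (cauchy_schwarz _ _ _) _.
apply: le_trans (ler_wpM2r (hn_ge0 _ _) (sa _ _)) _; first by rewrite starM starK.
rewrite cn_star_sqr; have := sqr_ge0 (cn x * hn hdot h); nra.
Qed.

End Morphisms.

(** * A C*-subalgebra as a C*-algebra *)

Section Subalgebra.
Variable R : realType.
Local Notation C := (Cx R).
Variables (A : cstarType C) (B : set A) (hB : cstar_subalgebra B).

(** The proof that B is a C*-subalgebra is an argument so that the structures below,
    which depend on it, can be inferred from the type. *)
Definition csub_pred (_ : cstar_subalgebra B) : {pred A} := fun x => `[< B x >].

Fact csub_closed : GRing.subalg_closed (csub_pred hB).
Proof.
have [_ B1 Blin BM _] := hB; split; first exact/asboolP.
- by move=> a x y /asboolP Bx /asboolP By; apply/asboolP/Blin.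
- by move=> x y /asboolP Bx /asboolP By; apply/asboolP/BM.
Qed.
HB.instance Definition _ :=
  GRing.isSubalgClosed.Build C A (csub_pred hB)
    (GRing.subalg_closed_semi csub_closed).

Definition csub := {x : A | csub_pred hB x}.
HB.instance Definition _ := SubType.on csub.
HB.instance Definition _ := [Choice of csub by <:].
HB.instance Definition _ := [SubChoice_isSubAlgebra of csub by <:].

Lemma csubP (x : csub) : B (val x).
Proof. exact/asboolP/(valP x). Qed.

Lemma csub_star_subproof (x : csub) : csub_pred hB (star (val x)).
Proof. by apply/asboolP; have [_ _ _ _] := hB; apply; exact: csubP. Qed.

Definition csub_star (x : csub) : csub :=
  exist (fun y => csub_pred hB y) _ (csub_star_subproof x).
Definition csub_norm (x : csub) : C := cnorm (val x).

Fact csub_starK : involutive csub_star.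
Proof. by move=> x; apply/val_inj; exact: starK. Qed.
Fact csub_starD : {morph csub_star : x y / x + y}.
Proof. by move=> x y; apply/val_inj; exact: starD. Qed.
Fact csub_starZ (a : C) x : csub_star (a *: x) = a^* *: csub_star x.
Proof. by apply/val_inj; exact: starZ. Qed.
Fact csub_starM x y : csub_star (x * y) = csub_star y * csub_star x.
Proof. by apply/val_inj; exact: starM. Qed.
Fact csub_norm_eq0 x : csub_norm x = 0 -> x = 0.
Proof. by move=> h; apply/val_inj; exact: cnorm_eq0 h. Qed.
Fact csub_complete (u : nat -> csub) :
  (forall e : C, 0 < e -> exists N, forall m n,
     (N <= m)%N -> (N <= n)%N -> csub_norm (u m - u n) < e) ->
  exists l, forall e : C, 0 < e -> exists N, forall n,
     (N <= n)%N -> csub_norm (u n - l) < e.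
Proof.
move=> cu; have [l hl] := @cnorm_complete _ A (fun n => val (u n)) cu.
have Bl : B l.
  have [Bcl _ _ _ _] := hB; apply: Bcl => e /hl[N /(_ N (leqnn N)) hN].
  by exists (val (u N)); [exact: csubP|rewrite cnE cnB -cnE].
by exists (exist (fun y => csub_pred hB y) l (asboolT Bl)).
Qed.

HB.instance Definition _ := @isCStarAlgebra.Build C csub csub_star csub_starK
  csub_starD csub_starZ csub_starM csub_norm (fun x => cnorm_ge0 (val x))
  csub_norm_eq0 (fun x y => ler_cnormD (val x) (val y))
  (fun a x => cnormZ a (val x)) (fun x y => ler_cnormM (val x) (val y))
  (fun x => cnorm_star (val x)) csub_complete.

Definition csub_val : csub -> A := val.
Fact csub_val_lin : linear csub_val. Proof. by []. Qed.
Fact csub_val_mul : monoid_morphism csub_val. Proof. by []. Qed.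
HB.instance Definition _ := GRing.isLinear.Build C csub A _ csub_val csub_val_lin.
HB.instance Definition _ := GRing.isMonoidMorphism.Build csub A csub_val csub_val_mul.
Fact csub_val_star : {morph csub_val : x / star x >-> star x}. Proof. by []. Qed.
Definition csub_hom : starHom csub A := @StarHom _ csub A csub_val csub_val_star.

End Subalgebra.

(** * Free products: generation, shifts and localized elements *)

Section FreeProducts.
Variable R : realType.
Local Notation C := (Cx R).

Fact idfun_star (A : cstarType C) : {morph (idfun : A -> A) : x / star x >-> star x}.
Proof. by []. Qed.
Definition id_hom (A : cstarType C) : starHom A A :=
  @StarHom _ A A idfun (@idfun_star A).

Fact comp_star (A B D : cstarType C) (g : starHom B D) (f : starHom A B) :
  {morph g \o f : x / star x >-> star x}.
Proof. by move=> x /=; rewrite !starHomP. Qed.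
Definition comp_hom (A B D : cstarType C) (g : starHom B D) (f : starHom A B) :
  starHom A D := @StarHom _ A D (g \o f) (comp_star g f).

Lemma fp_liftE J (A : cstarType C) (P : freeProduct J A) (D : cstarType C)
  (f : J -> starHom A D) j a : fp_lift P f (fp_in P j a) = f j a.
Proof. by rewrite /fp_lift; case: cid2. Qed.

Lemma fp_hom_eq J (A : cstarType C) (P : freeProduct J A) (D : cstarType C)
  (g g' : starHom P D) :
  (forall j a, g (fp_in P j a) = g' (fp_in P j a)) -> g =1 g'.
Proof.
move=> gg' x.
have [h _ hu] := fp_univ P (fun j => comp_hom g' (fp_in P j)).
by rewrite (hu g) ?(hu g').
Qed.

(** The embeddings of A take values in B, so they lift to a morphism from the free
    product to B.  Followed by the inclusion of B it fixes all copies of A, and is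
    therefore the identity. *)
Theorem fp_generated J (A : cstarType C) (P : freeProduct J A) (B : set P) :
  cstar_subalgebra B -> (forall j a, B (fp_in P j a)) -> forall x, B x.
Proof.
move=> hB gen x.
have cls j a : csub_pred hB (fp_in P j a) by exact/asboolP.
pose i j a : csub hB := exist (fun y => csub_pred hB y) _ (cls j a).
have ilin j : linear (i j) by move=> a y z; apply/val_inj; exact: linearP.
have imul j : monoid_morphism (i j).
  by split=> [|y z]; apply/val_inj; [exact: rmorph1|exact: rmorphM].
have istar j : {morph i j : y / star y >-> star y}.
  by move=> y; apply/val_inj; exact: starHomP.
pose il j := GRing.isLinear.Build C A (csub hB) _ (i j) (ilin j).
pose im j := GRing.isMonoidMorphism.Build A (csub hB) (i j) (imul j).
pose ilr j : {lrmorphism A -> csub hB} := HB.pack (i j) (il j) (im j).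
pose ih j : starHom A (csub hB) := @StarHom _ _ _ (ilr j) (istar j).
pose g := fp_lift P ih.
have gE : comp_hom (csub_hom hB) g =1 id_hom P.
  by apply: fp_hom_eq => j a /=; rewrite fp_liftE.
by rewrite -[x]/(id_hom P x) -gE /=; exact: csubP.
Qed.

Lemma cstar_closedP (A : cstarType C) (B : set A) : cstar_subalgebra B ->
  forall x, (forall e : R, 0 < e -> exists2 y, B y & cn (x - y) < e) -> B x.
Proof.
move=> [Bcl _ _ _ _] x hx; apply: Bcl => e e0.
have [|y By hy] := hx (reC e); first by rewrite -ltr_toC raddf0 -ge0_toC // ltW.
by exists y => //; rewrite cnE [e]ge0_toC ?ltr_toC // ltW.
Qed.

Lemma cstar_subalgebraP (A : cstarType C) (B : set A) :
  (forall x, (forall e : R, 0 < e -> exists2 y, B y & cn (x - y) < e) -> B x) ->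
  B 1 -> (forall (a : C) x y, B x -> B y -> B (a *: x + y)) ->
  (forall x y, B x -> B y -> B (x * y)) -> (forall x, B x -> B (star x)) ->
  cstar_subalgebra B.
Proof.
move=> Bcl B1 Blin BM Bs; split=> // x hx; apply: Bcl => e e0.
have [y By hy] := hx (toC e) (etrans (toC_gt0 e) e0).
by exists y => //; move: hy; rewrite cnE ltr_toC.
Qed.

(** The preimage is closed because *-homomorphisms are continuous. *)
Lemma cstar_subalgebra_preimage (A D : cstarType C) (f : starHom A D) (B : set D) :
  cstar_subalgebra B -> cstar_subalgebra (f @^-1` B).
Proof.
move=> hB; have [_ B1 Blin BM Bs] := hB; apply: cstar_subalgebraP => /=.
- move=> x hx; apply: (cstar_closedP hB) => e e0.
  have [y By hy] := hx _ (divr_gt0 e0 (ltr0n R 2)).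
  exists (f y) => //; rewrite -raddfB; apply: le_lt_trans (starHom_bound _ _) _.
  by rewrite mulrC -ltr_pdivlMr.
- by rewrite rmorph1.
- by move=> a x y Bx By; rewrite linearP; exact: Blin.
- by move=> x y Bx By; rewrite rmorphM; exact: BM.
- by move=> x Bx; rewrite starHomP; exact: Bs.
Qed.

Lemma cstar_subalgebra_closure (A : cstarType C) (D : set A) :
  D 1 -> (forall (a : C) x y, D x -> D y -> D (a *: x + y)) ->
  (forall x y, D x -> D y -> D (x * y)) -> (forall x, D x -> D (star x)) ->
  cstar_subalgebra [set x | forall e : R, 0 < e -> exists2 y, D y & cn (x - y) < e].
Proof.
move=> D1 Dlin DM Ds; apply: cstar_subalgebraP => /=.
- move=> x hx e e0; have e2 := divr_gt0 e0 (ltr0n R 2).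
  have [y hy xy] := hx _ e2; have [z Dz yz] := hy _ e2; exists z => //.
  by have := cn_triangle y x z; lra.
- by move=> e e0; exists 1 => //; rewrite subrr cn0.
- move=> a x y hx hy e e0; have a0 : 0 < abs a + 1 by rewrite ltr_wpDl ?abs_ge0.
  have [x' Dx xx] := hx _ (divr_gt0 (divr_gt0 e0 (ltr0n R 2)) a0).
  have [y' Dy yy] := hy _ (divr_gt0 e0 (ltr0n R 2)).
  exists (a *: x' + y'); first exact: Dlin.
  rewrite opprD addrACA -scalerBr; apply: le_lt_trans (cnD _ _) _; rewrite cnZ.
  move: xx; rewrite ltr_pdivlMr // => xx.
  by have := abs_ge0 a; have := cn_ge0 (x - x'); nra.
- move=> x y hx hy e e0.
  have x1 : 0 < cn x + 1 by rewrite ltr_wpDl ?cn_ge0.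
  have [y' Dy yy] := hy _ (divr_gt0 (divr_gt0 e0 (ltr0n R 2)) x1).
  have y1 : 0 < cn y' + 1 by rewrite ltr_wpDl ?cn_ge0.
  have [x' Dx xx] := hx _ (divr_gt0 (divr_gt0 e0 (ltr0n R 2)) y1).
  exists (x' * y'); first exact: DM.
  have -> : x * y - x' * y' = x * (y - y') + (x - x') * y'.
    by rewrite mulrBr mulrBl addrA subrK.
  apply: le_lt_trans (cnD _ _) _.
  apply: le_lt_trans (lerD (cnM _ _) (cnM _ _)) _.
  move: xx yy; rewrite !ltr_pdivlMr // => xx yy.
  have := cn_ge0 x; have := cn_ge0 y'; have := cn_ge0 (x - x').
  by have := cn_ge0 (y - y'); nra.
- move=> x hx e /hx[y Dy xy]; exists (star y); first exact: Ds.
  by rewrite -starB cn_star.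
Qed.

Section Local.
Variables (J : Type) (A : cstarType C) (P : freeProduct J A).
Implicit Types F G : set J.

Lemma fp_local_in F j a : F j -> fp_local F (fp_in P j a).
Proof. by move=> Fj B [_]; apply; exists j => //; exists a. Qed.

Lemma fp_local_min F (B : set P) : cstar_subalgebra B ->
  (forall j a, F j -> B (fp_in P j a)) -> fp_local F `<=` B.
Proof. by move=> hB gen x; apply; split=> // _ [j Fj [a _ <-]]; exact: gen. Qed.

Lemma fp_local_subalgebra F : cstar_subalgebra (@fp_local _ J A P F).
Proof.
split.
- move=> x hx B BF; case: (BF) => -[Bcl _ _ _ _] _; apply: Bcl => e /hx[y Fy xy].
  by exists y => //; exact: Fy.
- by move=> B [[]].
- by move=> a x y Fx Fy B BF; case: (BF) => -[_ _ + _ _] _; apply; [exact: Fx|exact: Fy].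
- by move=> x y Fx Fy B BF; case: (BF) => -[_ _ _ + _] _; apply; [exact: Fx|exact: Fy].
- by move=> x Fx B BF; case: (BF) => -[_ _ _ _ +] _; apply; exact: Fx.
Qed.

Lemma fp_localS F G : F `<=` G -> @fp_local _ J A P F `<=` fp_local G.
Proof.
move=> FG; apply: fp_local_min; first exact: fp_local_subalgebra.
by move=> j a /FG; exact: fp_local_in.
Qed.

End Local.

Section Shifts.
Variables (A : cstarType C) (PN : freeProduct nat A) (PZ : freeProduct int A).
Local Notation emb := (embNZ PN PZ).

Definition unshiftZ : starHom PZ PZ := fp_lift PZ (fun j => fp_in PZ (j - 1)).

Lemma shiftZK : cancel (shiftZ PZ) unshiftZ.
Proof.
apply: (@fp_hom_eq _ _ _ _ (comp_hom unshiftZ (shiftZ PZ)) (id_hom PZ)) => j a /=.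
by rewrite !fp_liftE addrK.
Qed.

Lemma unshiftZK : cancel unshiftZ (shiftZ PZ).
Proof.
apply: (@fp_hom_eq _ _ _ _ (comp_hom (shiftZ PZ) unshiftZ) (id_hom PZ)) => j a /=.
by rewrite !fp_liftE subrK.
Qed.

Lemma emb_shift x : emb (shiftN PN x) = shiftZ PZ (emb x).
Proof.
apply: (@fp_hom_eq _ _ _ _ (comp_hom emb (shiftN PN)) (comp_hom (shiftZ PZ) emb)) => j a /=.
by rewrite !fp_liftE -addn1 PoszD.
Qed.

Lemma fp_local_shift (F G : set nat) (x : PN) :
  (forall j, F j -> G j.+1) -> fp_local F x -> fp_local G (shiftN PN x).
Proof.
move=> FG Fx; apply: (@fp_local_min _ _ _ F (shiftN PN @^-1` fp_local G) _ _ x Fx).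
  exact/cstar_subalgebra_preimage/fp_local_subalgebra.
by move=> j a Fj; rewrite /= fp_liftE; apply: fp_local_in; exact: FG.
Qed.

Lemma fp_local_iter_shift n (F G : set nat) (x : PN) :
  (forall j, F j -> G (n + j)%N) -> fp_local F x -> fp_local G (iter n (shiftN PN) x).
Proof.
elim: n G => [|n IH] G FG Fx; first by apply: fp_localS Fx.
by rewrite iterS; apply: (@fp_local_shift [set j | G j.+1]) => //; exact: IH.
Qed.

(** The localized elements form a *-algebra, whose closure contains all copies
    of A. *)
Lemma local_dense (x : PN) (e : R) : 0 < e ->
  exists n, exists2 y, fp_local `I_n y & cn (x - y) < e.
Proof.
pose D := [set y : PN | exists n, fp_local `I_n y].
have mono m n : (m <= n)%N -> @fp_local _ _ _ PN `I_m `<=` fp_local `I_n.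
  by move=> mn; apply: fp_localS => k /= km; exact: leq_trans mn.
suff cD : cstar_subalgebra [set x | forall e : R, 0 < e -> exists2 y, D y & cn (x - y) < e].
  move=> e0; have gen := fp_generated cD.
  have [|y [n Dy] xy] := gen _ x e e0.
    move=> j a e' e'0; exists (fp_in PN j a); last by rewrite subrr cn0.
    by exists j.+1; apply: fp_local_in => /=.
  by exists n, y.
apply: cstar_subalgebra_closure.
- by exists 0%N; have [_ + _ _ _] := @fp_local_subalgebra _ _ PN `I_0; apply.
- move=> a y z [m Dy] [n Dz]; exists (maxn m n).
  have [_ _ + _ _] := @fp_local_subalgebra _ _ PN `I_(maxn m n); apply.
    by apply: mono Dy; rewrite leq_maxl.
  by apply: mono Dz; rewrite leq_maxr.
- move=> y z [m Dy] [n Dz]; exists (maxn m n).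
  have [_ _ _ + _] := @fp_local_subalgebra _ _ PN `I_(maxn m n); apply.
    by apply: mono Dy; rewrite leq_maxl.
  by apply: mono Dz; rewrite leq_maxr.
- move=> y [m Dy]; exists m.
  by have [_ _ _ _ +] := @fp_local_subalgebra _ _ PN `I_m; apply.
Qed.

(** The k-th power of the backward shift, as a morphism. *)
Definition pastZ k : starHom PZ PZ := iter k (comp_hom unshiftZ) (id_hom PZ).

Lemma pastZ_shift k x : pastZ k.+1 (shiftZ PZ x) = pastZ k x.
Proof. by elim: k => [|k IH] /=; [rewrite shiftZK|rewrite -IH]. Qed.

Lemma pastZ_shiftN k j x : pastZ (j + k) (emb (iter j (shiftN PN) x)) = pastZ k (emb x).
Proof.
elim: j => // j IH; rewrite iterS emb_shift addSn pastZ_shift; exact: IH.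
Qed.

(** Elements of this form are a *-algebra: two of them can be written with the same
    number k of backward shifts, by shifting their localized parts forward. *)
Lemma past_dense (x : PZ) (e : R) : 0 < e ->
  exists k n, exists2 y, fp_local `I_n y & cn (x - pastZ k (emb y)) < e.
Proof.
pose D := [set z : PZ | exists k n, exists2 y, fp_local `I_n y & z = pastZ k (emb y)].
have loc2 (y z : PZ) : D y -> D z -> exists k n, exists y' z',
    [/\ @fp_local _ _ _ PN `I_n y', fp_local `I_n z', y = pastZ k (emb y') &
        z = pastZ k (emb z')].
  move=> [k [m [y' Fy ->]]] [l [n [z' Fz ->]]].
  exists (l + k)%N, (maxn (l + m) (k + n)).
  exists (iter l (shiftN PN) y'), (iter k (shiftN PN) z'); split.
  - by apply: fp_local_iter_shift Fy => j /= jm; lia.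
  - by apply: fp_local_iter_shift Fz => j /= jm; lia.
  - by rewrite pastZ_shiftN.
  - by rewrite addnC pastZ_shiftN.
suff cD : cstar_subalgebra [set x | forall e : R, 0 < e -> exists2 y, D y & cn (x - y) < e].
  move=> e0; have gen := fp_generated cD.
  have [|_ [k [n [y Fy ->]]] xy] := gen _ x e e0; last by exists k, n, y.
  move=> j a e' e'0; exists (fp_in PZ j a); last by rewrite subrr cn0.
  case: j => j.
    exists 0%N, j.+1, (fp_in PN j a); first by apply: fp_local_in => /=.
    by rewrite /= fp_liftE.
  exists j.+1, 1%N, (fp_in PN 0%N a); first by apply: fp_local_in.
  rewrite fp_liftE NegzE -[- _]add0r; elim: j.+1 => [|i IH] /=; first by rewrite subr0.
  by rewrite -IH fp_liftE -addn1 PoszD opprD addrA.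
apply: cstar_subalgebra_closure.
- exists 0%N, 0%N, 1; last by rewrite /= rmorph1.
  by have [_ + _ _ _] := @fp_local_subalgebra _ _ PN `I_0; apply.
- move=> a y z Dy Dz; have [k [n [y' [z' [Fy Fz -> ->]]]]] := loc2 _ _ Dy Dz.
  exists k, n, (a *: y' + z'); last by rewrite !linearP.
  by have [_ _ + _ _] := @fp_local_subalgebra _ _ PN `I_n; apply.
- move=> y z Dy Dz; have [k [n [y' [z' [Fy Fz -> ->]]]]] := loc2 _ _ Dy Dz.
  exists k, n, (y' * z'); last by rewrite !rmorphM.
  by have [_ _ _ + _] := @fp_local_subalgebra _ _ PN `I_n; apply.
- move=> _ [k [n [y Fy ->]]]; exists k, n, (star y); last by rewrite !starHomP.
  by have [_ _ _ _ +] := @fp_local_subalgebra _ _ PN `I_n; apply.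
Qed.

End Shifts.
End FreeProducts.

(** * Extending isometries from a dense subspace *)

Section IsometryExtension.
Variable R : realType.
Local Notation C := (Cx R).
Variable H : hilbertType C.
Implicit Types (h k : H) (U : H -> H).
Local Notation nm := (hn (@hdot _ H)).

Definition isometric U := forall h k, hdot (U h) (U k) = hdot h k.

Lemma closure_approx (D : set H) h (e : R) : closure D h -> 0 < e ->
  exists2 k, D k & nm (h - k) < e.
Proof.
move=> clD e0; have e0' : 0 < toC e by rewrite toC_gt0.
have [k [Dk]] := clD _ (nbhsx_ballx h _ e0').
by rewrite -ball_normE /= normHE ltr_toC => hk; exists k.
Qed.

(** Polarization: the real part of the inner product is determined by norms, and its
    imaginary part is the real part of another inner product. *)
Lemma isometric_of_norm U : linear U -> (forall h, nm (U h) = nm h) -> isometric U.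
Proof.
move=> lU nU.
have re h k : reC (hdot (U h) (U k)) = reC (hdot h k).
  have := hnD_sqr hdot (U h) (U k); have := hnD_sqr hdot h k.
  by rewrite -linearDf // !nU; lra.
move=> h k; apply/eqP; rewrite eq_complex; apply/andP; split; apply/eqP.
  exact: re.
have := re ('i *: h) k; rewrite linearZf // !dotZl !reCi => /eqP.
by rewrite eqr_opp => /eqP.
Qed.

(** The value U h is characterised by being at least as close to g x as h is to f x,
    for all x; this single condition gives linearity and preservation of norms. *)
Theorem extend_isometry (P : lmodType C) (f g : P -> H) :
  linear f -> linear g -> (forall x, nm (g x) = nm (f x)) ->
  (forall h (e : R), 0 < e -> exists x, nm (h - f x) < e) ->
  exists U, [/\ linear U, isometric U & forall x, U (f x) = g x].
Proof.
move=> lf lg gf df.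
have fB x y : f (x - y) = f x - f y by rewrite addrC -scaleN1r lf scaleN1r addrC.
have gB x y : g (x - y) = g x - g y by rewrite addrC -scaleN1r lg scaleN1r addrC.
have /choice[U hU] : forall h, exists h', forall x, nm (h' - g x) <= nm (h - f x).
  move=> h; have /choice[s hs] : forall n, exists x, nm (h - f x) < n.+1%:R^-1.
    by move=> n; apply: df; rewrite invr_gt0.
  have cf : to0 (fun n => nm (f (s n) - h)).
    by apply: to0_le (@to0_invS R) _ => n; rewrite hnBC; exact: ltW.
  have [|h' hh'] := @hilbert_complete R H (g \o s).
    move=> e /(to0_hcauchy cf)[N hN]; exists N => m n Nm Nn.
    by rewrite /= -gB gf fB; exact: hN.
  exists h' => x; rewrite -subr_le0; apply: to0_const.
  apply: to0_le (to0D hh' cf) _ => n /=.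
  have h1 := hn_triangle hdot (g (s n)) h' (g x).
  have h2 := hn_triangle hdot h (f (s n)) (f x).
  rewrite -gB gf fB in h1; rewrite (hnBC _ h' (g (s n))) in h1; lra.
have Uf x : U (f x) = g x.
  apply/eqP; rewrite -subr_eq0; apply/eqP/(hn_eq0 (f := hdot))/le_anti.
  by rewrite hn_ge0 andbT; apply: le_trans (hU _ _) _; rewrite subrr hn0.
have lU : linear U.
  move=> a h k; apply/eqP; rewrite -subr_eq0; apply/eqP/(hn_eq0 (f := hdot))/le_anti.
  rewrite hn_ge0 andbT leNgt; apply/negP; set d := hn _ _ => d0.
  have a0 : 0 < 4 * (abs a + 1) by rewrite mulr_gt0 // ltr_wpDl ?abs_ge0.
  have [x hx] := df h _ (divr_gt0 d0 a0).
  have [y hy] := df k _ (divr_gt0 d0 (ltr0n R 4)).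
  have h1 := hU (a *: h + k) (a *: x + y).
  have h2 := hU h x; have h3 := hU k y.
  have h4 : nm (a *: h + k - f (a *: x + y)) <= abs a * nm (h - f x) + nm (k - f y).
    rewrite lf opprD addrACA -scalerBr -hnZ; exact: hnD.
  have h5 : nm (a *: g x + g y - (a *: U h + U k)) <= abs a * nm (U h - g x) + nm (U k - g y).
    rewrite opprD addrACA -scalerBr (hnBC _ (U h)) (hnBC _ (U k)) -hnZ; exact: hnD.
  have := hn_triangle hdot (g (a *: x + y)) (U (a *: h + k)) (a *: U h + U k).
  rewrite [in X in _ <= _ + X]lg -/d => h6.
  move: hx hy; rewrite !ltr_pdivlMr // => hx hy.
  have := abs_ge0 a; have := hn_ge0 hdot (h - f x); have := hn_ge0 hdot (U h - g x).
  nra.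
exists U; split=> //; apply: isometric_of_norm => // h.
have close e : 0 < e -> `|nm (U h) - nm h| <= e.
  move=> e0; have [x hx] := df h _ (divr_gt0 e0 (ltr0n R 2)).
  have h1 := hU h x; have h2 := gf x.
  have h3 := hnD hdot (U h - g x) (g x); rewrite subrK in h3.
  have h4 := hnD hdot (g x - U h) (U h); rewrite subrK hnBC in h4.
  have h5 := hnD hdot (h - f x) (f x); rewrite subrK in h5.
  have h6 := hnD hdot (f x - h) h; rewrite subrK hnBC in h6.
  by rewrite ler_norml; apply/andP; split; lra.
apply/eqP; rewrite -subr_eq0 -normr_le0 leNgt; apply/negP => d0.
by have := close _ (divr_gt0 d0 (ltr0n R 2)); lra.
Qed.
End IsometryExtension.

(** * Von Neumann algebras generated by a representation *)

Section Representations.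
Variable R : realType.
Local Notation C := (Cx R).
Variables (P : cstarType C) (H : hilbertType C) (pi : starRep P H).
Implicit Types (h k : H) (S T : H -> H) (G : set (H -> H)).
Local Notation nm := (hn (@hdot _ H)).

Lemma repD x y h : pi (x + y) h = pi x h + pi y h.
Proof. by rewrite -[x]scale1r rep_linear !fctE !scale1r. Qed.
Lemma rep0 h : pi 0 h = 0.
Proof. by apply: (addrI (pi 0 h)); rewrite -repD !addr0. Qed.
Lemma repZ (a : C) x h : pi (a *: x) h = a *: pi x h.
Proof. by rewrite -[a *: x]addr0 rep_linear !fctE rep0 addr0. Qed.
Lemma repB x y h : pi (x - y) h = pi x h - pi y h.
Proof. by rewrite addrC -scaleN1r repD repZ scaleN1r addrC. Qed.
Lemma repMh x y h : pi (x * y) h = pi x (pi y h).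
Proof. by rewrite repM. Qed.
Lemma rep1h h : pi 1 h = h. Proof. by rewrite rep1. Qed.
Lemma rep_star2 x h k : hdot (pi x h) k = hdot h (pi (star x) k).
Proof. by rewrite -rep_star starK. Qed.

(** Membership in a bicommutant can thus be checked on generators of a C*-algebra. *)
Lemma rep_vna_subalgebra G : G `<=` bounded_op -> star_closed G ->
  cstar_subalgebra [set x | bicommutant G (pi x)].
Proof.
move=> Gb Gs; have sG2 := star_closed_commutant (star_closed_commutant Gs).
apply: cstar_subalgebraP => /=.
- move=> x hx; split; first exact: rep_bounded.
  move=> S cS; have bS : bounded_op S by case: cS.
  have /bounded_opP[lS [c c0 bc]] := bS.
  apply/funext => h; apply/eqP; rewrite -subr_eq0; apply/eqP/(hn_eq0 (f := hdot))/le_anti.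
  rewrite hn_ge0 andbT leNgt; apply/negP => d0 /=.
  set d := hn _ _ in d0.
  have K0 : 0 < 4 * (c * nm h + nm (S h)) + 4.
    by rewrite ltr_wpDl // mulr_ge0 // addr_ge0 ?hn_ge0 // mulr_ge0 ?hn_ge0.
  have [y [_ /(_ _ cS) cy] xy] := hx _ (divr_gt0 d0 K0).
  have cyh : S (pi y h) = pi y (S h) by have := congr1 (@^~ h) cy.
  have dE : (S \o pi x) h - (pi x \o S) h = S (pi (x - y) h) - pi (x - y) (S h).
    by rewrite /= !repB linearBf // cyh opprB addrA subrK.
  have le1 := bc (pi (x - y) h); have le2 := rep_bound pi (x - y) h.
  have le3 := rep_bound pi (x - y) (S h).
  have := hnD hdot (S (pi (x - y) h)) (- pi (x - y) (S h)); rewrite hnN -dE -/d => le4.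
  have le5 : nm (S (pi (x - y) h)) <= c * (2 * cn (x - y) * nm h).
    by apply: le_trans le1 _; rewrite ler_wpM2l.
  move: xy; rewrite ltr_pdivlMr // => xy.
  have := cn_ge0 (x - y); lra.
- by rewrite rep1; exact: commutant_id.
- move=> a x y [bx cx] [b_y cy]; split; first exact: rep_bounded.
  move=> S cS; rewrite rep_linear; apply/funext => h /=; rewrite !fctE.
  have [[lS _] _] := cS; rewrite lS.
  have := congr1 (@^~ h) (cx _ cS); have := congr1 (@^~ h) (cy _ cS).
  by rewrite /= => -> ->.
- by move=> x y cx cy; rewrite repM; exact: commutant_comp.
- move=> x cx; have [T' cT' hT'] := sG2 _ cx.
  suff -> : pi (star x) = T' by [].
  by apply: op_ext => h k; rewrite rep_star (adjoint_sym hT').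
Qed.

End Representations.

Section StarAlgebras.
Variable R : realType.
Local Notation C := (Cx R).
Variables (Q P : cstarType C) (H : hilbertType C) (pi : starRep P H).
Variable f : starHom Q P.

Lemma star_algebra_image (B : set Q) : cstar_subalgebra B ->
  star_algebra ((fun x => pi (f x)) @` B).
Proof.
move=> [_ B1 Blin BM Bs]; split.
- by move=> _ [x _ <-]; exact: rep_bounded.
- by exists 1 => //; rewrite rmorph1 rep1.
- by move=> a _ _ [x Bx <-] [y By <-]; exists (a *: x + y); [exact: Blin|rewrite linearP rep_linear].
- by move=> _ _ [x Bx <-] [y By <-]; exists (x * y); [exact: BM|rewrite rmorphM repM].
- move=> _ [x Bx <-]; exists (pi (f (star x))); first by exists (star x) => //; exact: Bs.
  by move=> h k; rewrite starHomP rep_star2.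
Qed.

End StarAlgebras.

(** * The shift unitary and past vectors *)

Section Shift.
Variable R : realType.
Local Notation C := (Cx R).
Variables (A : cstarType C) (PN : freeProduct nat A) (PZ : freeProduct int A).
Variables (H : hilbertType C) (pi : starRep PZ H) (xi : H).
Local Notation emb := (embNZ PN PZ).
Local Notation nm := (hn (@hdot _ H)).
Implicit Types (h k : H) (S T : H -> H).

(** The operators whose bicommutant is the n-th algebra in the intersection that
    defines the tail algebra. *)
Definition generators n : set (H -> H) :=
  [set T | exists2 k : nat, (n <= k)%N & exists a, T = pi (fp_in PZ k%:Z a)].

Lemma generators_bounded n : generators n `<=` bounded_op.
Proof. by move=> _ [k _ [a ->]]; exact: rep_bounded. Qed.

Lemma generators_star n : star_closed (generators n).
Proof.
move=> _ [k nk [a ->]]; exists (pi (fp_in PZ k%:Z (star a))); first by exists k => //; exists (star a).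
by move=> h h'; rewrite starHomP rep_star2.
Qed.

Lemma local_generated (F : set nat) n x : (forall j, F j -> (n <= j)%N) ->
  fp_local F x -> bicommutant (generators n) (pi (emb x)).
Proof.
move=> Fn Fx.
apply: (@fp_local_min _ _ _ _ F (emb @^-1` [set y | bicommutant (generators n) (pi y)]) _ _ x Fx).
  apply/cstar_subalgebra_preimage/rep_vna_subalgebra; first exact: generators_bounded.
  exact: generators_star.
move=> j a Fj; rewrite /= fp_liftE; apply: sub_bicommutant; first exact: generators_bounded.
by exists j; [exact: Fn|exists a].
Qed.

Lemma local_vna_generated (F : set nat) n : (forall j, F j -> (n <= j)%N) ->
  local_vna PN pi F `<=` bicommutant (generators n).
Proof.
move=> Fn; apply: bicommutant_sub; first exact: generators_bounded.
by move=> _ [x Fx <-]; exact: local_generated Fx.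
Qed.

Lemma fp_localT (x : PN) : fp_local setT x.
Proof.
by apply: (fp_generated (@fp_local_subalgebra _ _ _ PN setT)) => j a; exact: fp_local_in.
Qed.

Lemma local_vnaT : local_vna PN pi setT = future_vna PN pi.
Proof.
congr bicommutant; apply/seteqP; split=> [_ [x _ <-]|_ [x _ <-]]; first by exists x.
by exists x => //; exact: fp_localT.
Qed.

Lemma future_generated : future_vna PN pi = bicommutant (generators 0).
Proof.
apply/seteqP; split; first by rewrite -local_vnaT; exact: local_vna_generated.
apply: bicommutantS => _ [k _ [a ->]]; exists (fp_in PN k a) => //.
by rewrite fp_liftE.
Qed.

Lemma local_vna_future F : local_vna PN pi F `<=` future_vna PN pi.
Proof. by rewrite future_generated; exact: local_vna_generated. Qed.

Lemma future_star_algebra : star_algebra (range (fun x : PN => pi (emb x))).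
Proof. by apply: star_algebra_image; split. Qed.

(** U is the unitary implementing the shift, V its inverse. *)
Variables U V : H -> H.
Hypothesis Ulin : linear U.
Hypothesis Vlin : linear V.
Hypothesis UV : forall h k, hdot (U h) k = hdot h (V k).
Hypothesis UK : cancel U V.
Hypothesis VK : cancel V U.
Hypothesis Upi : forall x h, U (pi x h) = pi (shiftZ PZ x) (U h).
Hypothesis Uxi : U xi = xi.

Lemma Vpi x h : V (pi x h) = pi (unshiftZ PZ x) (V h).
Proof. by rewrite -{1}[h]VK -{1}[x]unshiftZK -Upi UK. Qed.

Lemma Vxi : V xi = xi. Proof. by rewrite -{1}Uxi UK. Qed.

Lemma iterUV n h k : hdot (iter n U h) k = hdot h (iter n V k).
Proof. by elim: n h k => // n IH h k; rewrite iterS UV IH -iterSr. Qed.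

Lemma iterVU n h k : hdot (iter n V h) k = hdot h (iter n U k).
Proof. by rewrite dotC -iterUV -dotC. Qed.

Lemma iterUK n : cancel (iter n U) (iter n V).
Proof. by elim: n => // n IH h; rewrite iterSr iterS UK IH. Qed.

Lemma iterVK n : cancel (iter n V) (iter n U).
Proof. by elim: n => // n IH h; rewrite iterSr iterS VK IH. Qed.

Lemma iter_lin n (W : H -> H) : linear W -> linear (iter n W).
Proof. by move=> lW; elim: n => // n IH a h k; rewrite !iterS IH lW. Qed.

Lemma iterVpi n x h : iter n V (pi x h) = pi (pastZ PZ n x) (iter n V h).
Proof. by elim: n => // n IH; rewrite !iterS IH Vpi. Qed.

Lemma iterVxi n : iter n V xi = xi.
Proof. by elim: n => // n IH; rewrite iterS IH Vxi. Qed.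

Lemma iterUemb n x h : iter n U (pi (emb x) h) = pi (emb (iter n (shiftN PN) x)) (iter n U h).
Proof. by elim: n => // n IH; rewrite !iterS IH Upi emb_shift. Qed.

Lemma nm_iterU n h : nm (iter n U h) = nm h.
Proof. by rewrite /hn iterUV iterUK. Qed.
Lemma nm_iterV n h : nm (iter n V h) = nm h.
Proof. by rewrite /hn iterVU iterVK. Qed.

Lemma bounded_iterU n : bounded_op (iter n U).
Proof.
apply/bounded_opP; split; first exact: iter_lin.
by exists 1 => // h; rewrite nm_iterU mul1r.
Qed.
Lemma bounded_iterV n : bounded_op (iter n V).
Proof.
apply/bounded_opP; split; first exact: iter_lin.
by exists 1 => // h; rewrite nm_iterV mul1r.
Qed.

Definition up n T := iter n U \o T \o iter n V.
Definition down n T := iter n V \o T \o iter n U.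

Lemma bounded_up n T : bounded_op T -> bounded_op (up n T).
Proof.
move=> bT; apply: bounded_comp (bounded_iterV n).
exact: bounded_comp (bounded_iterU n) bT.
Qed.
Lemma bounded_down n T : bounded_op T -> bounded_op (down n T).
Proof.
move=> bT; apply: bounded_comp (bounded_iterU n).
exact: bounded_comp (bounded_iterV n) bT.
Qed.
Lemma bounded_by_up n c T : bounded_by c T -> bounded_by c (up n T).
Proof. by move=> cT h; rewrite /up /= nm_iterU -(nm_iterV n h). Qed.
Lemma iterUgen n j a h :
  iter n U (pi (fp_in PZ j%:Z a) h) = pi (fp_in PZ (n + j)%N%:Z a) (iter n U h).
Proof.
elim: n => // n IH; rewrite !iterS IH Upi fp_liftE; congr (pi (fp_in PZ _ a) _).
by rewrite addSn -addn1 PoszD.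
Qed.
Lemma iterVgen n j a h :
  iter n V (pi (fp_in PZ (n + j)%N%:Z a) h) = pi (fp_in PZ j%:Z a) (iter n V h).
Proof. by rewrite -{1}[h](iterVK n) -iterUgen iterUK. Qed.

(** Conjugation by U^n maps the generators with index k to those with index n + k. *)
Lemma commutant_up n S : commutant (generators 0) S -> commutant (generators n) (up n S).
Proof.
move=> [bS cS]; split; first exact: bounded_up.
move=> _ [k nk [a ->]]; apply/funext => h; rewrite -(subnKC nk) /up /=.
rewrite iterVgen -iterUgen; congr (iter n U _).
by have /= := congr1 (@^~ (iter n V h)) (cS (pi (fp_in PZ (k - n)%N%:Z a)) _); apply; exists (k - n)%N => //; exists a.
Qed.

Lemma commutant_down n S : commutant (generators n) S -> commutant (generators 0) (down n S).
Proof.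
move=> [bS cS]; split; first exact: bounded_down.
move=> _ [k _ [a ->]]; apply/funext => h; rewrite /down /=.
rewrite iterUgen -iterVgen; congr (iter n V _).
have /= := congr1 (@^~ (iter n U h)) (cS (pi (fp_in PZ (n + k)%N%:Z a)) _); apply.
by exists (n + k)%N; [exact: leq_addr|exists a].
Qed.

Lemma bicommutant_down n T :
  bicommutant (generators n) T -> bicommutant (generators 0) (down n T).
Proof.
move=> [bT cT]; split; first exact: bounded_down.
move=> S cS; apply/funext => h.
have := congr1 (@^~ (iter n U h)) (cT _ (commutant_up n cS)).
by rewrite /up /down /= iterUK => /(congr1 (iter n V)); rewrite iterUK.
Qed.

Lemma bicommutant_up n T :
  bicommutant (generators 0) T -> bicommutant (generators n) (up n T).
Proof.
move=> [bT cT]; split; first exact: bounded_up.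
move=> S cS; apply/funext => h.
have := congr1 (@^~ (iter n V h)) (cT _ (commutant_down cS)).
by rewrite /up /down /= iterVK => /(congr1 (iter n U)); rewrite iterVK.
Qed.

Lemma generatorsS m n : (m <= n)%N -> generators n `<=` generators m.
Proof. by move=> mn T [k nk ha]; exists k => //; exact: leq_trans nk. Qed.

Definition past : set H :=
  [set h | exists n, exists2 x, fp_local `I_n x & h = iter n V (pi (emb x) xi)].

(** Shifting the localized parts forward gives both vectors the same number of
    backward shifts. *)
Lemma past_pair h k : past h -> past k -> exists n x y,
  [/\ @fp_local _ _ _ PN `I_n x, fp_local `I_n y, h = iter n V (pi (emb x) xi)
    & k = iter n V (pi (emb y) xi)].
Proof.
move=> [m [x Fx ->]] [n [y Fy ->]].
exists (n + m)%N, (iter n (shiftN PN) x), (iter m (shiftN PN) y); split.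
- by apply: fp_local_iter_shift Fx => j /= jm; lia.
- by apply: fp_local_iter_shift Fy => j /= jm; lia.
- by rewrite !iterVpi pastZ_shiftN !iterVxi.
- by rewrite !iterVpi addnC pastZ_shiftN !iterVxi.
Qed.

Lemma past_iterV m h : past h -> past (iter m V h).
Proof.
move=> [n [x Fx ->]]; exists (m + n)%N, x; last by rewrite iterD.
by apply: fp_localS Fx => j /= jn; lia.
Qed.

Variables (phi : state PN) (phiZ : state PZ).
Hypothesis gns : forall x, phiZ x = hdot (pi x xi) xi.
Hypothesis cyclic : closure (range (fun x => pi x xi)) = setT.
Hypothesis ext : forall x, phiZ (emb x) = phi x.

(** Matrix coefficients at past vectors are values of phi at products whose middle
    factor has been shifted beyond the outer ones. *)
Lemma coefficient n x y z :
  hdot (pi (emb y) (iter n V (pi (emb x) xi))) (iter n V (pi (emb z) xi)) =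
  phi (star z * iter n (shiftN PN) y * x).
Proof.
rewrite -iterUV iterUemb iterVK -rep_star -starHomP -!repMh.
by rewrite -ext gns !rmorphM.
Qed.

Definition eventually_past : set H := [set h | exists n, past (iter n V h)].

Lemma eventually_past_dense h (e : R) : 0 < e ->
  exists2 d, eventually_past d & nm (h - d) < e.
Proof.
move=> e0; have e2 := divr_gt0 e0 (ltr0n R 2).
have [_ [x _ <-] hx] := @closure_approx _ _ _ h _ (eq_ind_r (fun D => D h) I cyclic) e2.
have K0 : 0 < 2 * nm xi + 1 by rewrite ltr_wpDl // mulr_ge0 ?hn_ge0.
have [k [n [y Fy hy]]] := past_dense PN x (divr_gt0 e2 K0).
exists (pi (pastZ PZ k (emb y)) xi).
  exists n, (n + k)%N, y; first by apply: fp_localS Fy => j /= jn; lia.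
  by rewrite -(iterVxi k) -iterVpi iterVxi -iterD.
have h1 := hn_triangle hdot (pi x xi) h (pi (pastZ PZ k (emb y)) xi).
apply: le_lt_trans h1 _; rewrite -repB.
have := rep_bound pi (x - pastZ PZ k (emb y)) xi.
move: hy; rewrite ltr_pdivlMr //; set c := cn _ => hy.
have c0 : 0 <= c by exact: cn_ge0.
lra.
Qed.

Lemma eventually_past_pair h k : eventually_past h -> eventually_past k ->
  exists n, past (iter n V h) /\ past (iter n V k).
Proof.
move=> [m hm] [n kn]; exists (m + n)%N; split.
  by rewrite addnC iterD; exact: past_iterV.
by rewrite iterD; exact: past_iterV.
Qed.

Lemma op_ext_dense S T : bounded_op S -> bounded_op T ->
  (forall h k, eventually_past h -> eventually_past k -> hdot (S h) k = hdot (T h) k) ->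
  S = T.
Proof.
move=> bS bT ST.
have right h : eventually_past h -> S h = T h.
  move=> hp; apply/eqP; rewrite -subr_eq0; apply/eqP; set v := S h - T h.
  apply: (hn_eq0 (f := hdot)); apply/le_anti; rewrite hn_ge0 andbT leNgt; apply/negP => v0.
  have [d dp hd] := eventually_past_dense v v0.
  have : hdot v d = 0 by rewrite dotBl ST // subrr.
  move=> vd; have : abs (hdot v (v - d)) <= nm v * nm (v - d) by exact: cauchy_schwarz.
  rewrite dotBr vd subr0 dotvv abs_toC ger0_norm ?sqr_ge0 // expr2 ler_pM2l //.
  by rewrite leNgt hd.
have /bounded_opP[lD [c c0 cD]] : bounded_op ((-1) *: S + T) by exact: bounded_lin.
apply/funext => h; apply/eqP; rewrite -subr_eq0; apply/eqP/(hn_eq0 (f := hdot))/le_anti.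
rewrite hn_ge0 andbT leNgt; apply/negP => v0.
have c1 : 0 < c + 1 by rewrite ltr_wpDl.
have [d dp] := eventually_past_dense h (divr_gt0 v0 c1).
rewrite ltr_pdivlMr // ltNge => /negP; apply.
have := cD (h - d); rewrite linearBf // !fctE /= (right _ dp) !scaleN1r addNr subr0.
rewrite addrC hnBC => /le_trans; apply.
by rewrite mulrC ler_wpM2l ?hn_ge0 // lerDl.
Qed.

Lemma upE n T h k : hdot (up n T h) k = hdot (T (iter n V h)) (iter n V k).
Proof. by rewrite /up /= iterUV. Qed.

Lemma rep_emb_ext (h1 k1 h2 k2 : H) :
  (forall n y, fp_local `I_n y -> hdot (pi (emb y) h1) k1 = hdot (pi (emb y) h2) k2) ->
  forall y, hdot (pi (emb y) h1) k1 = hdot (pi (emb y) h2) k2.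
Proof.
move=> eqloc y; apply/eqP; rewrite -subr_eq0; apply/eqP/abs_eq0/le_anti.
rewrite abs_ge0 andbT leNgt; apply/negP => d0; set d := abs _ in d0.
pose K := 4 * (nm h1 * nm k1 + nm h2 * nm k2) + 1.
have K0 : 0 < K by rewrite ltr_wpDl // mulr_ge0 // addr_ge0 // mulr_ge0 ?hn_ge0.
have [n [y' Fy hy]] := local_dense y (divr_gt0 d0 K0).
have bnd h k : abs (hdot (pi (emb (y - y')) h) k) <= 4 * cn (y - y') * nm h * nm k.
  apply: le_trans (dot_bound (rep_bound pi _) _ _) _.
  rewrite !ler_wpM2r ?hn_ge0 //; have := starHom_bound emb (y - y'); lra.
have dE : hdot (pi (emb y) h1) k1 - hdot (pi (emb y) h2) k2 =
   hdot (pi (emb (y - y')) h1) k1 - hdot (pi (emb (y - y')) h2) k2.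
  by rewrite raddfB !repB !dotBl (eqloc _ _ Fy) opprB addrA subrK.
have := absD (hdot (pi (emb (y - y')) h1) k1) (- hdot (pi (emb (y - y')) h2) k2).
rewrite -dE -/d absN; move: hy; rewrite ltr_pdivlMr // /K.
have := bnd h1 k1; have := bnd h2 k2; have := cn_ge0 (y - y'); nra.
Qed.

(** * The conditional expectation of a weakly spreadable process *)

Section WeaklySpreadable.
Hypothesis ws : weakly_spreadable phi.

(** The only place where weak spreadability is used: for localized y in place of T
    this is the hypothesis for supports [0, n), [n, n + m) and [0, n). *)
Lemma future_constant T h k : future_vna PN pi T -> past h -> past k ->
  hdot (T (V h)) (V k) = hdot (T h) k.
Proof.
move=> TR /past_pair /[apply] -[n [x [z [Fx Fz -> ->]]]].
apply/esym; apply: bicommutant_dot2 future_star_algebra TR _ => _ [y _ <-].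
move: y; apply: rep_emb_ext => m y Fy; rewrite -!iterS !coefficient iterS.
apply: (ws (Fx := `I_n) (Fy := [set j | n <= j < n + m]%N) (Fz := `I_n)) => //.
- by apply: (sub_finite_set _ (finite_II (n + m))) => j /= /andP[].
- by move=> i j /= /andP[ni _] [|] /= jn; exact: leq_trans ni.
- by have [_ _ _ _ +] := @fp_local_subalgebra _ _ _ PN `I_n; apply.
- by apply: fp_local_iter_shift Fy => j /= jm; lia.
Qed.

Lemma future_constant_iter n T h k : future_vna PN pi T -> past h -> past k ->
  hdot (T (iter n V h)) (iter n V k) = hdot (T h) k.
Proof.
move=> TR ph pk; elim: n => // n IH.
by rewrite !iterS future_constant //; exact: past_iterV.
Qed.

Lemma up_stable T h k m n : future_vna PN pi T -> past (iter m V h) ->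
  past (iter m V k) -> (m <= n)%N -> hdot (up n T h) k = hdot (up m T h) k.
Proof.
move=> TR ph pk mn; rewrite !upE -{1 2}(subnK mn) !iterD.
exact: future_constant_iter.
Qed.

(** Write T = U^m S V^m with S in the algebra of the nonnegative indices, for an m that
    makes the two given vectors past; then their coefficients of S are constant. *)
Lemma tail_up_fixed n T : tail_vna pi T -> up n T = T.
Proof.
move=> TT; have bT : bounded_op T by have [] := TT 0%N I.
apply: op_ext_dense => //; first exact: bounded_up.
move=> h k /eventually_past_pair /[apply] -[m [ph pk]]; rewrite upE.
have TR : future_vna PN pi (down m T).
  by rewrite future_generated; apply: bicommutant_down; exact: TT.
have dE x y : hdot (T x) y = hdot (down m T (iter m V x)) (iter m V y).
  by rewrite /down /= iterVK iterVU iterVK.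
by rewrite !dE -!iterD !(addnC m n) !iterD future_constant_iter.
Qed.

Lemma up_wlim T : future_vna PN pi T ->
  exists2 B, bounded_op B & wlim (fun n => up n T) B.
Proof.
move=> TR; have bT : bounded_op T by case: TR.
have /bounded_opP[lT [c c0 cT]] := bT.
apply: (@wlim_exists _ _ _ c eventually_past c0).
- by move=> n; case: (bounded_up n bT).
- by move=> n; exact: bounded_by_up.
- exact: eventually_past_dense.
move=> h k /eventually_past_pair /[apply] -[m [ph pk]].
exists (hdot (up m T h) k); apply: (ctends_eventually (m := m)) (ctends_cst _) => n mn.
by rewrite (up_stable TR ph pk mn).
Qed.

Definition tail_limit T : H -> H :=
  xget (idfun : H -> H) [set B | bounded_op B /\ wlim (fun n => up n T) B].

Lemma tail_limitP T : future_vna PN pi T ->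
  bounded_op (tail_limit T) /\ wlim (fun n => up n T) (tail_limit T).
Proof.
by move=> /up_wlim[B bB TB]; apply: (@xgetPex _ (idfun : H -> H) [set B | bounded_op B /\ wlim (fun n => up n T) B]); exists B.
Qed.

Lemma tail_limit_eq T B : bounded_op B -> wlim (fun n => up n T) B -> tail_limit T = B.
Proof.
move=> bB TB; have [_ h] : [set B | bounded_op B /\ wlim (fun n => up n T) B] (tail_limit T).
  by apply: xgetPex; exists B.
exact: wlim_unique h TB.
Qed.

Lemma tail_limit_coef T h k m : future_vna PN pi T -> past (iter m V h) ->
  past (iter m V k) -> hdot (tail_limit T h) k = hdot (up m T h) k.
Proof.
move=> TR ph pk; have [_ TB] := tail_limitP TR; apply: ctends_unique (TB h k) _.
apply: (ctends_eventually (m := m)) (ctends_cst _) => n mn.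
by rewrite (up_stable TR ph pk mn).
Qed.

Lemma tail_future : tail_vna pi `<=` future_vna PN pi.
Proof. by move=> T /(_ 0%N I); rewrite future_generated. Qed.

(** For n <= j the operator U^j T V^j lies in the n-th tail algebra, which is weakly
    closed. *)
Lemma tail_limit_tail T : future_vna PN pi T -> tail_vna pi (tail_limit T).
Proof.
move=> TR; have [bE TE] := tail_limitP TR; move=> n _.
apply: (commutant_wlim (m := n) _ bE TE) => [S []//|j nj].
apply: bicommutantS (generatorsS nj) _ _; apply: bicommutant_up.
by rewrite -future_generated.
Qed.

Lemma tail_limit_id T : tail_vna pi T -> tail_limit T = T.
Proof.
move=> TT; apply: tail_limit_eq; first by have [] := TT 0%N I.
by move=> h k; apply: ctends_ext (ctends_cst _) => n; rewrite tail_up_fixed.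
Qed.

Lemma tail_limit_lin (a : C) S T : future_vna PN pi S -> future_vna PN pi T ->
  tail_limit (a *: S + T) = a *: tail_limit S + tail_limit T.
Proof.
move=> SR TR; have [bS hS] := tail_limitP SR; have [bT hT] := tail_limitP TR.
apply: tail_limit_eq; first exact: bounded_lin.
move=> h k; rewrite !fctE /= dotDl dotZl.
apply: ctends_ext (ctendsD (ctendsZ a (hS h k)) (hT h k)) => n.
by rewrite !upE dotDl dotZl.
Qed.

Lemma up_comp n S T : up n (S \o T) = up n S \o up n T.
Proof. by apply/funext => h; rewrite /up /= iterUK. Qed.

(** Conjugation by U^n is multiplicative and fixes S and S'. *)
Lemma tail_limit_bimodule S T S' : tail_vna pi S -> future_vna PN pi T ->
  tail_vna pi S' -> tail_limit (S \o T \o S') = S \o tail_limit T \o S'.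
Proof.
move=> ST TR S'T; have [bE hE] := tail_limitP TR.
have bS : bounded_op S by have [] := ST 0%N I.
have bS' : bounded_op S' by have [] := S'T 0%N I.
apply: tail_limit_eq.
  by apply: bounded_comp bS'; exact: bounded_comp bE.
have [S1 bS1 hS1] := adjoint bS.
move=> h k /=; rewrite hS1; apply: ctends_ext (hE (S' h) (S1 k)) => n.
by rewrite (up_comp n (S \o T) S') (up_comp n S T) (tail_up_fixed n ST) (tail_up_fixed n S'T) /= hS1.
Qed.

Lemma tail_limit_bound T (c : R) : future_vna PN pi T -> bounded_by c T ->
  bounded_by c (tail_limit T).
Proof.
move=> TR cT; have [_ hE] := tail_limitP TR.
by apply: wlim_bound hE => n; exact: bounded_by_up.
Qed.

Lemma tail_limit_cp n (T : 'I_n -> 'I_n -> H -> H) :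
  (forall i j, future_vna PN pi (T i j)) -> positive_opmx T ->
  positive_opmx (fun i j => tail_limit (T i j)).
Proof.
move=> TR posT x.
pose s m := \sum_i \sum_j hdot (T i j (iter m V (x j))) (iter m V (x i)).
apply: (@ctends_ge0 _ s) => [|m]; last exact: (posT (fun i => iter m V (x i))).
apply: ctends_sum => i; apply: ctends_sum => j.
have [_ hE] := tail_limitP (TR i j).
by apply: ctends_ext (hE (x j) (x i)) => m; rewrite upE.
Qed.

Lemma tail_limit_shift x :
  tail_limit (pi (emb (shiftN PN x))) = tail_limit (pi (emb x)).
Proof.
have xR : future_vna PN pi (pi (emb x)).
  by apply: sub_bicommutant; [move=> _ [y _ <-]; exact: rep_bounded|exists x].
have [bE hE] := tail_limitP xR; apply: tail_limit_eq => // h k e /(hE h k)[N hN].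
exists N => n Nn; have -> : up n (pi (emb (shiftN PN x))) = up n.+1 (pi (emb x)).
  apply/funext => h'.
  rewrite -[RHS]/(iter n.+1 U (pi (emb x) (iter n.+1 V h'))) [RHS]iterSr iterS.
  by rewrite Upi VK -emb_shift.
by apply: hN; exact: leqW.
Qed.

Lemma tail_limit_state T : future_vna PN pi T ->
  hdot (tail_limit T xi) xi = hdot (T xi) xi.
Proof.
move=> TR; have [_ hE] := tail_limitP TR; apply: ctends_unique (hE xi xi) _.
by apply: ctends_ext (ctends_cst _) => n; rewrite upE !iterVxi.
Qed.

Lemma iterVemb n x h :
  iter n V (pi (emb (iter n (shiftN PN) x)) h) = pi (emb x) (iter n V h).
Proof. by rewrite -{1}[h](iterVK n) -iterUemb iterUK. Qed.

(** The vector X h is a limit of vectors that become past after p backward shifts,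
    stated dually: it is orthogonal to everything that is orthogonal to them. *)
Lemma past_local_vna p F X h w : local_vna PN pi F X -> (forall j, F j -> (j < p)%N) ->
  past h -> (forall k, past (iter p V k) -> hdot k w = 0) -> hdot (X h) w = 0.
Proof.
move=> XF Fp [n [x Fx ->]] hw.
apply: bicommutant_orth (star_algebra_image pi emb (fp_local_subalgebra PN F)) XF _.
move=> _ [y Fy <-]; apply: hw.
exists (p + n)%N, (iter n (shiftN PN) y * x); last by rewrite rmorphM repMh iterD iterVemb.
have [_ _ _ + _] := @fp_local_subalgebra _ _ _ PN `I_(p + n); apply.
  by apply: fp_local_iter_shift Fy => j /= /Fp; lia.
by apply: fp_localS Fx => j /= jn; lia.
Qed.

(** The difference of Y and its n-th shift has zero coefficients at vectors that are
    past after p backward shifts; the previous lemma is applied first to Z h and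
    then, with the roles of the two arguments exchanged, to X^* k. *)
Lemma decoupling_constant p F G X X' Y Z h k n :
  (forall j, F j -> (j < p)%N) -> (forall j, G j -> (j < p)%N) ->
  local_vna PN pi F X' -> bicommutant (generators p) Y -> local_vna PN pi G Z ->
  (forall h k, hdot (X h) k = hdot h (X' k)) -> past h -> past k ->
  hdot (up n Y (Z h)) (X' k) = hdot (Y (Z h)) (X' k).
Proof.
move=> Fp Gp X'F YG ZG adjX ph pk.
have TR : future_vna PN pi (down p Y) by rewrite future_generated; exact: bicommutant_down.
have bY : bounded_op Y by case: YG.
pose W h' := past (iter p V h').
have YW h1 k1 : W h1 -> W k1 -> hdot (up n Y h1) k1 = hdot (Y h1) k1.
  move=> w1 w2; rewrite upE.
  have dE x y : hdot (Y x) y = hdot (down p Y (iter p V x)) (iter p V y).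
    by rewrite /down /= iterVK iterVU iterVK.
  by rewrite !dE -!iterD !(addnC p n) !iterD future_constant_iter.
have bD : bounded_op (up n Y - Y).
  by rewrite addrC -scaleN1r; apply: bounded_lin => //; exact: bounded_up.
have [D' _ hD'] := adjoint bD.
have DE h1 k1 : hdot ((up n Y - Y) h1) k1 = hdot (up n Y h1) k1 - hdot (Y h1) k1.
  by rewrite !fctE dotBl.
apply/eqP; rewrite -subr_eq0 -DE; apply/eqP.
rewrite hD'; apply: (past_local_vna ZG Gp ph) => h1 w1.
rewrite -hD'; apply: (can_inj conjCK); rewrite -dotC conjC0.
apply: (past_local_vna X'F Fp pk) => k1 w2.
by apply: (can_inj conjCK); rewrite -dotC conjC0 DE YW // subrr.
Qed.

Lemma local_vna_adjoint F X : local_vna PN pi F X ->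
  exists2 X', local_vna PN pi F X' & forall h k, hdot (X h) k = hdot h (X' k).
Proof.
have [_ _ _ _ sF] := star_algebra_image pi emb (fp_local_subalgebra PN F).
exact: (star_closed_commutant (star_closed_commutant sF)).
Qed.

Lemma tail_limit_decoupling : forward_decoupling PN pi tail_limit.
Proof.
move=> FX FY FZ finX finY finZ YXZ X Y Z XF YF ZF.
(* If both FX and FZ are empty, p = 0 and FY is arbitrary. *)
have [p Fp pY] : exists2 p, forall j, (FX `|` FZ) j -> (j < p)%N
    & forall j, FY j -> (p <= j)%N.
  have /finite_seqP[s sE] : finite_set (FX `|` FZ) by rewrite finite_setU.
  exists (\max_(j <- s) j.+1)%N => [j|i Yi].
    by rewrite sE /= => js; exact: (leq_bigmax_seq (F := succn) j js).
  apply/bigmax_leqP_seq => j js _; apply: YXZ => //.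
  by rewrite sE.
have XR := local_vna_future XF; have YR := local_vna_future YF.
have ZR := local_vna_future ZF.
have EYR := tail_future (tail_limit_tail YR).
have XYZ S : future_vna PN pi S -> future_vna PN pi (X \o S \o Z).
  by move=> SR; apply: commutant_comp ZR; exact: commutant_comp XR SR.
have [bE1 _] := tail_limitP (XYZ _ YR); have [bE2 _] := tail_limitP (XYZ _ EYR).
have [X' X'F adjX] := local_vna_adjoint XF.
apply: op_ext_dense => // h k /eventually_past_pair /[apply] -[m [ph pk]].
rewrite !(tail_limit_coef (m := m)) //; try exact: XYZ.
rewrite !upE /= !adjX; have [_ EY] := tail_limitP YR.
apply: ctends_unique _ (EY _ _); apply: ctends_ext (ctends_cst _) => n; apply/esym.
apply: (decoupling_constant (p := p) (F := FX) (G := FZ)) ph pk => //.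
- by move=> j Xj; apply: Fp; left.
- by move=> j Zj; apply: Fp; right.
- exact: local_vna_generated YF.
Qed.

Lemma eventually_pastB h k : eventually_past h -> eventually_past k ->
  eventually_past (h - k).
Proof.
move=> /eventually_past_pair /[apply] -[m [ph pk]]; exists m.
have [n [x [y [Fx Fy hx ky]]]] := past_pair ph pk.
have lV : linear (iter m V) := iter_lin m Vlin.
exists n, (x - y).
  rewrite addrC -scaleN1r.
  by have [_ _ + _ _] := @fp_local_subalgebra _ _ _ PN `I_n; apply.
by rewrite linearBf // hx ky -linearBf ?raddfB ?repB //; exact: iter_lin.
Qed.

Lemma future_bounded : future_vna PN pi `<=` bounded_op.
Proof. by move=> T []. Qed.

Lemma tail_limit_normal (F : set_system (H -> H)) T :
  ProperFilter F -> F (future_vna PN pi) -> future_vna PN pi T ->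
  sigma_weak_cvg F T -> sigma_weak_cvg (tail_limit @ F) (tail_limit T).
Proof.
move=> FF FR TR FT u v su sv.
have [||h k hD kD|u' [v' [su' sv' eqE]]] := @normal_functional_pullback R H
  eventually_past eventually_past_dense eventually_pastB (future_vna PN pi)
  tail_limit (fun n => iter n V) future_bounded _ _ _ u v su sv.
- by move=> S /tail_limitP[].
- by move=> m h; exact: nm_iterV.
- have [m [ph pk]] := eventually_past_pair hD kD.
  by exists m => S SR; rewrite (tail_limit_coef SR ph pk) upE.
rewrite (eqE _ TR) => D /(FT _ _ su' sv'); rewrite !nbhs_simpl /=.
by apply: filterS2 FR => S SR /=; rewrite (eqE _ SR).
Qed.

Lemma tail_limit_condexp :
  normal_condexp (future_vna PN pi) (tail_vna pi) tail_limit.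
Proof.
split.
- exact: tail_limit_tail.
- exact: tail_limit_id.
- exact: tail_limit_lin.
- exact: tail_limit_bimodule.
- move=> T c TR c0 cT.
  have cE := ge0_toC c0.
  have bT : bounded_by (reC c) T.
    by move=> x; have := cT x; rewrite cE !normHE -rmorphM ler_toC toCK.
  by move=> x; rewrite cE !normHE -rmorphM ler_toC; exact: (tail_limit_bound TR bT).
- exact: tail_limit_cp.
- exact: tail_limit_normal.
Qed.

Lemma op_ext_normal S T : bounded_op S -> bounded_op T ->
  (forall u v, square_summable u -> square_summable v ->
     normal_functional u v S = normal_functional u v T) -> S = T.
Proof.
move=> bS bT ST; apply: op_ext => h k.
rewrite -(normal_functional_fin _ _ bS) -(normal_functional_fin _ _ bT).
by apply: ST; exact: (@sqsum_fin R H).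
Qed.

Lemma rep_future x : future_vna PN pi (pi (emb x)).
Proof. by apply: sub_bicommutant; [move=> _ [y _ <-]; exact: rep_bounded|exists x]. Qed.

(** Apply E to the sequence of shifts of pi(x): it is constant there by shift
    invariance, and the limit of the sequence is in the tail algebra, which E fixes. *)
Lemma invariant_condexp_rep E x : invariant_condexp PN pi xi E ->
  E (pi (emb x)) = tail_limit (pi (emb x)).
Proof.
move=> [cE shE _]; pose s n := pi (emb (iter n (shiftN PN) x)).
have sup n : s n = up n (pi (emb x)).
  by apply/funext => h; rewrite /up /= iterUemb iterVK.
have Es n : E (s n) = E (pi (emb x)).
  by elim: n => // n IH; rewrite -IH /s iterS shE.
have [bL hL] := tail_limitP (rep_future x).
have bpi := rep_bound pi (emb x).
have c0 : 0 <= 2 * cn (emb x) by rewrite mulr_ge0 ?cn_ge0.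
have LT := tail_limit_tail (rep_future x).
have sL : sigma_weak_cvg (s @ \oo) (tail_limit (pi (emb x))).
  move=> u v su sv; apply/ctendsP; apply: (@wlim_normal_functional _ _ _ _ _ u v c0) => //.
  - by move=> n; exact: rep_bounded.
  - by move=> n; rewrite sup; exact: bounded_by_up.
  - by move=> h k; apply: ctends_ext (hL h k) => n; rewrite sup.
have sF : (s @ \oo) (future_vna PN pi) by exists 0%N => // n _; exact: rep_future.
have := condexp_normal cE _ sF (tail_future LT) sL.
rewrite (condexp_id cE LT) => EL.
apply: op_ext_normal => //.
  by have [] := (condexp_sub cE (rep_future x) : tail_vna pi _) 0%N I.
move=> u v su sv.
have EL' : ctends (fun n => normal_functional u v (E (s n)))
    (normal_functional u v (tail_limit (pi (emb x)))).
  by apply/ctendsP; exact: EL.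
apply: ctends_unique EL'; apply: ctends_ext (ctends_cst _) => n.
by rewrite -(Es n).
Qed.

(** Both maps are sigma-weakly continuous and agree on a sigma-weakly dense set. *)
Theorem invariant_condexp_unique E T : invariant_condexp PN pi xi E ->
  future_vna PN pi T -> E T = tail_limit T.
Proof.
move=> iE TR; have [cE _ _] := iE.
have [F [FF FM FT]] := bicommutant_sigma_weak future_star_algebra TR.
have FR : F (future_vna PN pi).
  by apply: filterS FM => _ [x _ <-]; exact: rep_future.
have ET := condexp_normal cE FF FR TR FT.
have LT := tail_limit_normal FF FR TR FT.
apply: op_ext_normal.
- by have [] := (condexp_sub cE TR : tail_vna pi _) 0%N I.
- by have [] := tail_limitP TR.
move=> u v su sv; have h1 := ET u v su sv; have h2 := LT u v su sv.
have h3 : normal_functional u v S @[S --> E @ F] --> normal_functional u v (tail_limit T).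
  move=> D /h2; rewrite !nbhs_simpl /=; apply: filterS2 FM => _ [x _ <-] /=.
  by rewrite (invariant_condexp_rep x iE).
exact: (cvg_unique (@norm_hausdorff _ _) h1 h3).
Qed.

Theorem tail_limit_invariant : invariant_condexp PN pi xi tail_limit.
Proof.
split; first exact: tail_limit_condexp.
  exact: tail_limit_shift.
exact: tail_limit_state.
Qed.

End WeaklySpreadable.

(** Shifting y does not change the expectation of its operator, and decoupling applies
    to y as well as to its shift. *)
Lemma decoupling_spreadable E : invariant_condexp PN pi xi E ->
  forward_decoupling PN pi E -> weakly_spreadable phi.
Proof.
move=> [cE shE stE] dec Fx Fy Fz finx finy finz yxz x y z Fxx Fyy Fzz.
have loc F w : fp_local F w -> local_vna PN pi F (pi (emb w)).
  by move=> Fw; apply: sub_bicommutant; [move=> _ [? _ <-]; exact: rep_bounded|exists w].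
have phiE a b c : phi (a * b * c) =
    hdot (E (pi (emb a) \o pi (emb b) \o pi (emb c)) xi) xi.
  by rewrite -ext gns -(stE _ (rep_future (a * b * c))) !rmorphM !repM.
have shy : fp_local [set j.+1 | j in Fy] (shiftN PN y).
  by apply: fp_local_shift Fyy => j Fj; exists j.
have yxz' : set_gt [set j.+1 | j in Fy] (Fx `|` Fz).
  by move=> _ j [i Fi <-] /(yxz _ _ Fi) ji; exact: leqW.
have finy' : finite_set [set j.+1 | j in Fy] by exact: finite_image.
rewrite !phiE (dec _ _ _ finx finy finz yxz _ _ _ (loc _ _ Fxx) (loc _ _ Fyy) (loc _ _ Fzz)).
by rewrite (dec _ _ _ finx finy' finz yxz' _ _ _ (loc _ _ Fxx) (loc _ _ shy) (loc _ _ Fzz)) shE.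
Qed.

End Shift.

(** * Existence of the shift unitary and the theorem *)

Section ShiftUnitary.
Variable R : realType.
Local Notation C := (Cx R).
Variables (A : cstarType C) (PZ : freeProduct int A).
Variables (H : hilbertType C) (pi : starRep PZ H) (xi : H) (phiZ : state PZ).
Local Notation nm := (hn (@hdot _ H)).
Hypothesis gns : forall x, phiZ x = hdot (pi x xi) xi.
Hypothesis cyclic : closure (range (fun x => pi x xi)) = setT.
Hypothesis statZ : forall x, phiZ (shiftZ PZ x) = phiZ x.

Lemma cyclic_dense h (e : R) : 0 < e -> exists x, nm (h - pi x xi) < e.
Proof.
move=> e0.
have clh : closure (range (fun x => pi x xi)) h by rewrite cyclic.
by have [_ [x _ <-] hx] := closure_approx clh e0; exists x.
Qed.

(** In a cyclic representation an automorphism that preserves the state is isometric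
    on the dense subspace of all pi(x) xi, and so is its inverse. *)
Lemma automorphism_unitary (s t : starHom PZ PZ) : cancel s t -> cancel t s ->
  (forall x, phiZ (s x) = phiZ x) ->
  exists U V : H -> H, [/\ [/\ linear U, linear V, cancel U V & cancel V U],
    forall h k, hdot (U h) k = hdot h (V k),
    forall x h, U (pi x h) = pi (s x) (U h) & U xi = xi].
Proof.
move=> st ts inv.
have lf : linear (fun x => pi x xi) by move=> a x y; rewrite rep_linear.
have nE x : hdot (pi x xi) (pi x xi) = phiZ (star x * x).
  by rewrite -rep_star gns repMh.
have ext_iso (g : starHom PZ PZ) : (forall x, phiZ (g x) = phiZ x) ->
    exists U, [/\ linear U, isometric U & forall x, U (pi x xi) = pi (g x) xi].
  move=> ginv; apply: (extend_isometry lf) => [a x y|x|h e e0].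
  - by rewrite linearP rep_linear.
  - by rewrite /hn !nE -starHomP -rmorphM ginv.
  - exact: cyclic_dense.
have [U [lU iU Ux]] := ext_iso s inv.
have [V [lV iV Vx]] := ext_iso t (fun x => etrans (esym (inv (t x))) (congr1 phiZ (ts x))).
have dense_eq (S T : H -> H) (c : R) : linear S -> linear T -> bounded_by c S ->
    bounded_by c T -> (forall x, S (pi x xi) = T (pi x xi)) -> S =1 T.
  move=> lS lT cS cT ST h; apply/eqP; rewrite -subr_eq0; apply/eqP/(hn_eq0 (f := hdot))/le_anti.
  rewrite hn_ge0 andbT leNgt; apply/negP => d0; set d := hn _ _ in d0.
  have K0 : 0 < 2 * `|c| + 1 by rewrite ltr_wpDl ?mulr_ge0.
  have [x hx] := cyclic_dense h (divr_gt0 d0 K0).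
  have dE : S h - T h = S (h - pi x xi) - T (h - pi x xi).
    by rewrite (linearBf lS) (linearBf lT) ST opprB addrA subrK.
  have := hnD hdot (S (h - pi x xi)) (- T (h - pi x xi)); rewrite hnN -dE -/d.
  have := cS (h - pi x xi); have := cT (h - pi x xi).
  move: hx; rewrite ltr_pdivlMr //; set z := hn _ (h - _).
  have z0 : 0 <= z by exact: hn_ge0.
  have : c * z <= `|c| * z by rewrite ler_wpM2r // ler_norm.
  lra.
have iso_nm (W : H -> H) : isometric W -> bounded_by 1 W.
  by move=> iW h; rewrite mul1r /hn iW.
have lcomp (S T : H -> H) : linear S -> linear T -> linear (S \o T).
  by move=> lS lT a h k /=; rewrite lT lS.
have bcomp (S T : H -> H) : bounded_by 1 S -> bounded_by 1 T -> bounded_by 1 (S \o T).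
  by move=> b1 b2 h; apply: le_trans (b1 _) _; rewrite mul1r; exact: b2.
have bU := iso_nm _ iU; have bV := iso_nm _ iV.
have bid : bounded_by 1 (@id H) by move=> h; rewrite mul1r.
have lid : linear (@id H) by [].
have UK : cancel U V.
  apply: (dense_eq (V \o U) id 1) => // [||x /=]; [exact: lcomp|exact: bcomp|].
  by rewrite Ux Vx st.
have VK : cancel V U.
  apply: (dense_eq (U \o V) id 1) => // [||x /=]; [exact: lcomp|exact: bcomp|].
  by rewrite Vx Ux ts.
exists U, V; split=> //.
- by move=> h k; rewrite -{1}[k]VK iU.
- move=> x; have /bounded_opP[lx [c c0 cx]] := rep_bounded pi x.
  have /bounded_opP[ly [d d0 dx]] := rep_bounded pi (s x).
  apply: (dense_eq (U \o pi x) (pi (s x) \o U) (c + d)).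
  + exact: lcomp.
  + exact: lcomp.
  + move=> h /=; apply: le_trans (bU _) _; rewrite mul1r; apply: le_trans (cx _) _.
    by rewrite ler_wpM2r ?hn_ge0 // lerDl.
  + move=> h /=; apply: le_trans (dx _) _; apply: ler_pM; rewrite ?hn_ge0 //.
      by rewrite lerDr.
    by have := bU h; rewrite mul1r.
  + by move=> y /=; rewrite -repMh !Ux rmorphM repMh.
- by rewrite -{1}[xi](rep1h pi) Ux rmorph1 rep1h.
Qed.

End ShiftUnitary.

Theorem weakly_spreadable_iff (R : realType) (A : cstarType (Cx R))
    (PN : freeProduct nat A) (PZ : freeProduct int A) (phi : state PN) (phiZ : state PZ)
    (H : hilbertType (Cx R)) (pi : starRep PZ H) (xi : H) :
  stationary_extension phi phiZ -> is_GNS phiZ pi xi ->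
  weakly_spreadable phi <->
  exists E : (H -> H) -> (H -> H),
    [/\ invariant_condexp PN pi xi E,
        forall E' : (H -> H) -> (H -> H), invariant_condexp PN pi xi E' ->
          forall T, future_vna PN pi T -> E' T = E T
      & forward_decoupling PN pi E].
Proof.
move=> [statZ ext] [gns cyclic].
have [U [V [[lU lV UK VK] UV Upi Uxi]]] :=
  automorphism_unitary gns cyclic (@shiftZK _ _ PZ) (@unshiftZK _ _ PZ) statZ.
split=> [ws|[E [iE _ dE]]]; last exact: (decoupling_spreadable gns ext iE dE).
exists (tail_limit U V); split.
- exact: (tail_limit_invariant lU lV UV UK VK Upi Uxi gns cyclic ext ws).
- move=> E iE T TR.
  exact: (invariant_condexp_unique lU lV UV UK VK Upi Uxi gns cyclic ext ws iE TR).
- exact: (tail_limit_decoupling lU lV UV UK VK Upi Uxi gns cyclic ext ws).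
Qed.

Theorem theorem6p7 (R : realType) (A : cstarType R[i])
    (PN : freeProduct nat A) (PZ : freeProduct int A)
    (X : qprocess A) (phi : state PN) (phiZ : state PZ)
    (H : hilbertType R[i]) (pi : starRep PZ H) (xi : H) :
  is_distribution X phi ->
  stationary phi ->
  stationary_extension phi phiZ ->
  is_GNS phiZ pi xi ->
  weakly_spreadable phi <->
  exists E : (H -> H) -> (H -> H),
    [/\ invariant_condexp PN pi xi E,
        forall E' : (H -> H) -> (H -> H), invariant_condexp PN pi xi E' ->
          forall T, future_vna PN pi T -> E' T = E T
      & forward_decoupling PN pi E].
Proof. by move=> _ _; exact: (@weakly_spreadable_iff R). Qed.
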